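(* Let $\mathcal{B}=\mathrm{ShST}(\lambda/\mu,n)$ (tableaux up to equivalence). For $1\le i\le n-1$ and $T\in\mathcal{B}$, let $(\varphi_i(T),\varepsilon_i(T)):=(x^{(i)},y^{(i)})$ be the endpoint of the $i$-th lattice walk of the reading word of $T$, and let $\mathrm{wt}(T)$ be the weight of $T$. Then: (a) for each $i$, any two of the operators $F_i,E_i,F_i',E_i'$ commute whenever both compositions are defined (e.g. $F_iF_i'(T)=F_i'F_i(T)$ whenever both sides are not $\varnothing$); (b) $(\mathcal{B},\{E_i,F_i\},\{\varepsilon_i,\varphi_i\},\mathrm{wt})$ and $(\mathcal{B},\{E_i',F_i'\},\{\varepsilon_i,\varphi_i\},\mathrm{wt})$ each satisfy the Kashiwara crystal axioms (K1) and (K2) for $\mathrm{GL}_n$.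
   Context: Kashiwara crystal axioms for $\mathrm{GL}_n$, for a set $\mathcal{B}$ with partial operators $e_i,f_i$, functions $\varepsilon_i,\varphi_i:\mathcal{B}\to\mathbb{Z}$ ($1\le i\le n-1$) and $\mathrm{wt}:\mathcal{B}\to\mathbb{Z}^n$: (K1) $e_i,f_i$ are partial inverses ($Y=e_i(X)$ iff $X=f_i(Y)$), and if $Y=e_i(X)$ then $(\varepsilon_i(Y),\varphi_i(Y))=(\varepsilon_i(X)-1,\varphi_i(X)+1)$ and $\mathrm{wt}(Y)=\mathrm{wt}(X)+\alpha_i$, where $\alpha_i$ has $1$ in position $i$, $-1$ in position $i+1$, and $0$ elsewhere; (K2) $\varphi_i(X)=\langle\mathrm{wt}(X),\alpha_i\rangle+\varepsilon_i(X)$ for all $i$ and $X$. Letters are ordered $1'<1<2'<2<\cdots$. Strings are equivalent if they differ only in whether, for some $i$, the first letter from $\{i',i\}$ is primed; words are equivalence classes. Weight $\mathrm{wt}(w)=(n_1,\dots,n_n)$ counts letters $i$ or $i'$. Standardization $\mathrm{std}(w)$ replaces letters by $1,\dots,N$ in increasing order of value, breaking ties among equal unprimed letters left to right and among equal primed letters right to left. $\mathrm{ShST}(\lambda/\mu,n)$: fillings of the shifted skew shape $\lambda/\mu$ ($\lambda,\mu$ strict partitions, row $r$ of a shifted diagram occupying columns $r,\dots,r+\lambda_r-1$) by letters from $\{1',1,\dots,n',n\}$, rows and columns weakly increasing, each unprimed letter at most once per column and each primed letter at most once per row; reading word = rows left to right, bottom row to top row; tableaux are equivalent if they have the same shape and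 equivalent reading words. Lattice walk of a word in $\{1',1,2',2\}$: start at $(0,0)$, one unit step per letter; at $(x,y)$ with $x>0,y>0$: $1'$ east, $1$ south, $2$ north, $2'$ west; when $x=0$ or $y=0$: $1,1'$ east and $2,2'$ north. The $i$-th lattice walk of $w$ is the walk of the subword of letters in $\{i',i,(i+1)',i+1\}$ with $i,i+1$ read as $1,2$. Operators on words in $\{1',1,2',2\}$: $E'(w)$ (resp. $F'(w)$) is the unique word with the same standardization and weight $\mathrm{wt}(w)+(1,-1)$ (resp. $-(1,-1)$), else $\varnothing$. For a representative $v$ and substring $u=v_k\cdots v_l$, with $(x,y)$ the walk position after $v_1\cdots v_{k-1}$: $u$ is $F$-critical of type 1F if $u=1(1')^m2'$ ($m\ge0$), ($y=0$ or ($y=1,x\ge1$)), transformed to $2'(1')^m2$; 2F if $u=1(2)^m1'$, ($x=0$ or ($x=1,y\ge1$)), transformed to $2'(2)^m1$; 3F if $u=1$, $y=0$, to $2$; 4F if $u=1'$, $x=0$, to $2'$; 5F if $u\in\{1,2'\}$, $x=1,y\ge1$ (undefined). $F(w)$ transforms the final $F$-critical substring over all representatives (largest starting index, then longest), and is $\varnothing$ if it has type 5F or none exists. $E$ is the same with $E$-critical types: 1E $u=2'(2)^m1$, ($x=0$ or ($x=1,y\ge1$)) $\mapsto1(2)^m1'$; 2E $u=2'(1')^m2$, ($y=0$ or ($y=1,x\ge1$)) $\mapsto1(1')^m2'$; 3E $u=2'$, $x=0$ $\mapsto1'$; 4E $u=2$, $y=0$ $\mapsto1$; 5E $u\in\{2',1\}$,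 $y=1,x\ge1$ (undefined). $E_i,F_i,E_i',F_i'$ act on the subword of letters in $\{i',i,(i+1)',i+1\}$ (reading $i,i+1$ as $1,2$), and on tableaux via reading words, keeping the shape. *)

(* Defs.v *)
From mathcomp Require Import all_boot all_order all_algebra.
Set Implicit Arguments. Unset Strict Implicit. Unset Printing Implicit Defensive.

(* A letter is a pair (k, p): k >= 1 is its index, p = true iff primed (k'). *)
Definition letter := (nat * bool)%type.
Definition idx (a : letter) : nat := a.1.
Definition primed (a : letter) : bool := a.2.
(* total order 1' < 1 < 2' < 2 < ... : value 2k-1 for k', 2k for k *)
Definition lval (a : letter) : nat := if a.2 then (a.1).*2.-1 else (a.1).*2.

Definition l1' : letter := (1, true).
Definition l1  : letter := (1, false).
Definition l2' : letter := (2, true).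
Definition l2  : letter := (2, false).

Definition first_occ (s : seq letter) (p : nat) : bool :=
  all (fun q => idx (nth l1 s q) != idx (nth l1 s p)) (iota 0 p).

Definition first_positions (s : seq letter) : seq nat :=
  [seq p <- iota 0 (size s) | first_occ s p].

Definition canon (s : seq letter) : seq letter :=
  [seq (if first_occ s p then (idx (nth l1 s p), false) else nth l1 s p)
  | p <- iota 0 (size s)].

Definition str_equiv (s t : seq letter) : bool := canon s == canon t.

Fixpoint reps_aux (ps : seq nat) (v : seq letter) : seq (seq letter) :=
  match ps with
  | [::] => [:: v]
  | p :: ps' =>
      reps_aux ps' (set_nth l1 v p (idx (nth l1 v p), false)) ++
      reps_aux ps' (set_nth l1 v p (idx (nth l1 v p), true))
  end.

Definition reps (s : seq letter) : seq (seq letter) :=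
  reps_aux (first_positions s) s.

Definition wt (s : seq letter) (j : nat) : nat := count (fun a => idx a == j) s.

Definition std (s : seq letter) : seq nat :=
  [seq (count (fun b => lval b < lval (nth l1 s j)) s
        + (if primed (nth l1 s j)
           then count (fun b => b == nth l1 s j) (drop j.+1 s)
           else count (fun b => b == nth l1 s j) (take j s))).+1
  | j <- iota 0 (size s)].

Definition step (xy : nat * nat) (a : letter) : nat * nat :=
  let x := xy.1 in let y := xy.2 in
  if (0 < x) && (0 < y) then
    if a == l1' then (x.+1, y)
    else if a == l1 then (x, y.-1)
    else if a == l2 then (x, y.+1)
    else if a == l2' then (x.-1, y)
    else (x, y)
  else if idx a == 1 then (x.+1, y)
  else if idx a == 2 then (x, y.+1)
  else (x, y).

Definition walk (s : seq letter) : nat * nat := foldl step (0, 0) s.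

(* crit xy u : None = not critical; Some None = type 5 (undefined);
   Some (Some u') = critical, to be transformed into u'. xy = walk position
   before u. *)
Definition critF (xy : nat * nat) (u : seq letter) : option (option (seq letter)) :=
  let x := xy.1 in let y := xy.2 in
  if (u == [:: l1]) && (y == 0) then Some (Some [:: l2])
  else if (u == [:: l1']) && (x == 0) then Some (Some [:: l2'])
  else if ((u == [:: l1]) || (u == [:: l2'])) && (x == 1) && (0 < y) then Some None
  else if 2 <= size u then
    let a := head l1 u in let z := last l1 u in
    let mid := take (size u - 2) (behead u) in
    if [&& a == l1, z == l2', all (pred1 l1') mid & (y == 0) || ((y == 1) && (0 < x))]
    then Some (Some (l2' :: mid ++ [:: l2]))
    else if [&& a == l1, z == l1', all (pred1 l2) mid & (x == 0) || ((x == 1) && (0 < y))]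
    then Some (Some (l2' :: mid ++ [:: l1]))
    else None
  else None.

Definition critE (xy : nat * nat) (u : seq letter) : option (option (seq letter)) :=
  let x := xy.1 in let y := xy.2 in
  if (u == [:: l2']) && (x == 0) then Some (Some [:: l1'])
  else if (u == [:: l2]) && (y == 0) then Some (Some [:: l1])
  else if ((u == [:: l2']) || (u == [:: l1])) && (y == 1) && (0 < x) then Some None
  else if 2 <= size u then
    let a := head l1 u in let z := last l1 u in
    let mid := take (size u - 2) (behead u) in
    if [&& a == l2', z == l1, all (pred1 l2) mid & (x == 0) || ((x == 1) && (0 < y))]
    then Some (Some (l1 :: mid ++ [:: l1']))
    else if [&& a == l2', z == l2, all (pred1 l1') mid & (y == 0) || ((y == 1) && (0 < x))]
    then Some (Some (l1 :: mid ++ [:: l2']))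
    else None
  else None.

Definition candidate := (nat * nat * seq letter * option (seq letter))%type.

Definition candidates crit (s : seq letter) : seq candidate :=
  flatten [seq flatten [seq pmap (fun l => omap (fun r => (k, l, v, r))
                                   (crit (walk (take k v)) (drop k (take l.+1 v))))
                              (iota k (size v - k))
                       | k <- iota 0 (size v)]
          | v <- reps s].

Definition better (c b : candidate) : bool :=
  (b.1.1.1 < c.1.1.1) || ((c.1.1.1 == b.1.1.1) && (b.1.1.2 < c.1.1.2)).

Definition final_cand (cs : seq candidate) : option candidate :=
  foldl (fun best c => match best with
                       | None => Some c
                       | Some b => if better c b then Some c else Some b end) None cs.

Definition crit_op crit (s : seq letter) : option (seq letter) :=
  match final_cand (candidates crit s) with
  | Some (k, l, v, Some u') => Some (take k v ++ u' ++ drop l.+1 v)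
  | _ => None
  end.

Definition Fw := crit_op critF.
Definition Ew := crit_op critE.

Fixpoint all_strings (N : nat) : seq (seq letter) :=
  match N with
  | 0 => [:: [::]]
  | N'.+1 => [seq a :: t | a <- [:: l1'; l1; l2'; l2], t <- all_strings N']
  end.

Definition unique_word (P : seq letter -> bool) (s : seq letter) : option (seq letter) :=
  match [seq v <- all_strings (size s) | [&& canon v == v, std v == std s & P v]] with
  | [:: v] => Some v
  | _ => None
  end.

Definition E'w (s : seq letter) : option (seq letter) :=
  unique_word (fun v => (wt v 1 == (wt s 1).+1) && ((wt v 2).+1 == wt s 2)) s.
Definition F'w (s : seq letter) : option (seq letter) :=
  unique_word (fun v => ((wt v 1).+1 == wt s 1) && (wt v 2 == (wt s 2).+1)) s.

Definition in_i (i : nat) (a : letter) : bool := (idx a == i) || (idx a == i.+1).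
Definition down (i : nat) (a : letter) : letter := ((idx a - i).+1, primed a).
Definition up (i : nat) (a : letter) : letter := ((idx a + i).-1, primed a).

Definition subword (i : nat) (s : seq letter) : seq letter :=
  [seq down i a | a <- s & in_i i a].

Fixpoint merge_back (i : nat) (s t : seq letter) : seq letter :=
  match s with
  | [::] => [::]
  | a :: s' =>
      if in_i i a then
        match t with
        | b :: t' => up i b :: merge_back i s' t'
        | [::] => a :: merge_back i s' t
        end
      else a :: merge_back i s' t
  end.

Definition lift_op (op : seq letter -> option (seq letter)) (i : nat)
  (s : seq letter) : option (seq letter) :=
  match op (subword i s) with
  | Some t => Some (canon (merge_back i s t))
  | None => None
  end.

Definition phi_ (i : nat) (s : seq letter) : nat := (walk (subword i s)).1.
Definition eps_ (i : nat) (s : seq letter) : nat := (walk (subword i s)).2.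

Definition strict_partition (l : seq nat) : bool :=
  all (fun r => 0 < r) l && sorted gtn l.

Definition contained (mu lam : seq nat) : bool :=
  (size mu <= size lam) && all (fun r => nth 0 mu r <= nth 0 lam r) (iota 0 (size lam)).

Definition rowlen (lam mu : seq nat) (r : nat) : nat := nth 0 lam r - nth 0 mu r.

(* rows (top row first, row index r = 0,1,...) recovered from a reading word,
   which lists rows left to right from the bottom row to the top row *)
Definition rows_of (lam mu : seq nat) (s : seq letter) : seq (seq letter) :=
  rev (reshape (rev [seq rowlen lam mu r | r <- iota 0 (size lam)]) s).

Definition reading_word (t : seq (seq letter)) : seq letter := flatten (rev t).

Definition in_shape (lam mu : seq nat) (r c : nat) : bool :=
  (r < size lam) && (r + nth 0 mu r <= c < r + nth 0 lam r).

Definition entry (lam mu : seq nat) (t : seq (seq letter)) (r c : nat) : letter :=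
  nth l1 (nth [::] t r) (c - r - nth 0 mu r).

Definition valid_filling (n : nat) (lam mu : seq nat) (t : seq (seq letter)) : bool :=
  let R := iota 0 (size lam) in
  let C := iota 0 (head 0 lam) in
  let e := entry lam mu t in
  [&& size t == size lam,
      all (fun r => size (nth [::] t r) == rowlen lam mu r) R,
      all (fun row => all (fun a => (1 <= idx a <= n)) row) t,
      all (fun r => all (fun c => all (fun c' =>
          (in_shape lam mu r c && in_shape lam mu r c' && (c < c')) ==>
          ((lval (e r c) <= lval (e r c')) && ~~ (primed (e r c) && (e r c == e r c'))))
        C) C) R &
      all (fun c => all (fun r => all (fun r' =>
          (in_shape lam mu r c && in_shape lam mu r' c && (r < r')) ==>
          ((lval (e r c) <= lval (e r' c)) && ~~ (~~ primed (e r c) && (e r c == e r' c))))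
        R) R) C].

(* element of ShST(lam/mu, n), represented by the canonical representative of
   its reading word: some representative is the reading word of a valid tableau *)
Definition inB (n : nat) (lam mu : seq nat) (s : seq letter) : bool :=
  [&& canon s == s,
      size s == sumn [seq rowlen lam mu r | r <- iota 0 (size lam)] &
      has (fun v => valid_filling n lam mu (rows_of lam mu v)) (reps s)].

Inductive opname := OpF | OpE | OpF' | OpE'.

Definition op_word (o : opname) : seq letter -> option (seq letter) :=
  match o with OpF => Fw | OpE => Ew | OpF' => F'w | OpE' => E'w end.

Definition Top (o : opname) (i : nat) (s : seq letter) : option (seq letter) :=
  lift_op (op_word o) i s.

Import GRing.Theory.
Local Open Scope ring_scope.
Definition alpha (i j : nat) : int := Posz (j == i) - Posz (j == i.+1).

Definition kashiwara_K1_K2 (n : nat) (lam mu : seq nat) (i : nat)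
  (e f : seq letter -> option (seq letter)) : Prop :=
  let B := inB n lam mu in
  [/\ (forall X Y, B X -> e X = Some Y -> B Y),
      (forall X Y, B X -> f X = Some Y -> B Y),
      (forall X Y, B X -> B Y -> (e X = Some Y <-> f Y = Some X)),
      (forall X Y, B X -> B Y -> e X = Some Y ->
         [/\ (Posz (eps_ i Y)) = (Posz (eps_ i X)) - 1,
             (Posz (phi_ i Y)) = (Posz (phi_ i X)) + 1 &
             forall j, (1 <= j <= n)%N -> (Posz (wt Y j)) = (Posz (wt X j)) + alpha i j]) &
      (forall X, B X ->
         (Posz (phi_ i X)) = ((Posz (wt X i)) - (Posz (wt X i.+1))) + (Posz (eps_ i X)))].

(* Main.v *)
Require Import Defs.
From mathcomp Require Import all_boot all_order all_algebra zify.
Set Implicit Arguments. Unset Strict Implicit. Unset Printing Implicit Defensive.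

(** Choose in every word the representative whose first letter of each index is 1' or 2.
All four operators then satisfy short recursions on the last letter. Up to passing to the chosen
representative, F'(w 1) = w 2', F'(w 1') = F'(w) 1' if w has an index 1 and w 2' otherwise,
F'(w 2) = F'(w) 2 and F'(w 2') is undefined; F(w a) is F(w) a except near the boundary of the
quadrant, where it is w a or F'(w) a with the letter a changed, or undefined.
Inverses, commutation and the effect on the endpoint and the weight follow by induction on w.
That F picks the final critical substring is an induction showing which candidates end at the
last letter; that F' is characterized by the standardization follows since equality of
standardizations amounts to equality of the order relations between the positions of the two words.
The latter also gives the stability of tableaux under E' and F'. For E and F, a move changes a
critical block 1 (1')^m 2', 1 (2)^m 1', 1 or 1', after which every 1 and every 2' lies at a point with
x >= 2 and y >= 1; comparing the walk at an entry with the walk at its upper and lower neighbours in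
the shape shows that no row or column condition can break. *)

(** The letters 1' and 2 step in the same direction everywhere, while 1 and 2' turn inwards off the
    axes; below, the former are called free and the latter mixed. A first letter of its index is
    read while the coordinate of that index is 0, where both letters of the index step alike, so
    taking it free does not change the walk. Since the definition of F ranges over all
    representatives, one normal form per class is what allows their results to be compared. The
    recursion closes because a critical substring 1 (1')^m 2' or 1 (2)^m 1' without its last letter
    is a 1 followed by free letters, and on a word with such an end F' changes exactly that 1 into
    2'. Exchanging the indices while keeping letters free or mixed interchanges the coordinates and
    turns F into E and F' into E'; hence a single Boolean [b]. This exchange does not preserve the
    conditions on tableaux, so stability needs separate inequalities for F and for E. *)

Lemma omap_some (A B : Type) (f : A -> B) o y :
  omap f o = Some y -> exists2 x, o = Some x & y = f x.
Proof. by case: o => //= x [<-]; exists x. Qed.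

Ltac osome s E := let H := fresh in move=> H; case: (omap_some H) => {H} s E; first [move=> -> | move=> _].

Ltac brk := repeat match goal with
  | |- context[if ?c then _ else _] => let h := fresh "c" in case: (boolP c) => h
  | H : context[if ?c then _ else _] |- _ => let h := fresh "c" in move: H; case: (boolP c) => h H
  end.

(** * Recursive operators on reversed words *)

(* (j, f): j tells whether the index is 2, f whether the letter always steps away from its axis, so
   that 1' = (false, true), 1 = (false, false), 2 = (true, true), 2' = (true, false). With b = true
   in place of b = false, the F-operators become the E-operators. Words are reversed: the head of
   the list is the last letter. *)
Definition sletter := (bool * bool)%type.

Section ReversedWords.
Implicit Types (a c : sletter) (w t u p q v : seq sletter) (b : bool).

Definition hasi b w := has (fun a => a.1 == b) w.

(* pos w false and pos w true are the coordinates x and y of the end of the walk. *)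
Fixpoint pos w b : nat :=
  if w is a :: w' then
    if [|| a.2, pos w' b == 0 | pos w' (~~ b) == 0] then (a.1 == b) + pos w' b
    else pos w' b - (a.1 != b)
  else 0.

(** Appends a letter to a normal form. The first letter of each index is taken free, so that each
    class keeps exactly one word. *)
Definition sn a w := (a.1, a.2 || ~~ hasi a.1 w) :: w.
Notation osn a := (omap (sn a)).

Fixpoint nfp w := if w is a :: w' then (a.2 || hasi a.1 w') && nfp w' else true.

Fixpoint flipP b w : option (seq sletter) :=
  if w is a :: w' then
    if a.1 == b then
      if a.2 && hasi b w' then osn a (flipP b w') else Some (sn (~~ b, false) w')
    else if a.2 then osn a (flipP b w') else None
  else None.

(** The two calls of [flipP] are the types with a middle block, [a] being the last letter of the
    block; the results built directly from [w'] are types 4 and 3. For a mixed letter, [None] is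
    type 5 when the coordinate b is 1 and the other one positive. At coordinate 0 nothing is lost,
    since a defined move lowers the coordinate b. *)
Fixpoint flip b w : option (seq sletter) :=
  if w is a :: w' then
    let x := pos w' b in let y := pos w' (~~ b) in
    if a.1 == b then
      if a.2 then
        if x == 0 then Some (sn (~~ b, false) w')
        else if (x == 1) && flipP b w' then osn (b, false) (flipP b w')
        else osn a (flip b w')
      else if y == 0 then Some (sn (~~ b, true) w')
      else if x <= 1 then None else osn a (flip b w')
    else if a.2 then osn a (flip b w')
    else if x == 0 then None
    else if y == 0 then osn (~~ b, true) (flipP b w')
    else if x <= 1 then None else osn a (flip b w')
  else None.

Lemma sn_nfp a w : nfp w -> nfp (sn a w).
Proof. by rewrite /sn /= => ->; rewrite -orbA orNb orbT. Qed.

Lemma sn_id a w : nfp (a :: w) -> sn a w = a :: w.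
Proof. by case: a => j [] //=; rewrite /sn /= => /andP[-> _]. Qed.

Lemma pos_hasi b w : ~~ hasi b w -> pos w b = 0.
Proof.
elim: w => //= a w IH; rewrite negb_or => /andP[/negbTE ab /IH ->].
by rewrite orbT /= ab.
Qed.

(** The walk never returns to the origin: an inward step is taken only where both coordinates are
    positive, and it lowers just one of them. *)
Lemma pos0 w b : pos w b = 0 -> pos w (~~ b) = 0 -> w = [::].
Proof.
case: w => //= a w; rewrite negbK.
case: a => j f /=; case: f; case: j; case: b => /=;
  do ?[case: eqP => /= ?]; lia.
Qed.

Lemma pos_sn a w b : pos (sn a w) b = pos (a :: w) b.
Proof.
rewrite /sn /=; case: (boolP (hasi a.1 w)) => [_|/pos_hasi]; first by rewrite orbF.
by case: a => -[] [] //=; case: b => //= ->; rewrite ?orbT.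
Qed.

Definition cnt b w := count (fun a => a.1 == b) w.

Lemma pos_le_cnt w b : pos w b <= cnt b w.
Proof. by rewrite /cnt; elim: w => //= a w IH; case: ifP => _; lia. Qed.

Lemma hasi_cnt b w : hasi b w = (0 < cnt b w).
Proof. by rewrite /hasi has_count. Qed.

Lemma pos_cnt b w : ~~ hasi (~~ b) w -> pos w b = cnt b w.
Proof.
elim: w => //= a w IH /norP[ab h]; rewrite (pos_hasi h) eqxx !orbT (IH h) /=.
by [].
Qed.

(** Each letter of index b changes the difference of the coordinates by one in favour of b, whether
    it steps outwards in its own coordinate or inwards in the other. This becomes (K2). *)
Lemma pos_balance b w : pos w b + cnt (~~ b) w = pos w (~~ b) + cnt b w.
Proof.
elim: w => //= -[j f] w; rewrite negbK /cnt /=.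
by case: j; case: b; case: f => /= IH; brk; lia.
Qed.

(** The coordinates settle the boundary cases of the inductions, and the counts settle which indices
    still occur, hence which letters get normalized. Both halves become (K1). *)
Definition moved b w t :=
  [/\ nfp t, pos w b = (pos t b).+1, pos t (~~ b) = (pos w (~~ b)).+1,
      cnt b w = (cnt b t).+1 & cnt (~~ b) t = (cnt (~~ b) w).+1].

Lemma moved_sn b a c w s : nfp s ->
  pos (a :: w) b = (pos (c :: s) b).+1 ->
  pos (c :: s) (~~ b) = (pos (a :: w) (~~ b)).+1 ->
  cnt b (a :: w) = (cnt b (c :: s)).+1 ->
  cnt (~~ b) (c :: s) = (cnt (~~ b) (a :: w)).+1 -> moved b (a :: w) (sn c s).
Proof. by move=> n1 n2 n3 n4 n5; split; rewrite ?pos_sn //; apply: sn_nfp. Qed.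

Lemma flipP_moved b w t : nfp w -> flipP b w = Some t -> moved b w t.
Proof.
elim: w t => //= a w IH t /= /andP[jw nw].
have h0 := @pos_hasi b w.
have {IH} H s : flipP b w = Some s -> moved b w s := fun E => IH s nw E.
case: a b jw h0 H => -[] [] [] /= jw h0 H; rewrite ?andbT ?andbF /=; brk => //;
  try (by osome s E; have [n1 n2 n3 n4 n5] := H s E; apply: moved_sn; move: n2 n3 n4 n5 => /= n2 n3 n4 n5; brk; lia);
  move=> [<-]; apply: moved_sn => //=; try (have := h0 ltac:(done)); brk; lia.
Qed.

(** Free letters step alike everywhere. A mixed letter is passed over only where the coordinate b is
    at least 2 and the other at least 1; after the shift by (-1, +1) the walk is still off the axes,
    so the letter steps in the same direction. *)
Lemma flip_moved b w t : nfp w -> flip b w = Some t -> moved b w t.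
Proof.
elim: w t => //= a w IH t /= /andP[jw nw].
have h0 := @pos_hasi (~~ b) w.
have {IH} H s : flip b w = Some s -> moved b w s := fun E => IH s nw E.
have HP s := @flipP_moved b w s nw.
case: a b jw h0 H HP => -[] [] [] /= jw h0 H HP; brk => //;
  try (by osome s E; have [n1 n2 n3 n4 n5] := HP s E; apply: moved_sn; move: n2 n3 n4 n5 => /= n2 n3 n4 n5; brk; lia);
  try (by osome s E; have [n1 n2 n3 n4 n5] := H s E; apply: moved_sn; move: n2 n3 n4 n5 => /= n2 n3 n4 n5; brk; lia);
  move=> [<-]; apply: moved_sn => //=; try (have := h0 ltac:(done)); brk; lia.
Qed.

(** * Inverses and commutation of the recursive operators *)

Ltac hb := repeat (rewrite /= ?andbT ?andbF ?orbT ?orbF; match goal with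
  | H : is_true (hasi ?b ?w) |- context[hasi ?b ?w] => rewrite H
  | H : is_true (~~ hasi ?b ?w) |- context[hasi ?b ?w] => rewrite (negbTE H)
  | H : is_true (hasi ?b ?w), H' : is_true (~~ hasi ?b ?w) |- _ => by rewrite H in H'
  | |- context[hasi ?b ?w] => let h := fresh "h" in case: (boolP (hasi b w)) => h
  end); rewrite /= ?andbT ?andbF ?orbT ?orbF.

Ltac hcnt := repeat match goal with H : context[hasi _ _] |- _ => rewrite hasi_cnt in H end.

Lemma moved_hasi b w t : moved b w t -> hasi b w /\ hasi (~~ b) t.
Proof.
by case=> _ e1 e2 _ _; split; apply: contraT => /pos_hasi; rewrite ?e1 ?e2.
Qed.

Ltac close := rewrite /sn /=; hb => //; rewrite /sn /=; hb => //.

Lemma flipPK b w t : nfp w -> flipP b w = Some t -> flipP (~~ b) t = Some w.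
Proof.
elim: w t => //= a w IH t /andP[jw nw].
have {IH} H s : flipP b w = Some s -> flipP (~~ b) s = Some w := fun E => IH s nw E.
have hP s (E : flipP b w = Some s) := moved_hasi (flipP_moved nw E).
case: a b jw H hP => -[] [] [] //= jw H hP; hb.
all: try (osome s E; rewrite /= (H s E); case: (hP s E) => h1 h2).
all: try move=> [<-].
all: close.
Qed.

(** A word in the index b alone runs along an axis. There the two recursions differ only in the mark
    of a letter that is the first of its index, and normalization removes this difference. *)
Lemma flip_eqP b w : nfp w -> ~~ hasi (~~ b) w -> flip b w = flipP b w.
Proof.
elim: w => //= a w IH /andP[jw nw] /norP[j h].
have y0 := pos_hasi h.
have hP s (E : flipP b w = Some s) := moved_hasi (flipP_moved nw E).
have x0 := @pos0 w b.
have hC s (E : flipP b w = Some s) := flipP_moved nw E.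
have p1 := pos_cnt h.
have h0 := @pos_hasi b w.
rewrite IH //.
case: a b jw j h y0 hP x0 h0 hC p1 {IH} => -[] [] [] //= jw j h y0 hP x0 h0 hC p1.
all: rewrite ?y0 ?jw /=; hb.
all: brk => //.
all: try by rewrite (x0 (eqP c)) in h1 *.
all: try by rewrite h0 in c.
all: try by close.
all: case E: (flipP _ w) => [s|] //=; rewrite /sn /=; case: (hC s E) => _ n2 n3 n4 n5; hb => //.
all: try by rewrite hasi_cnt in h2; lia.
Qed.

(* At y = 0 the two operators can only be undone by one another when they act on a one-letter word. *)
Lemma flip_flipP_back b w t s : nfp w -> pos w (~~ b) = 0 ->
  flip b w = Some t -> flipP (~~ b) t = Some s -> s = w /\ ~~ hasi (~~ b) w.
Proof.
elim: w t s => //= a w IH t s /andP[jw nw] py.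
have hC r (E : flipP b w = Some r) := flipP_moved nw E.
have hF r (E : flip b w = Some r) := flip_moved nw E.
have hCK r (E : flipP b w = Some r) := flipPK nw E.
have hE r (E : flipP (~~ b) w = Some r) := flipP_moved nw E.
have {IH} H r u (e : pos w (~~b) = 0) (E : flip b w = Some r) (E' : flipP (~~ b) r = Some u) := IH r u nw e E E'.
have x0 := @pos0 w b.
have h0 := @pos_hasi b w.
have h1 := @pos_hasi (~~ b) w.
have pc := @pos_cnt b w.
case: a b jw py H hC hF hCK hE x0 h0 h1 pc => -[] [] [] //= jw py H hC hF hCK hE x0 h0 h1 pc; brk; try lia.
all: try by move: (x0 ltac:(lia) ltac:(lia)) => w0; subst w; move=> [<-] /= [<-].
all: try done.
all: try by move=> [<-]; rewrite /sn /=; hb => //; [osome u E'; case: (hE u E'); lia | move=> [<-]; rewrite /sn /= ?jw].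
all: osome r E.
all: first [have [_ n2 n3 n4 n5] := hC r E | have [_ n2 n3 n4 n5] := hF r E].
all: move: n2 n3 n4 n5 => /= n2 n3 n4 n5; rewrite /sn /=.
all: try by osome u E'; case: (H r u ltac:(lia) E E') => -> h2; rewrite /sn /= ?jw.
all: hb => //.
all: try (osome u E'; have := hCK r E; rewrite E' => -[<-]; rewrite /sn /= ?jw; hb => //; split=> //).
all: exfalso; move: (pos_balance true w) (pos_le_cnt r true) (pos_le_cnt r false) => /=; hcnt; lia.
Qed.

(** A mixed letter passed over at (x, y) with x >= 2 and y >= 1 is met at (x - 1, y + 1) on the way
    back and passed over again. The delicate case is a free letter of index [~~ b] at y = 0, where
    the way back may call [flipP]; by [flip_flipP_back] that index did not occur before, so
    normalization makes the two results equal. *)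
Lemma flipK b w t : nfp w -> flip b w = Some t -> flip (~~ b) t = Some w.
Proof.
elim: w t => //= a w IH t /andP[jw nw].
have hC r (E : flipP b w = Some r) := flipP_moved nw E.
have hF r (E : flip b w = Some r) := flip_moved nw E.
have hCK r (E : flipP b w = Some r) := flipPK nw E.
have hB r s e (E : flip b w = Some r) (E' : flipP (~~ b) r = Some s) := flip_flipP_back nw e E E'.
have x0 := @pos0 w b.
have h0 := @pos_hasi b w.
have h1 := @pos_hasi (~~ b) w.
have {IH} H r (E : flip b w = Some r) := IH r nw E.
have hN r (n : nfp r) (E : ~~ hasi b r) : flip (~~ b) r = flipP (~~ b) r.
  by apply: flip_eqP; rewrite // negbK.
case: a b jw H hC hF hCK hB x0 h0 h1 hN => -[] [] [] /= jw H hC hF hCK hB x0 h0 h1 hN; brk; try lia.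
all: try done.
all: try (osome r E; first [have [n1 n2 n3 n4 n5] := hC r E | have [n1 n2 n3 n4 n5] := hF r E];
  move: n2 n3 n4 n5 => /= n2 n3 n4 n5; rewrite /sn /=).
all: try move=> [<-]; rewrite /sn /=.
all: hb; brk; try lia.
all: rewrite /sn /= ?jw.
all: try by hb.
all: try by rewrite (hCK r E) /=; hb.
all: try by rewrite (H r E) /=; hb.
all: try by rewrite hN // (hCK r E) /=; hb.
all: try by rewrite (x0 ltac:(lia) ltac:(lia)).
all: try by exfalso; move: (pos_le_cnt r true) (pos_le_cnt r false); hcnt; lia.
all: match goal with c : context[isSome (flipP _ _)] |- _ => move: c end.
all: try by rewrite (hCK r E) /= andbT; lia.
all: move=> /andP[/eqP e1]; case E': (flipP _ r) => [s|] // _; case: (hB r s ltac:(lia) E E') => -> h2 /=; hb => //.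
Qed.

(** The changed letter blocks a second application unless it has become the first of its index. Then
    only letters of index b precede it and only free letters follow, so the walk never loses from
    the coordinate b. *)
Lemma flipP_twice b w t t' : nfp w -> flipP b w = Some t -> flipP b t = Some t' ->
  flip b w = Some t /\ pos w b = cnt b w.
Proof.
elim: w t t' => //= a w IH t t' /andP[jw nw].
have hC r (E : flipP b w = Some r) := flipP_moved nw E.
have {IH} H r r' (E : flipP b w = Some r) (E' : flipP b r = Some r') := IH r r' nw E E'.
have hN (E : ~~ hasi (~~ b) w) : flip b w = flipP b w by apply: flip_eqP.
have x0 := @pos0 w b.
have h0 := @pos_hasi b w.
have h1 := @pos_hasi (~~ b) w.
have pc := @pos_cnt b w.
have hl := pos_le_cnt w b.
case: a b jw H hC x0 h0 h1 hN pc hl => -[] [] [] /= jw H hC x0 h0 h1 hN pc hl; brk; try lia.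
all: try done.
all: try by move=> [<-]; rewrite /sn /=; hb => // _; exfalso; have := h1 h; lia.
all: try by move=> [<-]; rewrite /sn /=; hb => // _; have := h1 h; have := pc h; split=> //; lia.
all: try by move=> [<-]; rewrite /sn /=; hb => // _; split=> //; have := h0 c; hcnt; lia.
all: osome r E; have [n1 n2 n3 n4 n5] := hC r E; rewrite /sn /=; hb.
all: try (osome r' E'; have [H1 H2] := H r r' E E').
all: try (move: n2 n3 n4 n5 => /= n2 n3 n4 n5).
all: try by exfalso; hcnt; lia.
all: try by rewrite ?E ?H1 /sn /=; hb; split=> //; lia.
all: try by move=> _; rewrite E /=; hb; split=> //; hcnt; lia.
all: by exfalso; rewrite E /= andbT in c1; hcnt; lia.
Qed.

(** The equality is between options, so one composite is defined as soon as the other is. This is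
    the form that the induction carries, and it is also what the mixed pair of E and F operators
    relies on. *)
Lemma flip_flipP_comm b w f p : nfp w -> flip b w = Some f -> flipP b w = Some p ->
  flip b p = flipP b f.
Proof.
elim: w f p => //= a w IH f p /andP[jw nw].
have hC r (E : flipP b w = Some r) := flipP_moved nw E.
have hF r (E : flip b w = Some r) := flip_moved nw E.
have hT r r' (E : flipP b w = Some r) (E' : flipP b r = Some r') := flipP_twice nw E E'.
have {IH} H r r' (E : flip b w = Some r) (E' : flipP b w = Some r') := IH r r' nw E E'.
have hN (E : ~~ hasi (~~ b) w) : flip b w = flipP b w by apply: flip_eqP.
have x0 := @pos0 w b.
have h0 := @pos_hasi b w.
have h1 := @pos_hasi (~~ b) w.
have hZ : ~~ hasi b w -> flip b w = None /\ flipP b w = None.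
  move=> h; split.
    by case E: (flip b w) => [r|] //; have [] := moved_hasi (hF r E); rewrite (negbTE h).
  by case E: (flipP b w) => [r|] //; have [] := moved_hasi (hC r E); rewrite (negbTE h).
case: a b jw H hC hF hT x0 h0 h1 hN hZ => -[] [] [] /= jw H hC hF hT x0 h0 h1 hN hZ; brk; try lia.
all: try done.
all: try (osome r E; first [have [n1 n2 n3 n4 n5] := hF r E | have [n1 n2 n3 n4 n5] := hC r E];
  move: n2 n3 n4 n5 => /= n2 n3 n4 n5).
all: try move=> [<-].
all: try (osome r' E'; first [have [n1' n2' n3' n4' n5'] := hF r' E' | have [n1' n2' n3' n4' n5'] := hC r' E'];
  move: n2' n3' n4' n5' => /= n2' n3' n4' n5').
all: try move=> [<-].
all: try by exfalso; lia.
all: rewrite /sn /=.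
all: try by rewrite (H r r' E E').
all: try by case: (hZ ltac:(done)) => -> ->; hb; brk.
all: try by rewrite andNb; rewrite E in E'; case: E' => ->; case/andP: c0 => /eqP e1 _; case: eqP => //; lia.
all: try by case: (boolP (hasi _ w)) => h2; last (by rewrite hN);
  rewrite /= ifF; [by rewrite c | apply/negbTE/eqP => e; move: jw; rewrite x0 //; lia].
all: try by rewrite andNb; case: ifP => [/h1|/negbFE h2]; [lia | rewrite !ifF ?E /= /sn ?h2 //=; lia].
all: rewrite E' andbT in c0; case: eqP => e0; first lia.
all: case: (boolP (hasi _ r)) => hr; last (by exfalso; clear - n2 n2' hr e0; hcnt; move: (pos_le_cnt r true) (pos_le_cnt r false); lia).
(* The remaining clash is a free letter that the second [flip] meets at coordinate 1. There [flipP]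
   applies twice, and [flipP_twice] identifies the two operators on [w]. *)
all: case: ifP => [/andP[/eqP e1]|_]; last (by rewrite (H r r' E E')).
all: case E3: (flipP _ r') => [r3|] // _; have [e2 e3] := hT r' r3 E' E3; rewrite e2 in E; case: E => <-; rewrite E3 /= (_ : hasi _ r3 = false) //.
all: by have [_ _ _ m4 m5] := flipP_moved n1' E3; clear - m4 m5 n4' e1 e3 n2'; move: m4 m5 => /= m4 m5; apply/negbTE; rewrite hasi_cnt; lia.
Qed.

(** Since [w] is the image of [p] under [flipP b], commutation at [p] gives [f] as the image of [v]
    under [flipP b]; inverting this step gives the claim. *)
Lemma flip_flipP_comm_inv b w f p : nfp w -> flip b w = Some f -> flipP (~~ b) w = Some p ->
  forall u v, flipP (~~ b) f = Some u -> flip b p = Some v -> u = v.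
Proof.
move=> nw Ef Ep u v Eu Ev.
have np : nfp p by case: (flipP_moved nw Ep).
have Ew : flipP b p = Some w by have := flipPK nw Ep; rewrite negbK.
have := flip_flipP_comm np Ev Ew; rewrite Ef => /esym Euv.
have nv : nfp v by case: (flip_moved np Ev).
by have := flipPK nv Euv; rewrite Eu => -[].
Qed.

(** * Normal forms of arbitrary words and critical substrings *)

Fixpoint nf v := if v is a :: v' then sn a (nf v') else [::].

Lemma nf_nfp v : nfp (nf v). Proof. by elim: v => //= a v IH; apply: sn_nfp. Qed.

Lemma nf_id w : nfp w -> nf w = w.
Proof. by elim: w => //= a w IH /andP[h n]; rewrite IH // sn_id //= h. Qed.

Lemma hasi_nf b v : hasi b (nf v) = hasi b v.
Proof. by elim: v => //= a v IH; rewrite -IH. Qed.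

Lemma pos_nf v b : pos (nf v) b = pos v b.
Proof. by elim: v b => // a v IH b; rewrite [nf _]/= pos_sn /= !IH. Qed.

Lemma cnt_nf b v : cnt b (nf v) = cnt b v.
Proof. by rewrite /cnt; elim: v => //= a v ->. Qed.

Lemma size_nf v : size (nf v) = size v.
Proof. by elim: v => //= a v ->. Qed.

Lemma drop_nf n v : drop n (nf v) = nf (drop n v).
Proof. by elim: v n => [|a v IH] [|n] //=. Qed.

(** The letter [(b, false)] precedes [q] in the word, so no letter of [q] counts as the first of
    index b, and all of [q] is passed over. *)
Lemma flipP_nf b q p : all snd q ->
  flipP b (nf (q ++ (b, false) :: p)) = Some (nf (q ++ (~~ b, false) :: p)).
Proof.
elim: q => [_|[j f] q IH /= /andP[-> /IH E]] /=.
  rewrite eqxx; case: (boolP (hasi b (nf p))) => h //=.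
rewrite hasi_nf /hasi has_cat /= eqxx orbT E.
by case: eqP => [<-|] //.
Qed.

(** A first letter of index b is changed as if it were mixed; the representative is chosen so that
    it is. *)
Lemma flipP_decomp b w t : nfp w -> flipP b w = Some t ->
  exists q p, [/\ all snd q, nf (q ++ (b, false) :: p) = w & nf (q ++ (~~ b, false) :: p) = t].
Proof.
elim: w t => //= a w IH t /andP[jw nw].
have {IH} H r (E : flipP b w = Some r) := IH r nw E.
case: ifP => [/eqP ab|ab].
  case: ifP => [/andP[af h]|hf [<-]].
    osome r E; have [q [p [q1 q2 q3]]] := H r E.
    by exists (a :: q), p; rewrite /= af q1 q2 q3 sn_id //= jw.
  exists [::], w; rewrite /= !nf_id //; split=> //.
  case: a ab jw hf => j f /= <-.
  by rewrite /sn /=; case: f => /= [_ ->|-> _].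
case: ifP => // af; osome r E; have [q [p [q1 q2 q3]]] := H r E.
by exists (a :: q), p; rewrite /= af q1 q2 q3 sn_id //= jw.
Qed.

(** [critF] for b = false and [critE] for b = true: the exchange of indices sends 1, 1', 2, 2' to
    2', 2, 1', 1. Here [x] is the coordinate b and [y] the other one, so the two are swapped for
    E. *)
Definition critg b (x y : nat) u : option (option (seq sletter)) :=
  let m := (b, false) in let o := (b, true) in
  let m' := (~~ b, false) in let o' := (~~ b, true) in
  if (u == [:: m]) && (y == 0) then Some (Some [:: o'])
  else if (u == [:: o]) && (x == 0) then Some (Some [:: m'])
  else if ((u == [:: m]) || (u == [:: m'])) && (x == 1) && (0 < y) then Some None
  else if 2 <= size u then
    let a := head m u in let z := last m u in
    let mid := take (size u - 2) (behead u) in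
    if [&& a == m, z == m', all (pred1 o) mid & (y == 0) || ((y == 1) && (0 < x))]
    then Some (Some (m' :: mid ++ [:: o']))
    else if [&& a == m, z == o, all (pred1 o') mid & (x == 0) || ((x == 1) && (0 < y))]
    then Some (Some (m' :: mid ++ [:: m]))
    else None
  else None.

Variant critg_spec b x y : seq sletter -> option (seq sletter) -> Prop :=
  | Crit3 of y = 0 : critg_spec b x y [:: (b, false)] (Some [:: (~~ b, true)])
  | Crit4 of x = 0 : critg_spec b x y [:: (b, true)] (Some [:: (~~ b, false)])
  | Crit5 c of x = 1 & 0 < y & c.2 = false : critg_spec b x y [:: c] None
  | Crit1 k of (y = 0) \/ (y = 1 /\ 0 < x) :
      critg_spec b x y ((b, false) :: nseq k (b, true) ++ [:: (~~ b, false)])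
        (Some ((~~ b, false) :: nseq k (b, true) ++ [:: (~~ b, true)]))
  | Crit2 k of (x = 0) \/ (x = 1 /\ 0 < y) :
      critg_spec b x y ((b, false) :: nseq k (~~ b, true) ++ [:: (b, true)])
        (Some ((~~ b, false) :: nseq k (~~ b, true) ++ [:: (b, false)])).

(** The tests in [critg] exclude one another, so their order is immaterial. *)
Lemma critgP b x y u r : critg b x y u = Some r <-> critg_spec b x y u r.
Proof.
split.
- rewrite /critg; case: ifP => [/andP[/eqP -> /eqP y0] [<-]|h1]; first by constructor.
  case: ifP => [/andP[/eqP -> /eqP y0] [<-]|h2]; first by constructor.
  case: ifP => [/andP[/andP[/orP h /eqP x1] y0] [<-]|h3].
    by case: h => /eqP ->; constructor.
  case: ifP => // s2; case: u s2 {h1 h2 h3} => [|a u] //=; case: (lastP u) => // mid z _.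
  rewrite last_rcons size_rcons subSS subn1 /= -cats1 take_size_cat //.
  case: ifP => [/and4P[/eqP -> /eqP -> /all_pred1P -> h] [<-]|_].
    by constructor; case/orP: h => [/eqP|/andP[/eqP]]; [left | right].
  case: ifP => [/and4P[/eqP -> /eqP -> /all_pred1P -> h] [<-]|_] //.
  by constructor; case/orP: h => [/eqP|/andP[/eqP]]; [left | right].
- case=> [->|->|c -> y0 c2|k h|k h]; rewrite /critg.
  + by rewrite !eqxx.
  + by rewrite !eqxx /=; case: ifP => // /andP[/eqP].
  + by case: c c2 => j f /= ->; case: y y0 => // y _; case: j; case: b.
  + have s2 : 1 < size ((b, false) :: nseq k (b, true) ++ [:: (~~ b, false)]) by rewrite /= size_cat /= addn1.
    rewrite s2; have ns c : ((b, false) :: nseq k (b, true) ++ [:: (~~ b, false)] == [:: c]) = false.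
      by apply/eqP => e; rewrite e in s2.
    rewrite !ns /= last_cat /= !eqxx size_cat /= addn1 subSS subn1 /= take_size_cat //=.
    have -> : (y == 0) || (y == 1) && (0 < x) by lia.
    by rewrite all_pred1_nseq.
  + have s2 : 1 < size ((b, false) :: nseq k (~~ b, true) ++ [:: (b, true)]) by rewrite /= size_cat /= addn1.
    rewrite s2; have ns c : ((b, false) :: nseq k (~~ b, true) ++ [:: (b, true)] == [:: c]) = false.
      by apply/eqP => e; rewrite e in s2.
    rewrite !ns /= last_cat /= !eqxx size_cat /= addn1 subSS subn1 /= take_size_cat //=.
    have -> : (x == 0) || (x == 1) && (0 < y) by lia.
    rewrite all_pred1_nseq /=.
    by case: b {s2 ns}.
Qed.

(* A critical substring u at positions k..l of some representative q ++ rev u ++ p of w, with rh the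
   normalized result of its transformation (None for type 5); scand: one that ends at the last letter. *)
Definition cand b w k l rh := exists q u p r,
  [/\ nf (q ++ rev u ++ p) = w, size p = k, k + size u = l.+1,
      critg_spec b (pos p b) (pos p (~~ b)) u r
    & rh = omap (fun u' => nf (q ++ rev u' ++ p)) r].

Definition scand b w k rh := exists u p r,
  [/\ nf (rev u ++ p) = w, size p = k,
      critg_spec b (pos p b) (pos p (~~ b)) u r
    & rh = omap (fun u' => nf (rev u' ++ p)) r].

(** Candidates with the same ends may come from different representatives; the last clause records
    that they yield the same normalized word. *)
Definition best b w (o : option (nat * nat * option (seq sletter))) : Prop :=
  if o is Some (k, l, r) then
    cand b w k l r /\ forall k' l' r', cand b w k' l' r' ->
      [\/ k' < k, k' = k /\ l' < l | [/\ k' = k, l' = l & r' = r]]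
  else forall k l r, ~ cand b w k l r.

Lemma critg_size b x y u r : critg_spec b x y u r -> 0 < size u.
Proof. by case. Qed.

Lemma cand_cons b a w k l rh : cand b (a :: w) k l rh ->
  scand b (a :: w) k rh /\ l = size w \/
  exists a' rh0, [/\ sn a' w = a :: w, cand b w k l rh0, rh = omap (sn a') rh0 & l < size w].
Proof.
case=> -[|a' q] [u [p [r [e1 e2 e3 e4 e5]]]].
  left; split; first by exists u, p, r.
  by have := congr1 size e1; rewrite size_nf !size_cat size_rev /=; lia.
right; have e : nf (q ++ rev u ++ p) = w by case: e1.
exists a', (omap (fun u' => nf (q ++ rev u' ++ p)) r); split.
- by rewrite -{1}e -e1.
- by exists q, u, p, r.
- by rewrite e5; case: (r).
- by have := congr1 size e; rewrite size_nf !size_cat size_rev /=; lia.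
Qed.

Lemma cand_weaken b a w k l rh : cand b w k l rh -> cand b (sn a w) k l (omap (sn a) rh).
Proof.
case=> q [u [p [r [e1 e2 e3 e4 ->]]]]; exists (a :: q), u, p, r; split=> //=.
  by rewrite -e1.
by case: (r).
Qed.

Lemma scand_cand b a w k rh : scand b (a :: w) k rh -> cand b (a :: w) k (size w) rh.
Proof.
case=> u [p [r [e1 e2 e3 e4]]]; exists [::], u, p, r; split=> //=.
by have := congr1 size e1; rewrite size_nf !size_cat size_rev /=; lia.
Qed.

Lemma scand_le b a w k rh : scand b (a :: w) k rh -> k <= size w.
Proof.
case=> u [p [r [e1 e2 e3 e4]]].
have := congr1 size e1; rewrite size_nf !size_cat size_rev /=.
have := critg_size e3; lia.
Qed.

Lemma cand_le b w k l rh : cand b w k l rh -> k <= l.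
Proof. by case=> q [u [p [r [e1 e2 e3 /critg_size]]]]; lia. Qed.

(** If [a] is the first of its index, another representative may end in the other letter of that
    index, and after a transformation the two need not be equivalent any more. Hence the assumption
    on [a]. *)
Lemma best_shift b a w o : nfp (a :: w) -> hasi a.1 w \/ o = None ->
  (forall k rh, ~ scand b (a :: w) k rh) -> best b w o ->
  best b (a :: w) (omap (fun x => (x.1, omap (sn a) x.2)) o).
Proof.
move=> nw ha ns; case: o ha => [[[k l] r]|] ha /=.
  case=> c1 c2; split; first by rewrite -{1}(sn_id nw); apply: cand_weaken.
  move=> k' l' r' /cand_cons[[/ns] //|[a' [r0 [e1 e2 e3 e4]]]].
  have ea : a' = a.
    case: ha => // ha; move: e1 ha; rewrite /sn; case: a {nw ns c1} => j f [<- <-] /= ->.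
    by rewrite orbF; case: (a').
  by rewrite e3 ea; case: (c2 _ _ _ e2) => [h|h|[h1 h2 h3]]; [constructor 1 | constructor 2 | constructor 3; rewrite h3].
move=> c k l r /cand_cons[[/ns] //|[a' [r0 [e1 e2 e3 e4]]]].
exact: c e2.
Qed.

Lemma best_single b a w r : scand b (a :: w) (size w) r ->
  (forall r', scand b (a :: w) (size w) r' -> r' = r) ->
  best b (a :: w) (Some (size w, size w, r)).
Proof.
move=> s u; split; first exact: scand_cand.
move=> k l r' /cand_cons[[h ->]|[a' [r0 [e1 e2 e3 e4]]]].
  have := scand_le h; rewrite leq_eqVlt => /orP[/eqP e|]; last by constructor 1.
  by constructor 3; split=> //; apply: u; rewrite -e.
by constructor 1; have := cand_le e2; lia.
Qed.

Lemma best_multi b a w k r : scand b (a :: w) k r ->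
  (forall k' r', scand b (a :: w) k' r' -> k' = k /\ r' = r) ->
  (forall k' l' r', cand b w k' l' r' -> k' <= k) ->
  best b (a :: w) (Some (k, size w, r)).
Proof.
move=> s u h; split; first exact: scand_cand.
move=> k' l r' /cand_cons[[/u[-> ->] ->]|[a' [r0 [e1 e2 e3 e4]]]]; first by constructor 3.
have := h _ _ _ e2; rewrite leq_eqVlt => /orP[/eqP e|]; last by constructor 1.
by constructor 2.
Qed.

(** * Candidates that end at the last letter *)

Variant suffix_cand b a w : nat -> option (seq sletter) -> Prop :=
  | Suf3 of pos w (~~ b) = 0 & sn (b, false) w = a :: w :
      suffix_cand b a w (size w) (Some (sn (~~ b, true) w))
  | Suf4 of pos w b = 0 & sn (b, true) w = a :: w :
      suffix_cand b a w (size w) (Some (sn (~~ b, false) w))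
  | Suf5 c of pos w b = 1 & 0 < pos w (~~ b) & sn c w = a :: w & c.2 = false :
      suffix_cand b a w (size w) None
  | Suf1 j p t of nf (nseq j (b, true) ++ (b, false) :: p) = w & sn (~~ b, false) w = a :: w
      & pos p (~~ b) = 0 \/ pos p (~~ b) = 1 /\ 0 < pos p b
      & t = nf (nseq j (b, true) ++ (~~ b, false) :: p) :
      suffix_cand b a w (size p) (Some (sn (~~ b, true) t))
  | Suf2 j p t of nf (nseq j (~~ b, true) ++ (b, false) :: p) = w & sn (b, true) w = a :: w
      & pos p b = 0 \/ pos p b = 1 /\ 0 < pos p (~~ b)
      & t = nf (nseq j (~~ b, true) ++ (~~ b, false) :: p) :
      suffix_cand b a w (size p) (Some (sn (b, false) t)).

Lemma rev_nseq T n (x : T) : rev (nseq n x) = nseq n x.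
Proof.
elim: n => //= n IH; rewrite rev_cons IH -cats1.
by elim: n {IH} => //= n <-.
Qed.

Lemma rev_crit (m z x : sletter) j p :
  rev (m :: nseq j x ++ [:: z]) ++ p = z :: nseq j x ++ m :: p.
Proof. by rewrite rev_cons rev_cat rev_nseq /= cat_rcons. Qed.

Lemma suffix_candP b a w k r : nfp w -> scand b (a :: w) k r <-> suffix_cand b a w k r.
Proof.
move=> nw; have ew := nf_id nw; split.
  case=> u [p [r0 [e1 <- cr ->]]]; case: cr e1 => {u r0} /=.
  - move=> y0 e1; have e : nf p = w by case: e1.
    by subst w; rewrite -(size_nf p); apply: Suf3; rewrite ?pos_nf.
  - move=> y0 e1; have e : nf p = w by case: e1.
    by subst w; rewrite -(size_nf p); apply: Suf4; rewrite ?pos_nf.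
  - move=> c x1 y0 c2 e1; have e : nf p = w by case: e1.
    by subst w; rewrite -(size_nf p); apply: (@Suf5 _ _ _ c); rewrite ?pos_nf.
  - move=> j h; rewrite !rev_crit /= => e1.
    have e : nf (nseq j (b, true) ++ (b, false) :: p) = w by case: e1.
    by subst w; apply: (Suf1 (erefl _) _ h).
  - move=> j h; rewrite !rev_crit /= => e1.
    have e : nf (nseq j (~~ b, true) ++ (b, false) :: p) = w by case: e1.
    by subst w; apply: (Suf2 (erefl _) _ h).
case.
- move=> y0 e; exists [:: (b, false)], w, (Some [:: (~~ b, true)]).
  by rewrite /= ew; split=> //; constructor.
- move=> y0 e; exists [:: (b, true)], w, (Some [:: (~~ b, false)]).
  by rewrite /= ew; split=> //; constructor.
- move=> c x1 y0 e c2; exists [:: c], w, None.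
  by rewrite /= ew; split=> //; constructor.
- move=> j p t e1 e2 h ->.
  exists ((b, false) :: nseq j (b, true) ++ [:: (~~ b, false)]), p,
    (Some ((~~ b, false) :: nseq j (b, true) ++ [:: (~~ b, true)])).
  by rewrite rev_crit /= rev_crit e1; split=> //; constructor.
- move=> j p t e1 e2 h ->.
  exists ((b, false) :: nseq j (~~ b, true) ++ [:: (b, true)]), p,
    (Some ((~~ b, false) :: nseq j (~~ b, true) ++ [:: (b, false)])).
  by rewrite rev_crit /= rev_crit e1; split=> //; constructor.
Qed.

(** Where one word has [(b, false)] the other cannot have a block letter: with equal indices it
    would have to be the first letter of index b, although another one precedes it. So a candidate
    with a middle block and a given end has a unique start. *)
Lemma nf_block_inj (c : bool) b j j' p p' :
  nf (nseq j (c, true) ++ (b, false) :: p) = nf (nseq j' (c, true) ++ (b, false) :: p') ->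
  j = j' /\ nf p = nf p'.
Proof.
have key n q q' : sn (b, false) (nf q) = sn (c, true) (nf (nseq n (c, true) ++ (b, false) :: q')) -> False.
  move=> [<- + e]; rewrite e hasi_nf /hasi has_cat /= eqxx !orbT.
  by case: c.
elim: j j' => [|j IH] [|j'] //=.
- by case=> e1 e2.
- by move/key.
- by move=> e; case: (@key j p' p).
- by case=> /IH[-> ->].
Qed.

(** The start conditions are those under which [(b, false)] leads to the axis: a step along it, or
    the inward step from y = 1. The block letters then stay on it. *)
Lemma pos_block_same b j p :
  pos p (~~ b) = 0 \/ pos p (~~ b) = 1 /\ 0 < pos p b ->
  0 < pos (nseq j (b, true) ++ (b, false) :: p) b /\ pos (nseq j (b, true) ++ (b, false) :: p) (~~ b) = 0.
Proof.
move=> h; elim: j => [|j [IH1 IH2]]; first by case: b h => /= h; brk; lia.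
move: IH1 IH2; rewrite [nseq _.+1 _ ++ _]/=.
by move: (nseq j _ ++ _) => v; case: b {h} => /= h1 h2; lia.
Qed.

(** From x = 0 the letter [(b, false)] steps to x = 1, and from x = 1, y > 0 it turns inwards and
    leaves x alone. The block letters do not change x. *)
Lemma pos_block_other b j p :
  pos p b = 0 \/ pos p b = 1 /\ 0 < pos p (~~ b) ->
  pos (nseq j (~~ b, true) ++ (b, false) :: p) b = 1.
Proof.
move=> h; elim: j => [|j IH]; first by case: b h => /= h; brk; lia.
move: IH; rewrite [nseq _.+1 _ ++ _]/=.
by move: (nseq j _ ++ _) => v; case: b {h} => /= h1; lia.
Qed.

(** A nonempty word that ends at y = 0 ends in the index b, and dropping a free such letter does not
    leave y = 0; so the recursion meets no blocking letter. *)
Lemma flipP_exists b w : nfp w -> pos w (~~ b) = 0 -> w <> [::] -> flipP b w <> None.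
Proof.
elim: w => //= a w IH /andP[jw nw] y0 _.
have hx := @pos0 w b.
have hw : w = [::] \/ (pos w (~~ b) = 0 -> flipP b w <> None).
  by case: (eqVneq w [::]) => [|/eqP h]; [left | right=> e; apply: IH].
case: a b jw IH y0 hx hw => -[] [] [] //= jw IH y0 hx hw; try lia.
all: try by case: ifP => h; first (by case: hw => [e|hw]; [rewrite e in h|have := hw y0; case: flipP]).
all: by move: y0; brk; lia.
Qed.

(** No candidate starts inside a block. One starting with a free letter of index b has type 4 and
    needs x = 0, but x > 0 there; one starting with the other index has type 5 and needs y > 0, so
    that index occurs before and the block letter cannot be mixed. Hence the candidate formed by the
    block and the next letter beats all earlier ones. *)
Lemma cand_block b w k l r X j p : cand b w k l r ->
  w = nf (nseq j X ++ (b, false) :: p) ->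
  (X = (b, true) /\ (pos p (~~ b) = 0 \/ pos p (~~ b) = 1 /\ 0 < pos p b)) \/
  (X = (~~ b, true) /\ (pos p b = 0 \/ pos p b = 1 /\ 0 < pos p (~~ b))) ->
  k <= size p.
Proof.
case=> q' [u [p' [r' [e1 <- sl cr _]]]] e2 hX; rewrite leqNgt; apply/negP => hk.
have hu := critg_size cr.
have [c [u' eu]] : exists c u', rev u = rcons u' c.
  by clear - hu; case: u hu => // c u2 _; exists c, (rev u2); rewrite rev_cons.
have sz : size q' + size u + size p' = j + (size p).+1.
  by have := congr1 size (etrans e1 e2); rewrite !size_nf !size_cat size_rev size_nseq /=; lia.
have hd : nf (c :: p') = nf (nseq (size p' - size p) X ++ (b, false) :: p).
  have := congr1 (drop (size q' + size u')) (etrans e1 e2).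
  rewrite !drop_nf eu cat_rcons catA drop_size_cat ?size_cat // => ->.
  have := congr1 size eu; rewrite size_rev size_rcons => su.
  rewrite drop_cat size_nseq ifT; last by lia.
  by rewrite drop_nseq; congr (nf (nseq _ _ ++ _)); lia.
have [n En] : exists n, size p' - size p = n.+1 by exists (size p' - size p).-1; lia.
rewrite En /= in hd; have en : nf p' = nf (nseq n X ++ (b, false) :: p) by case: hd.
have ec : sn c (nf p') = sn X (nf p') by rewrite hd en.
have hb : hasi b (nf p') by rewrite en hasi_nf /hasi has_cat /= eqxx orbT.
have c1 : c.1 = X.1 by case: ec.
have ch : head c u = c by rewrite -(revK u) eu rev_rcons.
have pn b' : pos p' b' = pos (nseq n X ++ (b, false) :: p) b' by rewrite -pos_nf en pos_nf.
case: hX c1 ec => -[eX h] c1 ec.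
  have [x0 _] := pos_block_same n h; rewrite -eX -pn in x0.
  have c2 : c.2 by move: ec; rewrite /sn c1 eX hb /= orbF => -[->].
  clear - cr ch c1 c2 x0 eX; rewrite eX /= in c1; case: cr ch c1 c2 x0 => [_ <-|-> <-|c' _ _ h /= <-|j _ /= <-|j _ /= <-] //.
  by rewrite h.
have c2 : c.2 || ~~ hasi (~~ b) (nf p') by move: ec; rewrite /sn c1 eX /= => -[->].
have h0 := @pos_hasi (~~ b) (nf p'); rewrite pos_nf in h0.
clear - cr ch c1 c2 h0 eX; rewrite eX /= in c1; case: cr ch c1 c2 h0 => [_ <-|_ <-|c' _ y0 h /= <-|j _ /= <-|j _ /= <-] //=.
all: try by case: (b).
by rewrite h => _ /= h' h2; rewrite h2 in y0.
Qed.

Lemma free_block_pos b q p : all snd q ->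
  pos p b <= pos (q ++ p) b.
Proof. by elim: q => //= c q IH /andP[-> /IH] /=; lia. Qed.

(** Converse to the block computations: the endpoint alone shows that the letters passed over form a
    block with a legitimate start. So whenever [flip] calls [flipP], the letter changed by [flipP]
    starts a critical substring. *)
Lemma free_block_le1 b q p : all snd q -> pos (q ++ (b, false) :: p) b = 1 ->
  q = nseq (size q) (~~ b, true) /\ (pos p b = 0 \/ pos p b = 1 /\ 0 < pos p (~~ b)).
Proof.
elim: q => [_ e|c q IH].
  by split=> //; move: e; case: b => /=; brk; lia.
move=> /andP[c2 aq] e.
have := free_block_pos b ((b, false) :: p) aq.
have : 0 < pos ((b, false) :: p) b by case: b {IH e} => /=; brk; lia.
move: e; rewrite /= c2 /=; case: (eqVneq c.1 b) => [|cb] e h1 h2; first lia.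
have [-> h] := IH aq e; split=> //=.
by rewrite size_nseq; case: c c2 cb {e} => j f /= ->; case: j; case: b {IH h1 h2 h}.
Qed.

Lemma free_block_y0 b q p : all snd q -> pos (q ++ (b, false) :: p) (~~ b) = 0 ->
  q = nseq (size q) (b, true) /\ (pos p (~~ b) = 0 \/ pos p (~~ b) = 1 /\ 0 < pos p b).
Proof.
elim: q => [_ e|c q IH].
  by split=> //; move: e; case: b => /=; brk; lia.
move=> /andP[c2 aq]; rewrite /= c2 /=; case: (eqVneq c.1 (~~ b)) => [|cb] e; first lia.
have [-> h] := IH aq e; split=> //=.
by rewrite size_nseq; case: c c2 cb {e} => j f /= ->; case: j; case: b {IH h}.
Qed.

Lemma sn_eq a c w : sn c w = a :: w -> c.1 = a.1 /\ (hasi a.1 w -> c = a).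
Proof.
by case: a c => j f [j' f'] [<- <-] /=; split=> // ->; rewrite orbF.
Qed.

Lemma suffix_single b a w r : nfp (a :: w) -> suffix_cand b a w (size w) r ->
  (forall k r', suffix_cand b a w k r' -> k = size w -> r' = r) ->
  exists o, best b (a :: w) o /\ r = obind snd o.
Proof.
move=> /= /andP[_ nw] s u; exists (Some (size w, size w, r)); split=> //.
apply: best_single; first exact/suffix_candP.
by move=> r' /(suffix_candP _ _ _ _ nw) h; apply: u h _.
Qed.

Lemma suffix_multi b a w k r j X p : nfp (a :: w) -> suffix_cand b a w k r ->
  (forall k' r', suffix_cand b a w k' r' -> k' = k /\ r' = r) ->
  w = nf (nseq j X ++ (b, false) :: p) -> k = size p ->
  (X = (b, true) /\ (pos p (~~ b) = 0 \/ pos p (~~ b) = 1 /\ 0 < pos p b)) \/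
  (X = (~~ b, true) /\ (pos p b = 0 \/ pos p b = 1 /\ 0 < pos p (~~ b))) ->
  exists o, best b (a :: w) o /\ r = obind snd o.
Proof.
move=> /= /andP[_ nw] s u ew ek hX; exists (Some (k, size w, r)); split=> //.
apply: best_multi; first exact/suffix_candP.
  by move=> k' r' /(suffix_candP _ _ _ _ nw); apply: u.
by move=> k' l' r' /cand_block - /(_ _ _ _ ew hX); rewrite ek.
Qed.

Lemma suffix_shift b a w o : nfp (a :: w) -> hasi a.1 w -> best b w o -> flip b w = obind snd o ->
  (forall k r, ~ suffix_cand b a w k r) ->
  exists o', best b (a :: w) o' /\ osn a (flip b w) = obind snd o'.
Proof.
move=> nw h B e n; exists (omap (fun x => (x.1, omap (sn a) x.2)) o); split.
  apply: best_shift => //; first by left.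
  by move=> k r; case/andP: nw => _ nw /(suffix_candP _ _ _ _ nw); apply: n.
by rewrite e; case: (o).
Qed.

Lemma suffix_kinds b a w k r : nfp (a :: w) -> hasi a.1 w -> suffix_cand b a w k r ->
  [\/ [/\ a = (b, false), pos w (~~ b) = 0, k = size w & r = Some (sn (~~ b, true) w)],
      [/\ a = (b, true), pos w b = 0, k = size w & r = Some (sn (~~ b, false) w)],
      [/\ a.2 = false, pos w b = 1, 0 < pos w (~~ b), k = size w & r = None] |
    exists j p t, flipP b w = Some t /\
     ([/\ a = (~~ b, false), pos w (~~ b) = 0 /\ 0 < pos w b, k = size p /\ size p < size w,
          nf (nseq j (b, true) ++ (b, false) :: p) = w & r = Some (sn (~~ b, true) t)] \/
      [/\ a = (b, true), pos w b = 1, k = size p /\ size p < size w,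
          nf (nseq j (~~ b, true) ++ (b, false) :: p) = w & r = Some (sn (b, false) t)])].
Proof.
move=> /andP[jw nw] h [y0 e|x0 e|c x1 y0 e c2|j p t ew e hp et|j p t ew e hp et].
- by constructor 1; case: (sn_eq e) => _ /(_ h).
- by constructor 2; case: (sn_eq e) => _ /(_ h).
- by constructor 3; case: (sn_eq e) => _ /(_ h) <-.
- constructor 4; exists j, p, t; rewrite -{1}ew flipP_nf ?all_nseq ?orbT // -et; split=> //; left.
  have [x0 y0] := pos_block_same j hp.
  case: (sn_eq e) => _ /(_ h) <-; split=> //.
    by rewrite -ew !pos_nf.
  by rewrite -ew size_nf size_cat size_nseq /=; split=> //; lia.
- constructor 4; exists j, p, t; rewrite -{1}ew flipP_nf ?all_nseq ?orbT // -et; split=> //; right.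
  have x1 := pos_block_other j hp.
  case: (sn_eq e) => _ /(_ h) <-; split=> //.
    by rewrite -ew !pos_nf.
  by rewrite -ew size_nf size_cat size_nseq /=; split=> //; lia.
Qed.

Lemma best_nil b : best b [::] None.
Proof.
move=> k l r [q [u [p [r0 [e _ _ /critg_size hu _]]]]].
by have := congr1 size e; rewrite size_nf !size_cat size_rev /=; lia.
Qed.

(** A first letter of index [~~ b] is free in normal form, but mixed in another representative,
    where it may close a type 1 substring. [flip] passes over it all the same: only the index b
    occurs before it, so [flip] and [flipP] agree there. *)
Lemma best_flip_first b a w : nfp (a :: w) -> ~~ hasi a.1 w ->
  exists o, best b (a :: w) o /\ flip b (a :: w) = obind snd o.
Proof.
move=> nfw h; have /andP[jw nw] := nfw.
have a2 : a.2 by move: jw; rewrite (negbTE h) orbF.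
case: (eqVneq a.1 b) => ab.
  have x0 : pos w b = 0 by apply: pos_hasi; rewrite -ab.
  have ea : a = (b, true) by case: a a2 ab {h jw nfw} => j f /= -> ->.
  have -> : flip b (a :: w) = Some (sn (~~ b, false) w) by rewrite ea /= eqxx x0.
  apply: suffix_single => //; first by apply: Suf4 => //; rewrite ea sn_id // -ea.
  move=> k r [y0 e|_ e|c x1 y0 e c2|j p t ew e hp et|j p t ew e hp et] ek //.
  - by rewrite (pos0 x0 y0).
  - by rewrite x0 in x1.
  - by have := congr1 size ew; rewrite size_nf size_cat /=; lia.
  - by have := congr1 size ew; rewrite size_nf size_cat /=; lia.
have ea : a = (~~ b, true) by case: a a2 ab {h jw nfw} => j f /= -> ; case: j; case: b.
have hb : ~~ hasi (~~ b) w by rewrite ea /= in h.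
have y0 := pos_hasi hb.
have -> : flip b (a :: w) = osn a (flip b w) by rewrite ea /=; case: (b).
case: (eqVneq w [::]) => [w0|/eqP w0].
  exists None; split; last by rewrite w0.
  subst w; apply: (best_shift (o := None)) => //; [by right| |exact: best_nil].
  move=> k r /(@suffix_candP b a [::] k r isT) [y1 e|_ e|c x1 _ e c2|j p t ew e hp et|j p t ew e hp et].
  - by case: (sn_eq e) => e1 _; rewrite -e1 eqxx in ab.
  - by case: (sn_eq e) => e1 _; rewrite -e1 eqxx in ab.
  - by [].
  - by have := congr1 size ew; rewrite size_nf size_cat /=; lia.
  - by have := congr1 size ew; rewrite size_nf size_cat /=; lia.
rewrite flip_eqP //.
case E : (flipP b w) (flipP_exists nw y0 w0) => [t|] // _.
have [q [p [aq ew et]]] := flipP_decomp nw E.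
have yq : pos (q ++ (b, false) :: p) (~~ b) = 0 by rewrite -pos_nf ew.
have [eq hp] := free_block_y0 aq yq.
rewrite /=; apply: (@suffix_multi b a w (size p) _ (size q) (b, true) p) => //.
- rewrite ea; apply: (@Suf1 _ _ _ (size q) p t); rewrite -?eq //.
  by rewrite /sn /= hb.
- move=> k r [y1 e|_ e|c x1 y1 e c2|j p' t' ew' e hp' et'|j p' t' ew' e hp' et'].
  + by case: (sn_eq e) => e1 _; rewrite -e1 eqxx in ab.
  + by case: (sn_eq e) => e1 _; rewrite -e1 eqxx in ab.
  + by rewrite y0 in y1.
  + have := ew; rewrite eq -ew' => /nf_block_inj[j1 p1].
    have := flipP_nf b p' (q := nseq j (b, true)) ltac:(by rewrite all_nseq orbT).
    rewrite ew' E -et' => -[<-]; rewrite ea; split=> //.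
    by rewrite -(size_nf p') -p1 size_nf.
  + by case: (sn_eq e) => e1 _; rewrite -e1 eqxx in ab.
- by rewrite -eq.
- by left.
Qed.

Lemma suffix_kinds_src b w k r : nfp ((b, true) :: w) -> hasi b w -> suffix_cand b (b, true) w k r ->
  [/\ pos w b = 0, k = size w & r = Some (sn (~~ b, false) w)] \/
  exists j p t, [/\ flipP b w = Some t, pos w b = 1, k = size p,
    nf (nseq j (~~ b, true) ++ (b, false) :: p) = w & r = Some (sn (b, false) t)].
Proof.
move=> n h s; case: (suffix_kinds n h s) => [[]|[_ x0 e1 e2]|[]|[j [p [t [e [[]|[_ x1 [e1 _] e2 e3]]]]]]] //.
- by left.
- by right; exists j, p, t.
Qed.

Lemma suffix_kinds_src_mixed b w k r : nfp ((b, false) :: w) -> hasi b w -> suffix_cand b (b, false) w k r ->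
  [/\ pos w (~~ b) = 0, k = size w & r = Some (sn (~~ b, true) w)] \/
  [/\ pos w b = 1, 0 < pos w (~~ b), k = size w & r = None].
Proof.
move=> n h s; case: (suffix_kinds n h s) => [[_ x0 e1 e2]|[]|[_ x1 y1 e1 e2]|[j [p [t [e [[]|[]]]]]]] //.
- by left.
- by right.
- by case; case: (b).
Qed.

Lemma suffix_kinds_tgt b w k r : nfp ((~~ b, true) :: w) -> hasi (~~ b) w ->
  ~ suffix_cand b (~~ b, true) w k r.
Proof.
move=> n h s; case: (suffix_kinds n h s) => [[]|[]|[]|[j [p [t [e [[]|[]]]]]]] //; by case: (b).
Qed.

Lemma suffix_kinds_tgt_mixed b w k r : nfp ((~~ b, false) :: w) -> hasi (~~ b) w ->
  suffix_cand b (~~ b, false) w k r ->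
  [/\ pos w b = 1, 0 < pos w (~~ b), k = size w & r = None] \/
  [/\ pos w (~~ b) = 0, 0 < pos w b & exists j p t, [/\ flipP b w = Some t, k = size p,
    nf (nseq j (b, true) ++ (b, false) :: p) = w & r = Some (sn (~~ b, true) t)]].
Proof.
move=> n h s; case: (suffix_kinds n h s) => [[]|[]|[_ x1 y1 e1 e2]|[j [p [t [e [[_ [y0 x0] [e1 _] e2 e3]|[]]]]]]] //.
- by case: (b).
- by left.
- by right; split=> //; exists j, p, t.
Qed.

(** If the last letter is not the first of its index, all representatives share it, and earlier
    candidates keep their results up to appending it. They have to be compared with the candidates
    that end at the last letter, and the branches of [flip] are the types of these. *)
Lemma best_flip b w : nfp w -> exists o, best b w o /\ flip b w = obind snd o.
Proof.
elim: w => [_|a w IH nfw]; first by exists None; split=> //; apply: best_nil.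
have /andP[jw nw] := nfw.
case: (boolP (hasi a.1 w)) => h; last exact: best_flip_first.
have {IH} [o [B e]] := IH nw.
have shift := suffix_shift nfw h B e.
have flip0 : pos w b = 0 -> flip b w = None.
  by case E: (flip b w) => [t|] // x0; have [_ e1 _ _ _] := flip_moved nw E; rewrite x0 in e1.
have nb : ((~~ b) == b) = false by case: (b).
have : [\/ a = (b, true), a = (b, false), a = (~~ b, true) | a = (~~ b, false)].
  case: (a) => j f; case: (eqVneq j b) f => [->|jb] [].
  - by constructor 1.
  - by constructor 2.
  - by constructor 3; move: jb; case: (j); case: (b).
  - by constructor 4; move: jb; case: (j); case: (b).
case=> ea; subst a.
- have kinds := suffix_kinds_src nfw h.
  have -> : flip b ((b, true) :: w) = if pos w b == 0 then Some (sn (~~ b, false) w)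
      else if (pos w b == 1) && flipP b w then osn (b, false) (flipP b w) else osn (b, true) (flip b w).
    by rewrite /= eqxx.
  case: (eqVneq (pos w b) 0) => x0.
    apply: suffix_single => //; first by apply: Suf4; rewrite // sn_id.
    by move=> k r /kinds[[_ _ ->]|[j [p [t []]]]] //; rewrite x0.
  case: (eqVneq (pos w b) 1) => x1 /=; last first.
    by apply: shift => k r /kinds[[x2]|[j [p [t [_ x2]]]]]; rewrite x2 in x0 x1.
  case E : (flipP b w) => [t|]; last first.
    by apply: shift => k r /kinds[[x2]|[j [p [t []]]]]; [rewrite x2 in x0 | rewrite E].
  have [q [p [aq ew et]]] := flipP_decomp nw E.
  have yq : pos (q ++ (b, false) :: p) b = 1 by rewrite -pos_nf ew.
  have [eq hp] := free_block_le1 aq yq.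
  apply: (@suffix_multi b _ w (size p) _ (size q) (~~ b, true) p) => //; [| |by rewrite -eq|by right].
    by apply: (@Suf2 _ _ _ (size q) p t); rewrite -?eq // sn_id.
  move=> k r /kinds[[x2]|[j [p' [t' [E' _ -> ew' ->]]]]]; first by rewrite x2 in x0.
  have := ew; rewrite eq -ew' => /nf_block_inj[_ p1].
  by move: E'; rewrite E => -[->]; rewrite -(size_nf p) p1 size_nf.
- have kinds := suffix_kinds_src_mixed nfw h.
  have -> : flip b ((b, false) :: w) = if pos w (~~ b) == 0 then Some (sn (~~ b, true) w)
      else if pos w b <= 1 then None else osn (b, false) (flip b w).
    by rewrite /= eqxx.
  case: (eqVneq (pos w (~~ b)) 0) => y0.
    apply: suffix_single => //; first by apply: Suf3; rewrite // sn_id.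
    by move=> k r /kinds[[_ _ ->]|[]] //; rewrite y0.
  case: (eqVneq (pos w b) 1) => [x1|x1].
    rewrite x1 /=; apply: suffix_single => //.
      by apply: (@Suf5 _ _ _ (b, false)); rewrite ?sn_id //; lia.
    by move=> k r /kinds[[y1]|[_ _ _ ->]] //; rewrite y1 in y0.
  have ns : forall k r, ~ suffix_cand b (b, false) w k r.
    by move=> k r /kinds[[y1]|[x2]]; [rewrite y1 in y0 | rewrite x2 in x1].
  case: ifP => x2; last exact: shift.
  by have := shift ns; rewrite flip0 //; lia.
- have -> : flip b ((~~ b, true) :: w) = osn (~~ b, true) (flip b w) by rewrite /= nb.
  by apply: shift => k r; apply: suffix_kinds_tgt.
- have kinds := suffix_kinds_tgt_mixed nfw h.
  have -> : flip b ((~~ b, false) :: w) = if pos w b == 0 then None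
      else if pos w (~~ b) == 0 then osn (~~ b, true) (flipP b w)
      else if pos w b <= 1 then None else osn (~~ b, false) (flip b w).
    by rewrite /= nb.
  case: (eqVneq (pos w b) 0) => x0.
    have := shift; rewrite flip0 //; apply => k r.
    by move=> /kinds[[x2]|[_]]; [rewrite x2 in x0 | rewrite x0].
  case: (eqVneq (pos w (~~ b)) 0) => y0.
    case E : (flipP b w) => [t|]; last first.
      by case: (flipP_exists nw y0 _ E) => w0; rewrite w0 in h.
    have [q [p [aq ew et]]] := flipP_decomp nw E.
    have yq : pos (q ++ (b, false) :: p) (~~ b) = 0 by rewrite -pos_nf ew.
    have [eq hp] := free_block_y0 aq yq.
    apply: (@suffix_multi b _ w (size p) _ (size q) (b, true) p) => //; [| |by rewrite -eq|by left].
      by apply: (@Suf1 _ _ _ (size q) p t); rewrite -?eq // sn_id.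
    move=> k r /kinds[[_ y1]|[_ _ [j [p' [t' [E' -> ew' ->]]]]]]; first by rewrite y0 in y1.
    have := ew; rewrite eq -ew' => /nf_block_inj[_ p1].
    by move: E'; rewrite E => -[->]; rewrite -(size_nf p) p1 size_nf.
  case: (eqVneq (pos w b) 1) => [x1|x1].
    rewrite x1 /=; apply: suffix_single => //.
      by apply: (@Suf5 _ _ _ (~~ b, false)); rewrite ?sn_id //; lia.
    by move=> k r /kinds[[_ _ _ ->]|[y1]] //; rewrite y1 in y0.
  rewrite ifF; last by lia.
  by apply: shift => k r /kinds[[x2]|[y1]]; [rewrite x2 in x1 | rewrite y1 in y0].
Qed.
End ReversedWords.

Section Representatives.
Implicit Types (s v : seq letter) (b : bool).

(** * Representatives and critical substrings *)

Definition seen s k := has (fun c => idx c == k) s.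

Lemma first_occ_rcons s a p : p < size s -> first_occ (rcons s a) p = first_occ s p.
Proof.
move=> hp; rewrite /first_occ; apply: eq_in_all => q; rewrite mem_iota add0n => /andP[_ hq].
by rewrite !nth_rcons hp (ltn_trans hq hp).
Qed.

Lemma first_occ_last s a : first_occ (rcons s a) (size s) = ~~ seen s (idx a).
Proof.
rewrite /first_occ /seen -all_predC nth_rcons ltnn eqxx.
rewrite -[in RHS](mkseq_nth l1 s) all_map; apply: eq_in_all => q; rewrite mem_iota add0n => /andP[_ hq].
by rewrite nth_rcons hq.
Qed.

Lemma canon_rcons s a :
  canon (rcons s a) = rcons (canon s) (if seen s (idx a) then a else (idx a, false)).
Proof.
rewrite /canon size_rcons -addn1 iotaD map_cat add0n /= cats1.
rewrite first_occ_last nth_rcons ltnn eqxx if_neg; congr rcons.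
apply/eq_in_map => p; rewrite mem_iota add0n => /andP[_ hp].
by rewrite first_occ_rcons // nth_rcons hp.
Qed.

Lemma size_canon s : size (canon s) = size s.
Proof. by rewrite /canon size_map size_iota. Qed.

Lemma idx_canon s : map idx (canon s) = map idx s.
Proof. by elim/last_ind: s => //= s a IH; rewrite canon_rcons !map_rcons IH; case: ifP. Qed.

Lemma seen_idx s v k : map idx s = map idx v -> seen s k = seen v k.
Proof. by move=> e; rewrite /seen -!(has_map idx (pred1 k)) e. Qed.

Lemma seen_canon s k : seen (canon s) k = seen s k.
Proof. exact/seen_idx/idx_canon. Qed.

Lemma canon_idx s v : canon s = canon v -> map idx s = map idx v.
Proof. by move=> e; rewrite -idx_canon e idx_canon. Qed.

Lemma canonK s : canon (canon s) = canon s.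
Proof.
elim/last_ind: s => // s a IH; rewrite !canon_rcons IH seen_canon.
by case: (boolP (seen s (idx a))) => h /=; rewrite ?h ?(negbTE h).
Qed.

Lemma canon_rcons_eq s a v c : canon (rcons s a) = canon (rcons v c) <->
  [/\ canon s = canon v, idx a = idx c & seen s (idx a) -> a = c].
Proof.
rewrite !canon_rcons; split.
  move=> /rcons_inj[e1]; rewrite -(seen_idx _ (canon_idx e1)).
  case: a c => ka pa [kc pc] /= e2; have ek : ka = kc by case: ifP e2 => _; case: ifP => _ [].
  by subst kc; split=> // h; rewrite h in e2.
case=> e1 e2 e3; rewrite e1 -(seen_idx _ (canon_idx e1)) -e2.
by case: ifP => // h; rewrite e3.
Qed.

Lemma size_canon_eq s v : canon s = canon v -> size s = size v.
Proof. by move=> e; rewrite -size_canon e size_canon. Qed.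

Definition agree (P : pred nat) s v := size v = size s /\
  forall p, p < size s -> idx (nth l1 v p) = idx (nth l1 s p) /\ (~~ P p -> nth l1 v p = nth l1 s p).

Lemma reps_auxP ps s v : all (fun p => p < size s) ps ->
  reflect (agree (mem ps) s v) (v \in reps_aux ps s).
Proof.
elim: ps s => [|p ps IH] s /=.
  move=> _; rewrite inE; apply: (iffP eqP) => [->|[e h]]; first by split.
  by apply: (@eq_from_nth _ l1) => // q; rewrite e => /h[_]; apply.
case/andP=> hp hps; rewrite mem_cat.
have sz c : size (set_nth l1 s p c) = size s by rewrite size_set_nth; apply/maxn_idPr.
have hps' c : all (fun q => q < size (set_nth l1 s p c)) ps by rewrite sz.
have A c : idx c = idx (nth l1 s p) ->
  agree (mem ps) (set_nth l1 s p c) v -> agree (mem (p :: ps)) s v.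
  move=> ec [e h]; split; first by rewrite e sz.
  move=> q hq; have := h q; rewrite sz nth_set_nth /= inE => /(_ hq)[h1 h2].
  case: (eqVneq q p) h1 h2 => [->|qp] h1 h2; first by rewrite h1 ec.
  by rewrite h1; split.
apply: (iffP orP) => [|[e h]].
  by case=> /(IH _ (hps' _)); apply: A.
have ep : nth l1 v p = (idx (nth l1 s p), primed (nth l1 v p)).
  by have [h1 _] := h p hp; rewrite -h1; case: (nth l1 v p).
have B : agree (mem ps) (set_nth l1 s p (nth l1 v p)) v.
  split; first by rewrite e sz.
  move=> q; rewrite sz nth_set_nth /= => hq; have [h1 h2] := h q hq.
  case: (eqVneq q p) h1 h2 => [->|qp] h1 h2; split=> //.
  by move=> nq; apply: h2; rewrite inE negb_or qp.
by move: B; rewrite ep; case: (primed _) => B; [right|left]; apply/IH.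
Qed.

(** First occurrences depend on the indices alone, so all members of a class have them at the same
    positions. *)
Lemma repsP s v : reflect (canon v = canon s) (v \in reps s).
Proof.
have hs : all (fun p => p < size s) (first_positions s).
  by apply/allP => p; rewrite mem_filter mem_iota add0n => /andP[_ /andP[]].
apply: (iffP (reps_auxP v hs)).
  case=> e h; rewrite /canon e; apply/eq_in_map => p; rewrite mem_iota add0n => /andP[_ hp].
  have fo : first_occ v p = first_occ s p.
    rewrite /first_occ; apply: eq_in_all => q; rewrite mem_iota add0n => /andP[_ hq].
    by rewrite (proj1 (h p hp)) (proj1 (h q (ltn_trans hq hp))).
  rewrite fo; case: ifP => hf; first by rewrite (proj1 (h p hp)).
  have nm : p \notin first_positions s by rewrite mem_filter hf.
  by rewrite (proj2 (h p hp) nm).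
move=> e; have sz := size_canon_eq e; split=> // p hp.
have ei q : q < size s -> idx (nth l1 v q) = idx (nth l1 s q).
  move=> hq; have := congr1 (fun x => nth 0 x q) (canon_idx e).
  by rewrite /= !(nth_map l1) ?sz.
split; first exact: ei.
move=> nm; have nf : ~~ first_occ s p.
  by move: (nm : p \notin first_positions s); rewrite mem_filter mem_iota add0n /= hp andbT.
have := congr1 (fun x => nth l1 x p) e.
rewrite /= !(nth_map 0) ?size_iota ?sz // !nth_iota ?sz // !add0n (negbTE nf).
suff -> : first_occ v p = first_occ s p by rewrite (negbTE nf).
rewrite /first_occ; apply: eq_in_all => q; rewrite mem_iota add0n => /andP[_ hq].
by rewrite !ei ?(ltn_trans hq hp).
Qed.

(** The free letter is primed for index 1 and unprimed for index 2, whence the exclusive or. *)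
Definition enc (a : sletter) : letter := (if a.1 then 2 else 1, a.1 (+) a.2).
Definition dec i (a : letter) : sletter := (idx a == i.+1, (idx a == i.+1) (+) primed a).

Lemma encK : cancel enc (dec 1).
Proof. by case=> -[] []. Qed.

Lemma decK a : in_i 1 a -> enc (dec 1 a) = a.
Proof. by case: a => k p; rewrite /in_i /= => /orP[] /eqP ->; case: p. Qed.

Lemma enc_in a : in_i 1 (enc a).
Proof. by case: a => -[] []. Qed.

Definition all12 s := all (in_i 1) s.
Definition rdec s := rev (map (dec 1) s).
Definition renc w := rev (map enc w).

Lemma rencK : cancel renc rdec.
Proof. by move=> w; rewrite /rdec /renc map_rev revK mapK //; apply: encK. Qed.

Lemma rdecK s : all12 s -> renc (rdec s) = s.
Proof.
rewrite /rdec /renc map_rev revK -map_comp => h.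
by rewrite -[RHS]map_id; apply/eq_in_map => a /(allP h)/decK.
Qed.

Lemma all12_renc w : all12 (renc w).
Proof. by rewrite /all12 /renc all_rev all_map; apply/allP => a _; apply: enc_in. Qed.

Lemma rdec_rcons s a : rdec (rcons s a) = dec 1 a :: rdec s.
Proof. by rewrite /rdec map_rcons rev_rcons. Qed.

Lemma rdec_cat s v : rdec (s ++ v) = rdec v ++ rdec s.
Proof. by rewrite /rdec map_cat rev_cat. Qed.

Lemma size_rdec s : size (rdec s) = size s.
Proof. by rewrite size_rev size_map. Qed.

Lemma walk_pos s : all12 s -> walk s = (pos (rdec s) false, pos (rdec s) true).
Proof.
rewrite /walk; elim/last_ind: s => // s a IH; rewrite /all12 all_rcons => /andP[ha /IH e].
rewrite foldl_rcons e rdec_rcons -(decK ha) encK {ha e IH}; move: (dec 1 a) (rdec s) => c w.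
by case: c => -[] []; rewrite /step /=; case: (pos w false) => [|x]; case: (pos w true) => [|y] //=; rewrite ?subn0 ?subn1.
Qed.

Lemma enc_inj : injective enc. Proof. exact: can_inj encK. Qed.

Lemma enc_eqs (u u' : seq sletter) : (map enc u == map enc u') = (u == u').
Proof. exact/inj_eq/inj_map/enc_inj. Qed.

Definition critfor b := if b then critE else critF.

Lemma critfor_enc b x y (u : seq sletter) :
  critfor b (x, y) (map enc u) =
  omap (omap (map enc)) (critg b (if b then y else x) (if b then x else y) u).
Proof.
have e1 : [:: l1] = map enc [:: (false, false)] by [].
have e1' : [:: l1'] = map enc [:: (false, true)] by [].
have e2 : [:: l2] = map enc [:: (true, true)] by [].
have e2' : [:: l2'] = map enc [:: (true, false)] by [].
have al (c : sletter) t : all (pred1 (enc c)) (map enc t) = all (pred1 c) t.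
  by rewrite all_map; apply: eq_all => z /=; rewrite (inj_eq enc_inj).
have ew : (l1 = enc (false, false)) * (l1' = enc (false, true)) *
  (l2 = enc (true, true)) * (l2' = enc (true, false)) by [].
case: b; rewrite /critfor /critE /critF /critg /= ?e1 ?e1' ?e2 ?e2' !enc_eqs size_map.
all: case: ifP => // _; case: ifP => // _; case: ifP => // _; case: ifP => // s2.
all: case: u s2 => // c u _; rewrite /= last_map -map_take !ew !(inj_eq enc_inj) !al.
all: by case: ifP => // _ /=; rewrite ?map_cat //; case: ifP => // _ /=; rewrite ?map_cat.
Qed.

Lemma renc_cons a w : renc (a :: w) = rcons (renc w) (enc a).
Proof. by rewrite /renc /= rev_cons. Qed.

Lemma seen_renc a w : seen (renc w) (idx (enc a)) = hasi a.1 w.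
Proof.
rewrite /seen /renc has_rev has_map; apply: eq_has => -[j f] /=.
by case: a => -[] ? /=; case: j.
Qed.

Lemma canon_renc_nf w : canon (renc (nf w)) = canon (renc w).
Proof.
elim: w => //= a w IH; rewrite /sn !renc_cons; apply/canon_rcons_eq; split=> //.
rewrite (seen_renc (a.1, _)) hasi_nf /= => ->; by rewrite orbF -surjective_pairing.
Qed.

Lemma nf_rdec_canon s : all12 s -> nf (rdec (canon s)) = nf (rdec s).
Proof.
elim/last_ind: s => // s a IH; rewrite /all12 all_rcons => /andP[ha /[dup] hs /IH e].
rewrite canon_rcons !rdec_rcons /= e; case: ifP => // h.
have {}h : hasi (dec 1 a).1 (nf (rdec s)) = false.
  by rewrite hasi_nf -seen_renc decK // rdecK.
by move: h; rewrite /sn /= => ->; rewrite !orbT.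
Qed.

Lemma all_in_idx i s v : map idx s = map idx v -> all (in_i i) s = all (in_i i) v.
Proof.
move=> e; have P u : all (in_i i) u = all [pred k | (k == i) || (k == i.+1)] (map idx u).
  by rewrite all_map; apply: eq_all.
by rewrite !P e.
Qed.

Lemma canon_nf s v : all12 s -> all12 v -> canon v = canon s <-> nf (rdec v) = nf (rdec s).
Proof.
move=> hs hv; split=> e; first by rewrite -nf_rdec_canon // e nf_rdec_canon.
by rewrite -(rdecK hs) -(rdecK hv) -canon_renc_nf e canon_renc_nf.
Qed.

(** * The final critical substring of a word *)

Lemma final_candP cs :
  if final_cand cs is Some c then c \in cs /\ forall c', c' \in cs -> ~~ better c' c
  else cs = [::].
Proof.
rewrite /final_cand; elim/last_ind: cs => // cs c; rewrite foldl_rcons.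
case: foldl => [d [hd h]|->] /=; last first.
  rewrite inE; split=> // c'; rewrite inE => /eqP ->; rewrite /better; lia.
case: ifP => hb.
  rewrite mem_rcons mem_head; split=> // c'; rewrite mem_rcons inE => /orP[/eqP ->|/h].
    by rewrite /better; lia.
  move: hb; rewrite /better; lia.
rewrite mem_rcons inE hd orbT; split=> // c'; rewrite mem_rcons inE => /orP[/eqP ->|/h //].
by rewrite hb.
Qed.

Lemma mem_candidates crit s k l v r :
  ((k, l, v, r) : candidate) \in candidates crit s <->
  [/\ v \in reps s, k <= l < size v & crit (walk (take k v)) (drop k (take l.+1 v)) = Some r].
Proof.
split.
  case/flattenP => x /mapP[v' hv ->] /flattenP[y /mapP[k' hk ->]].
  rewrite mem_pmap => /mapP[l' hl]; case E: (crit _ _) => [r'|] //= [-> -> -> ->].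
  move: hk hl; rewrite !mem_iota => /andP[_ hk] /andP[hl1 hl2]; split=> //.
  by move: hl1 hl2 hk; lia.
case=> hv /andP[h1 h2] E; apply/flattenP.
eexists; first by apply/mapP; exists v.
apply/flattenP; eexists.
  by apply/mapP; exists k => //; rewrite mem_iota; lia.
rewrite mem_pmap; apply/mapP; exists l; first by rewrite mem_iota; lia.
by rewrite E.
Qed.

Lemma all12_canon s v : all12 s -> canon v = canon s -> all12 v.
Proof. by move=> hs /canon_idx e; rewrite /all12 (all_in_idx 1 e). Qed.

Lemma map_dec_rev s : map (dec 1) s = rev (rdec s).
Proof. by rewrite /rdec revK. Qed.

Lemma critfor_word b p u : all12 p -> all12 u ->
  critfor b (walk p) u = omap (omap (map enc)) (critg b (pos (rdec p) b) (pos (rdec p) (~~ b)) (map (dec 1) u)).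
Proof.
move=> hp hu; rewrite walk_pos //.
have -> : u = map enc (map (dec 1) u).
  by rewrite -map_comp -[LHS]map_id; apply/eq_in_map => a /(allP hu)/= /decK.
by rewrite critfor_enc -map_comp (eq_map encK) map_id; case: b.
Qed.

Lemma take_drop_split (T : Type) (x : seq T) k l : k <= l ->
  x = take k x ++ drop k (take l x) ++ drop l x.
Proof.
move=> h; rewrite -{1}(cat_take_drop l x) catA; congr (_ ++ _).
by rewrite -{1}(cat_take_drop k (take l x)) take_takel.
Qed.

Lemma cand_of_candidate b s k l v r : all12 s ->
  ((k, l, v, r) : candidate) \in candidates (critfor b) s ->
  cand b (nf (rdec s)) k l (omap (fun u => nf (rdec (take k v ++ u ++ drop l.+1 v))) r) /\
  (forall u, r = Some u -> all12 (take k v ++ u ++ drop l.+1 v)).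
Proof.
move=> hs /mem_candidates[/repsP e /andP[h1 h2] cr].
have hv := all12_canon hs e.
have sp := take_drop_split v (leqW h1).
set p := take k v in cr sp *; set u := drop k _ in cr sp; set q := drop l.+1 v in sp *.
have := hv; rewrite {1}sp /all12 !all_cat => /and3P[hp hu hq].
move: cr; rewrite critfor_word //; case E: critg => [r'|] //= [<-].
split; last first.
  by case: (r') => // u' w [<-]; rewrite !all_cat hp hq andbT all_map; apply/allP => z _; apply: enc_in.
exists (rdec q), (map (dec 1) u), (rdec p), r'; split.
- by rewrite map_dec_rev revK -!rdec_cat -catA -sp; apply/canon_nf.
- by rewrite size_rdec size_takel //; lia.
- by rewrite size_map size_drop !size_takel //; lia.
- exact/critgP.
- case: (r') => //= u'; congr (Some (nf _)); rewrite !rdec_cat -catA; congr (_ ++ (_ ++ _)).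
  by rewrite /rdec -map_comp (eq_map encK) map_id.
Qed.

Lemma candidate_of_cand b s k l rh : all12 s -> cand b (nf (rdec s)) k l rh ->
  exists v r, ((k, l, v, r) : candidate) \in candidates (critfor b) s.
Proof.
move=> hs [q [u [p [r [e1 e2 e3 /critgP e4 e5]]]]].
have su : 0 < size u by case: (u) e4.
pose v := renc (q ++ rev u ++ p).
have ev : v = renc p ++ map enc u ++ renc q.
  by rewrite /v /renc !map_cat map_rev !rev_cat revK -catA.
have sp : size (renc p) = k by rewrite size_rev size_map.
have tk : take k v = renc p by rewrite ev take_size_cat.
exists v, (omap (map enc) r); apply/mem_candidates; split.
- by apply/repsP/canon_nf; rewrite ?all12_renc // rencK.
- by rewrite ev !size_cat sp size_map; lia.
- rewrite tk; have -> : drop k (take l.+1 v) = map enc u.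
    by rewrite -e3 ev catA take_size_cat ?drop_size_cat // size_cat sp size_map.
  rewrite critfor_word ?all12_renc //; last by rewrite /all12 all_map; apply/allP => z _; apply: enc_in.
  by rewrite rencK -map_comp (eq_map encK) map_id e4.
Qed.

(** The fold keeps some candidate with maximal ends, whichever representative it comes from; by the
    last clause of [best] every such candidate has the same normalized result. *)
Lemma crit_op_flip b s : all12 s ->
  if crit_op (critfor b) s is Some t then all12 t /\ flip b (nf (rdec s)) = Some (nf (rdec t))
  else flip b (nf (rdec s)) = None.
Proof.
move=> hs; have [o [B ->]] := best_flip b (nf_nfp (rdec s)).
rewrite /crit_op; have := final_candP (candidates (critfor b) s).
case: final_cand => [[[[k l] v] r]|].
  case=> h1 h2; have [c1 c2] := cand_of_candidate hs h1.
  case: o B => [[[k0 l0] r0]|] /= B; last by case: (B _ _ _ c1).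
  case: B => B1 B2; have [v0 [r1 h3]] := candidate_of_cand hs B1.
  have hb := h2 _ h3; have er : r0 = omap (fun u => nf (rdec (take k v ++ u ++ drop l.+1 v))) r.
    by case: (B2 _ _ _ c1) hb => [?|[-> ?]|[-> -> ->]] //; rewrite /better /=; lia.
  by rewrite er; case: r c2 {h1 c1 er h2 hb} => //= u c2; split; first exact: c2.
move=> e0; case: o B => [[[k l] r]|] //= [B1 _].
by have [v [r1]] := candidate_of_cand hs B1; rewrite e0.
Qed.
End Representatives.

(** * Standardization as an order pattern *)

Section Sim.
Variables (T : Type) (o : rel T).
Implicit Types w v u : seq T.

(** Equality of order patterns: [o] relates each earlier letter to each later one in the same way in
    both words. The lists are reversed, so the head is the later letter and the second argument of
    [o]. *)
Fixpoint simr w v :=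
  match w, v with
  | [::], [::] => true
  | a :: w', c :: v' => simr w' v' && all2 (fun x y => o x a == o y c) w' v'
  | _, _ => false
  end.

Lemma simr_size w v : simr w v -> size w = size v.
Proof. by elim: w v => [|a w IH] [|c v] //= /andP[/IH ->]. Qed.

Lemma all2_refl_in (r : rel T) w : (forall x, r x x) -> all2 r w w.
Proof. by move=> h; elim: w => //= a w ->; rewrite h. Qed.

Lemma all2_trans_in (r : rel T) (r' r'' : rel T) w v u :
  (forall x y z, r x y -> r' y z -> r'' x z) -> all2 r w v -> all2 r' v u -> all2 r'' w u.
Proof.
move=> h; elim: w v u => [|x w IH] [|y v] [|z u] //= /andP[h1 h2] /andP[h3 h4].
by rewrite (h _ _ _ h1 h3) (IH _ _ h2 h4).
Qed.

Lemma all2_sym_in (r r' : rel T) w v :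
  (forall x y, r x y -> r' y x) -> all2 r w v -> all2 r' v w.
Proof.
by move=> h; elim: w v => [|x w IH] [|y v] //= /andP[/h -> /IH ->].
Qed.

Lemma all2_imp (r r' : rel T) w v :
  (forall x y, r x y -> r' x y) -> all2 r w v -> all2 r' w v.
Proof. by move=> h; elim: w v => [|x w IH] [|y v] //= /andP[/h -> /IH ->]. Qed.

Lemma all2_count (P Q : pred T) w v :
  all2 (fun x y => P x ==> Q y) w v -> count P w <= count Q v.
Proof.
elim: w v => [|x w IH] [|y v] //= /andP[h /IH]; move: h.
by case: (P x); case: (Q y) => //=; lia.
Qed.

Lemma simr_refl w : simr w w.
Proof. by elim: w => //= a w ->; apply: all2_refl_in. Qed.

Lemma simr_sym w v : simr w v -> simr v w.
Proof.
elim: w v => [|a w IH] [|c v] //= /andP[/IH -> ] /=.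
by apply: all2_sym_in => x y /eqP ->.
Qed.

Lemma simr_trans w v u : simr w v -> simr v u -> simr w u.
Proof.
elim: w v u => [|a w IH] [|c v] [|d u] //= /andP[h1 h2] /andP[h3 h4].
rewrite (IH _ _ h1 h3); apply: all2_trans_in h2 h4 => x y z /eqP -> /eqP ->; exact: eqxx.
Qed.

Lemma simrP x0 w v : reflect
  (size w = size v /\ forall p q, p < q < size w ->
     o (nth x0 w q) (nth x0 w p) = o (nth x0 v q) (nth x0 v p))
  (simr w v).
Proof.
elim: w v => [|a w IH] [|c v] /=; do ?[by constructor | by constructor; case].
apply: (iffP andP) => [[/IH [e h] h2]|[[e] h]].
  split=> [|[|p] [|q]] //=; first by rewrite e.
    rewrite ltnS => hq; move: h2; rewrite all2E e eqxx /= => /(all_nthP (x0, x0)) /(_ q).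
    by rewrite size_zip e minnn -e => /(_ hq); rewrite nth_zip //= => /eqP.
  by rewrite !ltnS; apply: h.
split.
  by apply/IH; split=> // p q hpq; apply: (h p.+1 q.+1).
rewrite all2E e eqxx /=; apply/(all_nthP (x0, x0)) => q; rewrite size_zip e minnn -e => hq.
by rewrite nth_zip //=; apply/eqP; apply: (h 0 q.+1).
Qed.
End Sim.

(** For [c] to the left of [d], this says that [c] gets the smaller number in the standardization.
    Among equal indices only the prime of the later letter counts, so the prime of a first
    occurrence is never consulted; this makes the pattern independent of the representative. *)
Definition olt (c d : letter) := (idx c < idx d) || ((idx c == idx d) && ~~ primed d).
(** The test [d.1 == d.2] says that [d] is 1 or 2, that is, unprimed. *)
Definition soltn (c d : sletter) := (~~ c.1 && d.1) || ((c.1 == d.1) && (d.1 == d.2)).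

Lemma olt_dec c d : in_i 1 c -> in_i 1 d -> olt c d = soltn (dec 1 c) (dec 1 d).
Proof.
by case: c => k p; case: d => k' p'; rewrite /in_i /= => /orP[] /eqP -> /orP[] /eqP ->; case: p; case: p'.
Qed.

Lemma simr_map (T U : Type) (o : rel T) (o' : rel U) (f : T -> U) (P : pred T) w v :
  (forall x y, P x -> P y -> o x y = o' (f x) (f y)) -> all P w -> all P v ->
  simr o w v = simr o' (map f w) (map f v).
Proof.
move=> h; elim: w v => [|a w IH] [|c v] //= /andP[ha hw] /andP[hc hv].
rewrite IH //; congr (_ && _); elim: w v hw hv {IH} => [|x w IH] [|y v] //= /andP[hx hw] /andP[hy hv].
by rewrite !h // IH.
Qed.

Lemma simr_rdec s v : all12 s -> all12 v -> simr olt (rev s) (rev v) = simr soltn (rdec s) (rdec v).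
Proof.
move=> hs hv; rewrite /rdec -!map_rev.
by apply: (simr_map olt_dec); rewrite all_rev.
Qed.

Lemma simr_nf w : simr soltn (nf w) w.
Proof.
elim: w => //= a w ->; rewrite /=.
have hd : forall u, (forall x, x \in u -> x \in w) ->
   all2 (fun x y : sletter => soltn x (a.1, a.2 || ~~ hasi a.1 (nf w)) == soltn y a) (nf u) u.
  elim=> //= x u IH hu; rewrite IH ?andbT; last by move=> z hz; apply: hu; rewrite inE hz orbT.
  rewrite /soltn /=; case: (boolP (hasi a.1 (nf w))) => [_|]; first by rewrite orbF.
  rewrite hasi_nf => /hasPn /(_ x (hu x (mem_head _ _))) /negbTE ->.
  by [].
exact: hd.
Qed.

Lemma simr_nfs w v : simr soltn (nf w) (nf v) = simr soltn w v.
Proof.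
apply/idP/idP => h.
  apply: simr_trans (simr_nf v); apply: simr_trans h; exact/simr_sym/simr_nf.
apply: simr_trans (simr_nf w) _; apply: simr_trans h _; exact/simr_sym/simr_nf.
Qed.

(** * The primed operators and order patterns *)

Section Primed.
Implicit Types (a c : sletter) (w t v : seq sletter) (b : bool).

Notation simL := (simr soltn).

Lemma all2_true (T : Type) (r : rel T) (w v : seq T) : size w = size v -> (forall x y, r x y) -> all2 r w v.
Proof. by move=> + h; elim: w v => [|x w IH] [|y v] //= [/IH ->]; rewrite h. Qed.

Lemma soltn_free (x c : sletter) : c.2 -> soltn x c = c.1.
Proof. by case: x c => -[] ? [[] []]. Qed.

Lemma simL_free a w v : a.2 -> simL w v -> simL (a :: w) (a :: v).
Proof.
move=> a2 h /=; rewrite h; apply: all2_true; first exact: simr_size h.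
by move=> x y; rewrite !soltn_free.
Qed.

Lemma sn_free a w : a.2 -> sn a w = a :: w.
Proof. by case: a => j f; rewrite /sn /= => ->. Qed.

(** Both 1 and 2' exceed exactly the earlier letters of index 1, so exchanging them keeps the
    pattern. The free letters passed over compare with every earlier letter in a fixed way. *)
Lemma flipP_sim b w t : nfp w -> flipP b w = Some t -> simL w t.
Proof.
elim: w t => //= a w IH t /andP[jw nw].
have {IH} H r : flipP b w = Some r -> simL w r by exact: IH.
case: ifP => [/eqP ab|ab].
  case: ifP => [/andP[af h]|hf [<-]].
    by osome r E; rewrite sn_free //; apply: simL_free af (H r E).
  rewrite /sn /= simr_refl /=.
  have hb : a.2 = ~~ hasi b w by move: hf jw; rewrite ab; case: (a.2); case: (hasi b w).
  have : forall u, (forall x, x \in u -> x \in w) ->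
     all2 (fun x y : sletter => soltn x a == soltn y (~~ b, ~~ hasi (~~ b) w)) u u.
    elim=> //= x u IH hu; rewrite IH ?andbT; last by move=> z hz; apply: hu; rewrite inE hz orbT.
    have xw := hu x (mem_head _ _).
    have h1 : a.2 -> (x.1 == b) = false by rewrite hb => /hasPn /(_ x xw) /negbTE.
    have h2 : ~~ hasi (~~ b) w -> (x.1 == ~~ b) = false by move/hasPn /(_ x xw) /negbTE.
    move: h1 h2; rewrite /soltn /= ab; case: (hasi _ _) => /=; case: (a.2); case: x {xw hu} => -[] ?; case: b {IH hb hf jw H ab} => //= h1 h2; first [by have := h1 isT | by have := h2 isT].
  exact.
case: ifP => // af; osome r E.
by rewrite sn_free //; apply: simL_free af (H r E).
Qed.

(** Letters of index 1 before [a] are smaller than it, so their partners are smaller than [c], which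
    forces index 1. *)
Lemma simL_cons_cross a c w v : a.1 -> ~~ c.1 -> simL (a :: w) (c :: v) -> cnt false w <= cnt false v.
Proof.
move=> a1 c1 /= /andP[_ h]; apply: all2_count; apply: all2_imp h => x y /eqP.
by case: a c a1 c1 => -[] ? [[] ?] //= _ _; case: x => -[] ? //; case: y => -[] ?.
Qed.

Lemma simL_same_idx a c w : a.1 = c.1 -> nfp (a :: w) -> nfp (c :: w) ->
  all2 (fun x y => soltn x a == soltn y c) w w -> a = c.
Proof.
case: a c => j f [j' f'] /= <- /andP[n1 _] /andP[n2 _] h.
case: (boolP (hasi j w)) n1 n2 => [hj _ _|_]; last by rewrite !orbF => -> ->.
elim: w h hj => //= x w IH /andP[/eqP h /IH {}IH] /orP[/eqP xj|//].
by clear IH; move: h; rewrite /soltn /= xj eqxx; case: (j); case: f; case: f'.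
Qed.

(** Standardization and weight determine a normal form; this is the uniqueness in the definition of
    the primed operators. *)
Lemma simL_cnt_eq w v : nfp w -> nfp v -> simL w v -> cnt false w = cnt false v -> w = v.
Proof.
elim: w v => [|a w IH] [|c v] // nw nv /[dup] s /= /andP[s1 s2] e.
have cross1 : a.1 -> ~~ c.1 -> cnt false w <= cnt false v by move=> h1 h2; apply: simL_cons_cross s.
have cross2 : c.1 -> ~~ a.1 -> cnt false v <= cnt false w by move=> h1 h2; apply: (simL_cons_cross h1 h2 (simr_sym s)).
have e1 : a.1 = c.1 by move: e cross1 cross2; rewrite /cnt /=; case: (a.1); case: (c.1) => //=; lia.
have {}IH : w = v.
  apply: IH => //; [by case/andP: nw | by case/andP: nv | by move: e; rewrite /cnt /= e1; lia].
by subst v; rewrite (simL_same_idx e1 nw nv s2).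
Qed.

Lemma simL_flipP w v : nfp w -> nfp v -> simL w v -> cnt false w = (cnt false v).+1 ->
  flipP false w = Some v.
Proof.
elim: w v => [|a w IH] [|c v] // nfw nfv /[dup] s /andP[s1 s2] e.
have /andP[jw nw] := nfw; have /andP[jv nv] := nfv.
(* If the drop in the count occurs before the last letters, some position has index 1 in [w] and
   index 2 in [v]. Comparing it with last letters of a common index forces one of them to be free;
   the other is free by a further comparison or by normality. *)
have hlt (r : rel sletter) : cnt false v < cnt false w ->
    all2 r w v -> exists x y, [/\ x.1 = false, y.1 = true & r x y].
  move=> h1 h2; case: (boolP (all2 (fun x y => (x.1 == false) ==> (y.1 == false)) w v)) => [/all2_count|].
    by rewrite -/(cnt false w) -/(cnt false v) leqNgt h1.
  elim: w v h2 {IH nfw nfv s s1 s2 e jw nw jv nv h1} => [|x w IH] [|y v] //= /andP[h1 h2].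
  rewrite negb_and => /orP[h|]; last exact: IH.
  by exists x, y; split=> //; move: h; case: (x.1); case: (y.1).
have hasw (r : rel sletter) j : hasi j w -> all2 r w v -> exists x y, x.1 = j /\ r x y.
  elim: (w) (v) => [|x w' IHw] [|y v'] //= /orP[/eqP xj|h] /andP[h1 h2]; first by exists x, y.
  exact: IHw h2.
have hasv (r : rel sletter) j : hasi j v -> all2 r w v -> exists x y, y.1 = j /\ r x y.
  elim: (w) (v) => [|x w' IHw] [|y v'] //= /orP[/eqP xj|h] /andP[h1 h2]; first by exists x, y.
  exact: IHw h2.
case: a c nfw nfv s s2 e jw jv => -[] f [[] f'] nfw nfv s s2 e jw jv.
- have e' : cnt false w = (cnt false v).+1 by clear -e; move: e; rewrite /cnt /=; lia.
  have [x [y [x1 y1 /eqP]]] := hlt _ ltac:(by rewrite e') s2.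
  rewrite /soltn x1 y1 /= => ef; have {x y x1 y1 ef} ef : f' = true by move: ef; case: (f').
  subst f'; have -> : f.
    case: (boolP (hasi true w)) jw => [h _|_ /=]; last by rewrite orbF.
    have [x [y [y1 /eqP]]] := hasw _ _ h s2.
    by rewrite [X in _ = X]soltn_free // /soltn y1 /=; case: (f).
  by rewrite /= (IH v) //= /sn /=.
- exfalso; have := simL_cons_cross (a := (true, f)) (c := (false, f')) isT isT s; clear -e; move: e; rewrite /cnt /=; lia.
- have e' : cnt false w = cnt false v by clear -e; move: e; rewrite /cnt /=; lia.
  have {}IH := simL_cnt_eq nw nv s1 e'; subst v.
  have diag (r : rel sletter) j : hasi j w -> all2 r w w -> exists x, x.1 = j /\ r x x.
    clear; elim: w => [|x w' IHw] //= /orP[/eqP xj|h] /andP[h1 h2]; first by exists x.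
    exact: IHw h2.
  have -> : flipP false ((false, f) :: w) = Some (sn (true, false) w).
    rewrite /=; case: ifP => // /andP[ff h]; have [x [x1 /eqP]] := diag _ _ h s2.
    by rewrite ff soltn_free // /soltn x1.
  rewrite /sn /=; congr (Some ((_, _) :: _)).
  case: (boolP (hasi true w)) jv => [h _|h]; last by rewrite orbF => /= ->.
  have [x [x1 /eqP]] := diag _ _ h s2.
  by rewrite /soltn x1 /=; case: (f').
- have e' : cnt false w = (cnt false v).+1 by clear -e; move: e; rewrite /cnt /=; lia.
  have [x [y [x1 y1 /eqP]]] := hlt _ ltac:(by rewrite e') s2.
  rewrite /soltn x1 y1 /= => ef; have {x y x1 y1 ef} ef : f = true by move: ef; case: (f).
  subst f; have -> : f'.
    case: (boolP (hasi false v)) jv => [h _|_ /=]; last by rewrite orbF.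
    have [x [y [y1 /eqP]]] := hasv _ _ h s2.
    by rewrite soltn_free // /soltn y1 /=; case: (f').
  have hw : hasi false w by rewrite hasi_cnt e'.
  by rewrite /= hw (IH v) //= /sn /=.
Qed.
End Primed.

(** * Standardization as a list of ranks *)

Section Standardization.
Implicit Types (s v : seq letter) (b : bool).

(* Encodes the lexicographic order of standardization (value, then position, reversed on primed
   letters) in a single number. *)
Definition key s p :=
  lval (nth l1 s p) * (size s).*2.+1 +
  (if primed (nth l1 s p) then size s - p else size s + p).

Lemma lex_ltn M a c x y : x < M -> y < M -> (a * M + x < c * M + y) = (a < c) || (a == c) && (x < y).
Proof. by move=> hx hy; case: (ltngtP a c) => h /=; nia. Qed.

Lemma lval_inj c d : 0 < idx c -> 0 < idx d -> lval c = lval d -> c = d.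
Proof.
by case: c => k p; case: d => k' p'; rewrite /lval /=; case: p; case: p' => h1 h2 e; congr (_, _); lia.
Qed.

Lemma key_lt s p q : p < size s -> q < size s -> (key s p < key s q) =
  (lval (nth l1 s p) < lval (nth l1 s q)) || (lval (nth l1 s p) == lval (nth l1 s q)) &&
   ((if primed (nth l1 s p) then size s - p else size s + p) <
    (if primed (nth l1 s q) then size s - q else size s + q)).
Proof. by move=> hp hq; rewrite lex_ltn //; case: ifP; lia. Qed.

Lemma key_olt s p q : all (fun c => 0 < idx c) s -> p < q < size s ->
  (key s p < key s q) = olt (nth l1 s p) (nth l1 s q) /\
  (key s q < key s p) = ~~ olt (nth l1 s p) (nth l1 s q).
Proof.
move=> hs /andP[pq hq]; have hp := ltn_trans pq hq.
have ip := allP hs _ (mem_nth l1 hp); have iq := allP hs _ (mem_nth l1 hq).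
rewrite !key_lt // /olt /lval /idx /primed.
move: ip iq; rewrite /idx; case: (nth l1 s p) => k e; case: (nth l1 s q) => k' e' /= ip iq.
by case: e; case: e' => /=; split; lia.
Qed.

Lemma count_nth (P : pred letter) s : count P s = count (fun r => P (nth l1 s r)) (iota 0 (size s)).
Proof. by rewrite -{1}(mkseq_nth l1 s) /mkseq count_map. Qed.

Lemma count_drop_nth (P : pred letter) s j : j < size s ->
  count P (drop j.+1 s) = count (fun r => P (nth l1 s r) && (j < r)) (iota 0 (size s)).
Proof.
move=> hj; have e : size s = j.+1 + (size s - j.+1) by lia.
rewrite [in RHS]e iotaD count_cat (_ : count _ (iota 0 j.+1) = 0) ?add0n; last first.
  rewrite -[RHS](count_pred0 (iota 0 j.+1)); apply: eq_in_count => r.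
  by rewrite mem_iota /= => hr; apply/negbTE; rewrite negb_and -leqNgt; apply/orP; right; lia.
rewrite -[drop _ _]take_size size_drop -(map_nth_iota l1); last by lia.
rewrite count_map; apply: eq_in_count => r; rewrite mem_iota /= => /andP[hr _].
by rewrite hr andbT.
Qed.

Lemma count_take_nth (P : pred letter) s j : j < size s ->
  count P (take j s) = count (fun r => P (nth l1 s r) && (r < j)) (iota 0 (size s)).
Proof.
move=> hj; have e : size s = j + (size s - j) by lia.
rewrite [in RHS]e iotaD count_cat (_ : count _ (iota (0 + j) _) = 0) ?addn0; last first.
  rewrite -[RHS](count_pred0 (iota (0 + j) (size s - j))); apply: eq_in_count => r.
  by rewrite mem_iota /= => hr; apply/negbTE; rewrite negb_and -leqNgt; apply/orP; right; lia.
rewrite -[X in take j X]drop0 -(map_nth_iota l1); last by lia.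
rewrite count_map; apply: eq_in_count => r; rewrite mem_iota /= => hr.
by rewrite hr andbT.
Qed.

Lemma nth_std s j : all (fun c => 0 < idx c) s -> j < size s ->
  nth 0 (std s) j = (count (fun r => key s r < key s j) (iota 0 (size s))).+1.
Proof.
move=> hs hj; rewrite /std (nth_map 0) ?size_iota // nth_iota // add0n; congr _.+1.
have -> : count (fun r => key s r < key s j) (iota 0 (size s)) =
  count (predU (fun r => lval (nth l1 s r) < lval (nth l1 s j))
   (fun r => (nth l1 s r == nth l1 s j) && (if primed (nth l1 s j) then j < r else r < j))) (iota 0 (size s)).
  apply: eq_in_count => r; rewrite mem_iota add0n => /andP[_ hr] /=.
  rewrite key_lt //; congr (_ || _).
  have ir := allP hs _ (mem_nth l1 hr); have ij := allP hs _ (mem_nth l1 hj).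
  case: (eqVneq (nth l1 s r) (nth l1 s j)) => [->|ne].
    by rewrite eqxx /=; case: ifP => _; lia.
  by case: eqP => // /(lval_inj ir ij) e; rewrite e eqxx in ne.
set A := fun r => lval (nth l1 s r) < lval (nth l1 s j).
set B := fun r => (nth l1 s r == nth l1 s j) && (if primed (nth l1 s j) then j < r else r < j).
have -> : count (predU A B) (iota 0 (size s)) = count A (iota 0 (size s)) + count B (iota 0 (size s)).
  rewrite -count_predUI -[LHS]addn0; congr (_ + _); apply/esym.
  rewrite -[RHS](count_pred0 (iota 0 (size s))); apply: eq_count => r /=.
  by rewrite /A /B; case: eqP => [->|_]; rewrite ?ltnn // andbF.
rewrite [in LHS]count_nth; congr (_ + _).
by rewrite /B; case: ifP => _; rewrite ?count_drop_nth ?count_take_nth.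
Qed.

Lemma size_std s : size (std s) = size s.
Proof. by rewrite /std size_map size_iota. Qed.

Lemma std_ltn s p q : all (fun c => 0 < idx c) s -> p < size s -> q < size s ->
  key s p < key s q -> nth 0 (std s) p < nth 0 (std s) q.
Proof.
move=> hs hp hq h; rewrite !nth_std // ltnS.
have hB : count (fun r => key s r < key s p) (iota 0 (size s)) + count (pred1 p) (iota 0 (size s)) <=
   count (fun r => key s r < key s q) (iota 0 (size s)).
  rewrite -count_predUI [X in _ + X](_ : _ = 0) ?addn0.
    by apply: sub_count => r /= /orP[/ltn_trans|/eqP ->] //; apply.
  rewrite -[RHS](count_pred0 (iota 0 (size s))); apply: eq_count => r /=.
  by case: eqP => [->|]; rewrite ?ltnn ?andbF.
have : count (pred1 p) (iota 0 (size s)) = 1 by rewrite count_uniq_mem ?iota_uniq // mem_iota /= add0n hp.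
by move: hB => + e; rewrite e addn1.
Qed.

(** The standardization lists the ranks of the positions by [key], and ranks and pairwise
    comparisons determine each other. *)
Lemma std_simr s v : all (fun c => 0 < idx c) s -> all (fun c => 0 < idx c) v ->
  (std s == std v) = simr olt (rev s) (rev v).
Proof.
move=> hs hv; apply/eqP/(simrP _ l1) => [e|[e h]].
  have sz : size s = size v by rewrite -size_std e size_std.
  split; first by rewrite !size_rev.
  move=> p q; rewrite size_rev => /andP[pq hq].
  rewrite !nth_rev -?sz ?(ltn_trans pq hq) //.
  set p' := size s - p.+1; set q' := size s - q.+1.
  have hqp : q' < p' < size s by rewrite /q' /p'; lia.
  have /andP[h1 hp'] := hqp; have hq' := ltn_trans h1 hp'.
  have [k1 k2] := key_olt hs hqp; have hqpv : q' < p' < size v by rewrite -sz.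
  have [k3 k4] := key_olt hv hqpv.
  move: (std_ltn hs hq' hp') (std_ltn hs hp' hq').
  have hqv : q' < size v by rewrite -sz.
  have hpv : p' < size v by rewrite -sz.
  move: (std_ltn hv hqv hpv) (std_ltn hv hpv hqv).
  rewrite k1 k2 k3 k4 e.
  case: (olt (nth l1 s q') (nth l1 s p')); case: (olt (nth l1 v q') (nth l1 v p')) => //= a1 a2 a3 a4.
    by have := a2 isT; have := a3 isT; lia.
  by have := a1 isT; have := a4 isT; lia.
have sz : size s = size v by rewrite -(size_rev s) e size_rev.
have olts p q : p < q < size s -> olt (nth l1 s p) (nth l1 s q) = olt (nth l1 v p) (nth l1 v q).
  move=> hpq; have := h (size s - q.+1) (size s - p.+1); rewrite size_rev.
  have /andP[pq hq] := hpq; have hp := ltn_trans pq hq.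
  have lt k : size s - k.+1 < size s by clear -hq; lia.
  have bk k : k < size s -> size s - (size s - k.+1).+1 = k by lia.
  by rewrite !nth_rev -?sz ?lt // !bk //; apply; lia.
apply: (@eq_from_nth _ 0) => [|j]; rewrite !size_std // => hj.
rewrite !nth_std // -?sz //; congr _.+1; apply: eq_in_count => r; rewrite mem_iota /= add0n => hr.
case: (ltngtP r j) => rj.
- have hrj : r < j < size s by rewrite rj.
  have [-> _] := key_olt hs hrj; have [-> _] := @key_olt v r j hv ltac:(by rewrite -sz).
  exact: olts.
- have hrj : j < r < size s by rewrite rj.
  have [_ ->] := key_olt hs hrj; have [_ ->] := @key_olt v j r hv ltac:(by rewrite -sz).
  by rewrite olts.
- by rewrite rj !ltnn.
Qed.

Lemma mem_all_strings N v : (v \in all_strings N) = (size v == N) && all12 v.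
Proof.
elim: N v => [|N IH] v.
  by rewrite inE /=; case: v => [|a v] //=; rewrite andbF.
apply/allpairsP/idP.
  case=> -[a t] /= [ha]; rewrite IH => /andP[/eqP <- h] ->; rewrite eqxx /= h andbT.
  by move: ha; rewrite !inE => /or4P[] /eqP ->.
case: v => // a v /andP[e /andP[ha hv]]; exists (a, v); split=> //=.
  by case: a ha {e} => k p; rewrite /in_i /= => /orP[] /eqP ->; case: p.
by rewrite IH -eqSS e.
Qed.

Lemma all_strings_uniq N : uniq (all_strings N).
Proof.
elim: N => // N IH; apply: (@allpairs_uniq _ _ _ cons) => //.
by move=> [a t] [a' t'] _ _ /= [-> ->].
Qed.

Lemma wt_rdec s b : all12 s -> wt s (if b then 2 else 1) = cnt b (rdec s).
Proof.
move=> h; rewrite /wt /cnt /rdec count_rev count_map; apply: eq_in_count => a /(allP h).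
by case: a => k p; rewrite /in_i /= => /orP[] /eqP ->; case: b.
Qed.

Lemma all12_pos s : all12 s -> all (fun c => 0 < idx c) s.
Proof. by apply: sub_all => c; rewrite /in_i => /orP[] /eqP ->. Qed.

Definition primefor b := if b then E'w else F'w.

Lemma primefor_flipP b s : all12 s ->
  if primefor b s is Some t then [/\ all12 t, canon t = t & flipP b (nf (rdec s)) = Some (nf (rdec t))]
  else flipP b (nf (rdec s)) = None.
Proof.
move=> hs; set w := nf (rdec s).
pose P v := [&& canon v == v, std v == std s & (if b then (wt v 1 == (wt s 1).+1) && ((wt v 2).+1 == wt s 2) else
  ((wt v 1).+1 == wt s 1) && (wt v 2 == (wt s 2).+1))].
have -> : primefor b s = if [seq v <- all_strings (size s) | P v] is [:: v] then Some v else None.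
  by rewrite /primefor /P; case: (b).
have cw b' : cnt b' w = wt s (if b' then 2 else 1) by rewrite cnt_nf wt_rdec.
have cv v b' : all12 v -> cnt b' (nf (rdec v)) = wt v (if b' then 2 else 1) by move=> h; rewrite cnt_nf wt_rdec.
have key v : v \in all_strings (size s) -> P v ->
    [/\ all12 v, canon v = v & flipP b w = Some (nf (rdec v))].
  rewrite mem_all_strings => /andP[_ hv] /and3P[/eqP c e n]; split=> //.
  have sm : simr soltn (nf (rdec v)) w.
    by rewrite simr_nfs -simr_rdec // -std_simr ?all12_pos.
  case: (b) n => /andP[/eqP n1 /eqP n2].
    (* [simL_flipP] treats F' only; for E' the roles of the two words are exchanged and the operator
       is inverted. *)
    have := @simL_flipP (nf (rdec v)) w (nf_nfp _) (nf_nfp _) sm.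
    by rewrite (cv _ false) // (cw false) n1 => /(_ erefl) /flipPK -> //; apply: nf_nfp.
  by apply: simL_flipP; rewrite ?nf_nfp //; [apply: simr_sym | rewrite (cv _ false) // (cw false) n1].
have mem v : v \in [seq v <- all_strings (size s) | P v] ->
    [/\ all12 v, canon v = v & flipP b w = Some (nf (rdec v))].
  by rewrite mem_filter => /andP[h1 h2]; apply: key.
have u : uniq [seq v <- all_strings (size s) | P v] by apply/filter_uniq/all_strings_uniq.
case E: [seq v <- all_strings (size s) | P v] mem u => [|v [|v' L]] mem u.
- case Ew: (flipP b w) => [t|] //; have [nt _ _ c1 c2] := flipP_moved (nf_nfp _) Ew.
  have e0 : nf (rdec (canon (renc t))) = t.
    by rewrite nf_rdec_canon ?all12_renc // rencK nf_id.
  have a0 : all12 (canon (renc t)).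
    by rewrite /all12 (all_in_idx 1 (idx_canon _)); apply: all12_renc.
  suff : canon (renc t) \in [seq v <- all_strings (size s) | P v] by rewrite E.
  have sm := flipP_sim (nf_nfp _) Ew.
  rewrite mem_filter mem_all_strings a0 andbT; apply/andP; split; last first.
    by rewrite size_canon /renc size_rev size_map -(simr_size sm) size_nf size_rdec.
  rewrite /P canonK eqxx /= std_simr ?all12_pos // simr_rdec // -simr_nfs e0 simr_sym //=.
  have f1 := cv _ false a0; have f2 := cv _ true a0; rewrite e0 in f1 f2.
  have g1 := cw false; have g2 := cw true.
  move: f1 f2 g1 g2 c1 c2 => /= f1 f2 g1 g2; rewrite -f1 -f2 -g1 -g2.
  by rewrite /w; clear; case: (b) => /=; lia.
- by apply: mem; rewrite inE.
- have [h1 h2 h3] := mem v (mem_head _ _).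
  have [h4 h5] := mem v' ltac:(by rewrite !inE eqxx orbT).
  rewrite h3 => -[/(canon_nf h4 h1)]; rewrite h2 h5 => e.
  by move: u; rewrite /= e mem_head.
Qed.
End Standardization.

(** * Stability of shifted tableaux, on positions of the reading word *)

(** Unprimed letters have even values: equal neighbours are allowed in a row if the value is even,
    in a column if it is odd. *)
Definition rowle (y z : nat) := (y < z) || (y == z) && ~~ odd y.
Definition colle (y z : nat) := (y < z) || (y == z) && odd y.

Definition between (a y : nat) := (a <= y) && (y <= a + 3).

(** * Inequalities for the walk at neighbouring entries *)

Section Geometry.

(* x lists the values of the N entries in reading order, with 1', 1, 2', 2 having the values a, ..., a+3;
   (X k, Y k) is the walk before entry k. H p: entries p and p+1 are adjacent in a row; V p q: entry p
   lies just below entry q; D p: entry p lies on the main diagonal. *)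
Variables (a N : nat) (x X Y : nat -> nat) (H D : nat -> Prop) (V : nat -> nat -> Prop).
Hypothesis odd_a : odd a.
Hypothesis rowx : forall p, H p -> rowle (x p) (x p.+1).
Hypothesis colx : forall p q, V p q -> colle (x q) (x p).
Hypothesis V_lt : forall p q, V p q -> p < q < N.
Hypothesis H_lt : forall p, H p -> p.+1 < N.
Hypothesis V_left : forall p q, V p q.+1 -> H q -> 
  (exists2 p0, p = p0.+1 & V p0 q /\ H p0) \/ D p /\ forall k, k.+1 = q -> ~ H k.
Hypothesis V_right : forall p q, V p q -> H p -> H q /\ V p.+1 q.+1.
Hypothesis D_first : forall p, D p -> a.+2 <= x p <= a + 3 -> forall k, k < p -> ~~ between a (x k).
Hypothesis V_rows : forall p q, V p q ->
  exists s, [/\ p < s <= q, (forall k, p <= k < q -> k.+1 <> s -> H k) & forall k, k.+1 = s -> ~ H k].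

Hypothesis start0 : X 0 = 0 /\ Y 0 = 0.
Hypothesis step1' : forall k, x k = a -> X k.+1 = (X k).+1 /\ Y k.+1 = Y k.
Hypothesis step2 : forall k, x k = a + 3 -> X k.+1 = X k /\ Y k.+1 = (Y k).+1.
Hypothesis step1 : forall k, x k = a.+1 ->
  if (0 < X k) && (0 < Y k) then X k.+1 = X k /\ (Y k.+1).+1 = Y k else X k.+1 = (X k).+1 /\ Y k.+1 = Y k.
Hypothesis step2' : forall k, x k = a.+2 ->
  if (0 < X k) && (0 < Y k) then (X k.+1).+1 = X k /\ Y k.+1 = Y k else X k.+1 = X k /\ Y k.+1 = (Y k).+1.
Hypothesis step_out : forall k, ~~ between a (x k) -> X k.+1 = X k /\ Y k.+1 = Y k.

Lemma walk_step k :
  [\/ x k = a /\ X k.+1 = (X k).+1 /\ Y k.+1 = Y k,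
      x k = a + 3 /\ X k.+1 = X k /\ Y k.+1 = (Y k).+1,
      x k = a.+1 /\ (0 < X k /\ 0 < Y k /\ X k.+1 = X k /\ (Y k.+1).+1 = Y k \/
                     (X k = 0 \/ Y k = 0) /\ X k.+1 = (X k).+1 /\ Y k.+1 = Y k) |
      x k = a.+2 /\ (0 < X k /\ 0 < Y k /\ (X k.+1).+1 = X k /\ Y k.+1 = Y k \/
                     (X k = 0 \/ Y k = 0) /\ X k.+1 = X k /\ Y k.+1 = (Y k).+1)]
  \/ (x k < a \/ a + 3 < x k) /\ X k.+1 = X k /\ Y k.+1 = Y k.
Proof.
case: (boolP (between a (x k))) => [hb|hb].
  left; have [e|[e|[e|e]]] : x k = a \/ x k = a + 3 \/ x k = a.+1 \/ x k = a.+2.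
    by move: hb; rewrite /between; lia.
  - by constructor 1; have := step1' e.
  - by constructor 2; have := step2 e.
  - constructor 3; split=> //; have := step1 e; case: ifP => h; [left|right]; first by case/andP: h.
    by split=> //; move: h; clear; lia.
  - constructor 4; split=> //; have := step2' e; case: ifP => h; [left|right]; first by case/andP: h.
    by split=> //; move: h; clear; lia.
by right; split; [move: hb; rewrite /between; lia | exact: step_out].
Qed.

Lemma row_chain p n : (forall k, p <= k < p + n -> H k) -> x p <= x (p + n).
Proof.
elim: n => [|n IH] h; first by rewrite addn0.
have := IH (fun k hk => h k ltac:(lia)); have := rowx (h (p + n) ltac:(lia)).
by rewrite addnS /rowle; lia.
Qed.

Lemma row_mono p q : p <= q -> (forall k, p <= k < q -> H k) -> x p <= x q.
Proof.
move=> pq h; have -> : q = p + (q - p) by lia.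
by apply: row_chain => k hk; apply: h; lia.
Qed.

Lemma walk_const (Z : nat -> nat) p q : p <= q ->
  (forall k, p <= k < q -> Z k.+1 = Z k) -> Z q = Z p.
Proof.
move=> pq; have -> : q = p + (q - p) by lia.
elim: (q - p) => [|n IH] h; first by rewrite addn0.
by rewrite addnS h; [apply: IH => k hk; apply: h; lia | lia].
Qed.

Lemma walk_mono (Z : nat -> nat) p q : p <= q ->
  (forall k, p <= k < q -> Z k <= Z k.+1) -> Z p <= Z q.
Proof.
move=> pq; have -> : q = p + (q - p) by lia.
elim: (q - p) => [|n IH] h; first by rewrite addn0.
have := h (p + n) ltac:(lia); rewrite addnS; apply: leq_trans.
by apply: IH => k hk; apply: h; lia.
Qed.

Lemma walk_anti (Z : nat -> nat) p q : p <= q ->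
  (forall k, p <= k < q -> Z k.+1 <= Z k) -> Z q <= Z p.
Proof.
move=> pq; have -> : q = p + (q - p) by lia.
elim: (q - p) => [|n IH] h; first by rewrite addn0.
have := h (p + n) ltac:(lia); rewrite addnS => /leq_trans; apply.
by apply: IH => k hk; apply: h; lia.
Qed.

Lemma diag_start p : D p -> a.+2 <= x p <= a + 3 -> X p = 0 /\ Y p = 0.
Proof.
move=> d hx; have h := D_first d hx; case: start0 => s1 s2.
by split; [rewrite -s1 | rewrite -s2]; apply: walk_const => // k hk;
   case: (step_out (h k ltac:(lia))).
Qed.

(* Past an entry 2' or 2 the rest of its row only contains 2 (and larger letters). *)
Lemma after_two p k : a.+2 <= x p -> p < k -> (forall j, p <= j < k -> H j) ->
  a + 3 <= x k.
Proof.
move=> h pk hH; have := rowx (hH p ltac:(lia)).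
have : x p.+1 <= x k by apply: row_mono => // j hj; apply: hH; lia.
by move: h odd_a; rewrite /rowle; lia.
Qed.

Lemma row_end_mono p q s : V p q -> a.+2 <= x p -> p < s <= q ->
  (forall k, p <= k < q -> k.+1 <> s -> H k) -> forall k, p < k < s -> a + 3 <= x k.
Proof.
move=> v hp hs hH k hk; apply: (after_two hp); first by lia.
by move=> j hj; apply: hH; lia.
Qed.

(** Between [s] and [q] only letters 1 lower Y. Such a 1 left of [q] stands over a 2' or 2, whose
    right neighbour must be a 2 and has raised Y. If the lower row starts on the diagonal too far
    right to provide that entry, X is still 0 at [s], where a 1 does not lower Y. *)
Lemma Y_before_above p q s : V p q -> a.+2 <= x p <= a + 3 -> a.+1 <= x q <= a.+2 ->
  p < s <= q -> (forall k, p <= k < q -> k.+1 <> s -> H k) -> (forall k, k.+1 = s -> ~ H k) ->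
  (Y s).+1 <= Y q + Y p.+1.
Proof.
elim: q p => [|q IH] p v hp hq hs hH hE; first by have := V_lt v.
have Yp : 0 < Y p.+1 by case: (walk_step p) => [[]|]; lia.
case: (eqVneq s q.+1) => [es|ns]; first by rewrite es; lia.
have Hq : H q by apply: hH; lia.
have rq := rowx Hq.
case: (ltnP (x q) a.+1) => [lq|gq].
  have -> : Y q.+1 = Y s.
    apply: walk_const; [lia | move=> k hk].
    have : x k <= x q by apply: row_mono; [lia | move=> j hj; apply: hH; lia].
    by case: (walk_step k) => [[]|]; lia.
  by lia.
have eq : x q = a.+1 by move: rq hq odd_a; rewrite /rowle /=; lia.
case: (V_left v Hq) => [[p0 e [v0 H0]]|[d dq]].
  have c0 := colx v0; have r0 := rowx H0.
  have hp0 : a.+2 <= x p0 <= a + 3 by move: c0 r0; rewrite -e eq /colle /rowle; lia.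
  have hs0 : p0 < s <= q by lia.
  have hH0 : forall k, p0 <= k < q -> k.+1 <> s -> H k.
    by move=> k hk hks; case: (eqVneq k p0) => [-> //|hkp]; apply: hH; lia.
  have := IH p0 v0 hp0 ltac:(lia) hs0 hH0 hE.
  have ep : x p = a + 3 by move: r0 hp hp0 odd_a; rewrite -e /rowle; lia.
  have [_ yp] := step2 ep.
  by rewrite -e yp; case: (walk_step q) => [[]|]; lia.
have esq : s = q.
  case: (eqVneq s q) => // nsq; case: q {IH v Hq rq gq eq hq} hs hH dq ns nsq => [|q] hs hH dq ns nsq; first lia.
  by case: (dq q erefl); apply: hH; lia.
have [X0 Y0] := diag_start d hp.
have Xs : forall n, p + n <= s -> X (p + n) = 0.
  elim=> [|n IHn] hn; first by rewrite addn0.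
  have {}IHn := IHn ltac:(lia).
  have hx : a.+2 <= x (p + n).
    case: n hn {IHn} => [|n] hn; first by rewrite addn0; lia.
    by have := row_end_mono v ltac:(lia) hs hH (k := p + n.+1) ltac:(lia); lia.
  by rewrite addnS; case: (walk_step (p + n)) => [[]|]; lia.
have := Xs (s - p) ltac:(lia); rewrite subnKC; last lia.
by rewrite esq => Xq; case: (walk_step q) => [[]|]; lia.
Qed.

(** After [p] the lower row holds only 2 and larger letters, so Y does not drop before [s]. *)
Lemma Y_above_pos p q : V p q -> a.+2 <= x p <= a + 3 -> a.+1 <= x q <= a.+2 -> 0 < Y q.
Proof.
move=> v hp hq; have [s [hs hH hE]] := V_rows v.
have := Y_before_above v hp hq hs hH hE.
suff : Y p.+1 <= Y s by lia.
apply: walk_mono; first by lia.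
move=> k hk; have := row_end_mono v ltac:(lia) hs hH (k := k) ltac:(lia).
by case: (walk_step k) => [[]|]; lia.
Qed.

Variable x' : nat -> nat.

(** [C] and [E] are the positions of the first and last letter of the critical substring; the
    constructors carry the numbers of the types. *)
Variant Fmove C E : Prop :=
  | F3 of C = E & x C = a.+1 & Y C = 0 & x' C = a + 3
  | F4 of C = E & x C = a & X C = 0 & x' C = a.+2
  | F1 of C < E & x C = a.+1 & x E = a.+2 & (forall k, C < k < E -> between a (x k) -> x k = a)
      & (Y C = 0 \/ Y C = 1 /\ 0 < X C) & x' C = a.+2 & x' E = a + 3
  | F2 of C < E & x C = a.+1 & x E = a & (forall k, C < k < E -> between a (x k) -> x k = a + 3)
      & (X C = 0 \/ X C = 1 /\ 0 < Y C) & x' C = a.+2 & x' E = a.+1.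

Variant Emove C E : Prop :=
  | E3 of C = E & x C = a.+2 & X C = 0 & x' C = a
  | E4 of C = E & x C = a + 3 & Y C = 0 & x' C = a.+1
  | E1 of C < E & x C = a.+2 & x E = a.+1 & (forall k, C < k < E -> between a (x k) -> x k = a + 3)
      & (X C = 0 \/ X C = 1 /\ 0 < Y C) & x' C = a.+1 & x' E = a
  | E2 of C < E & x C = a.+2 & x E = a + 3 & (forall k, C < k < E -> between a (x k) -> x k = a)
      & (Y C = 0 \/ Y C = 1 /\ 0 < X C) & x' C = a.+1 & x' E = a.+2.

Variables C E : nat.
Hypothesis same : forall k, k <> C -> k <> E -> x' k = x k.

Section Fclosure.
Hypothesis move_ : Fmove C E.
Hypothesis legal : forall k, E < k < N -> x k = a.+1 \/ x k = a.+2 -> 1 < X k /\ 0 < Y k.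

(** F raises values, so only the right neighbour of a changed entry can cause a conflict. For types
    3 and 4 a neighbour that is too small would be a 1 or 2' too close to an axis, against [legal];
    for types 1 and 2 the old row conditions suffice. *)
Lemma F_rows p : H p -> rowle (x' p) (x' p.+1).
Proof.
move=> h; have r := rowx h; have hN := H_lt h; have od := odd_a.
have sp := same (k := p); have sp1 := same (k := p.+1).
have lg := legal (k := p.+1).
have ws := walk_step p.
case: move_ => [eCE xC YC x'C|eCE xC XC x'C|lt xC xE mid YC x'C x'E|lt xC xE mid XC x'C x'E].
- subst E; case: (eqVneq p C) => [e|n1]; last case: (eqVneq p.+1 C) => [e|n2].
  + subst p; rewrite x'C sp1; try lia.
    suff : a + 3 <= x C.+1 by rewrite /rowle; move: od; clear; lia.
    rewrite leqNgt; apply/negP => hx.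
    have [|_] := lg ltac:(lia); first by move: r od; rewrite xC /rowle; lia.
    by case: ws => [[]|]; lia.
  + rewrite e x'C sp; try lia.
    by move: r; rewrite e xC /rowle; lia.
  + by rewrite sp ?sp1 //; lia.
- subst E; case: (eqVneq p C) => [e|n1]; last case: (eqVneq p.+1 C) => [e|n2].
  + subst p; rewrite x'C sp1; try lia.
    suff : a + 3 <= x C.+1 by rewrite /rowle; move: od; clear; lia.
    rewrite leqNgt; apply/negP => hx.
    have [|] := lg ltac:(lia); first by move: r od; rewrite xC /rowle; lia.
    by case: ws => [[]|]; lia.
  + rewrite e x'C sp; try lia.
    by move: r; rewrite e xC /rowle; lia.
  + by rewrite sp ?sp1 //; lia.
- case: (eqVneq p C) => [e|n1].
    subst p; rewrite x'C; case: (eqVneq C.+1 E) => [->|n2]; first by rewrite x'E /rowle; lia.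
    have hm := mid C.+1 ltac:(lia); rewrite sp1; try lia.
    by move: r hm od; rewrite xC /rowle /between; lia.
  case: (eqVneq p E) => [e|n2].
    by subst p; rewrite x'E sp1; try lia; move: r od; rewrite xE /rowle; lia.
  rewrite (sp ltac:(lia) ltac:(lia)).
  case: (eqVneq p.+1 C) => [e|n3]; first by rewrite e x'C; move: r; rewrite e xC /rowle; lia.
  case: (eqVneq p.+1 E) => [e|n4]; first by rewrite e x'E; move: r; rewrite e xE /rowle; lia.
  by rewrite sp1 //; lia.
- case: (eqVneq p C) => [e|n1].
    subst p; case: (eqVneq C.+1 E) => [e|n2].
      by move: r od; rewrite e xC xE /rowle; lia.
    have hm := mid C.+1 ltac:(lia); rewrite x'C sp1; try lia.
    by move: r hm od; rewrite xC /rowle /between; lia.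
  case: (eqVneq p E) => [e|n2].
    by subst p; rewrite x'E sp1; try lia; move: r od; rewrite xE /rowle; lia.
  rewrite (sp ltac:(lia) ltac:(lia)).
  case: (eqVneq p.+1 C) => [e|n3]; first by rewrite e x'C; move: r; rewrite e xC /rowle; lia.
  case: (eqVneq p.+1 E) => [e|n4]; first by rewrite e x'E; move: r; rewrite e xE /rowle; lia.
  by rewrite sp1 //; lia.
Qed.

(** X is positive after [p], and only a 2' in the rest of the lower row could lower it. Such a 2'
    forces the right neighbour of [q] to be 1 or 2', which the last hypothesis excludes when X is 0
    at [q]. Entries left of [q] are smaller than 1' and do not move the walk. *)
Lemma X_above_pos p q : V p q -> x q = a -> a <= x p <= a.+1 ->
  (q.+1 < N -> x q.+1 = a.+1 \/ x q.+1 = a.+2 -> 1 < X q.+1) -> X q <> 0.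
Proof.
move=> v xq xp lg Xq; have [s [hs hH hE]] := V_rows v; have od := odd_a.
have Xp : 0 < X p.+1 by case: (walk_step p) => [[]|]; lia.
have no2' k : p < k < s -> x k <> a.+2.
  move=> hk xk; have Hp : H p by apply: hH; lia.
  have [Hq vq] := V_right v Hp; have rq := rowx Hq; have cq := colx vq.
  have xpk : x p.+1 <= x k by apply: row_mono; [lia | move=> j hj; apply: hH; lia].
  have := lg (H_lt Hq) ltac:(by move: rq cq; rewrite xq /rowle /colle; lia).
  by case: (step1' xq) => ->; rewrite Xq.
have Xs : X p.+1 <= X s.
  apply: walk_mono; first by lia.
  by move=> k hk; have := no2' k ltac:(lia); case: (walk_step k) => [[]|]; lia.
have : X q = X s.
  apply: walk_const; first by lia.
  move=> k hk; have Hq : H q.-1 by apply: hH; lia.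
  have rq := rowx Hq.
  have : x k <= x q.-1 by apply: row_mono; [lia | move=> j hj; apply: hH; lia].
  move: rq; rewrite prednK; last lia.
  by rewrite xq /rowle; case: (walk_step k) => [[]|]; lia.
by lia.
Qed.

(** Only the lower neighbour of a changed entry matters. Raising a letter to 2 happens at Y = 0 and
    is settled by [Y_above_pos]; type 4 happens at X = 0 and is settled by [X_above_pos]. The first
    letter of types 1 and 2 causes no conflict. *)
Lemma F_cols p q : V p q -> colle (x' q) (x' p).
Proof.
move=> v; have r := colx v; have hN := V_lt v; have od := odd_a.
have sp := same (k := p); have sq := same (k := q).
case: move_ => [eCE xC YC x'C|eCE xC XC x'C|lt xC xE mid YC x'C x'E|lt xC xE mid XC x'C x'E].
- subst E; case: (eqVneq q C) => [e|n1]; last case: (eqVneq p C) => [e|n2].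
  + subst q; rewrite x'C sp; try lia.
    have := @Y_above_pos p C v; rewrite YC; move: r od; rewrite xC /colle; clear; lia.
  + rewrite e x'C sq; try lia.
    by move: r; rewrite e xC /colle; lia.
  + by rewrite sp ?sq //; lia.
- subst E; case: (eqVneq q C) => [e|n1]; last case: (eqVneq p C) => [e|n2].
  + subst q; rewrite x'C sp; try lia.
    have := @X_above_pos p C v xC; have lg := legal (k := C.+1).
    by move: r od; rewrite xC /colle; lia.
  + rewrite e x'C sq; try lia.
    by move: r; rewrite e xC /colle; lia.
  + by rewrite sp ?sq //; lia.
- case: (eqVneq q C) => [e|n1].
    subst q; rewrite x'C sp; try lia.
    by move: r od; rewrite xC /colle; lia.
  case: (eqVneq q E) => [e|n2].
    subst q; have hp : a.+2 <= x p by move: r; rewrite xE /colle; lia.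
    have YE : Y E = 0.
      have -> : Y E = Y C.+1.
        apply: walk_const; first by lia.
        move=> k hk; have := mid k ltac:(lia).
        by rewrite /between; case: (walk_step k) => [[]|]; lia.
      by case: (walk_step C) => [[]|]; lia.
    have pC : p <> C by move=> e; rewrite e xC in hp; lia.
    have := @Y_above_pos p E v; rewrite YE xE x'E sp; try lia.
    by rewrite /colle; lia.
  rewrite (sq ltac:(lia) ltac:(lia)).
  case: (eqVneq p C) => [e|n3]; first by rewrite e x'C; move: r; rewrite e xC /colle; lia.
  case: (eqVneq p E) => [e|n4]; first by rewrite e x'E; move: r; rewrite e xE /colle; lia.
  by rewrite sp //; lia.
- case: (eqVneq q C) => [e|n1].
    subst q; rewrite x'C sp; try lia.
    by move: r od; rewrite xC /colle; lia.
  case: (eqVneq q E) => [e|n2]; last first.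
    rewrite (sq ltac:(lia) ltac:(lia)).
    case: (eqVneq p C) => [e|n3]; first by rewrite e x'C; move: r; rewrite e xC /colle; lia.
    case: (eqVneq p E) => [e|n4]; first by rewrite e x'E; move: r; rewrite e xE /colle; lia.
    by rewrite sp //; lia.
  subst q; rewrite x'E; case: (eqVneq p C) => [->|n3]; first by rewrite x'C /colle; lia.
  rewrite sp; try lia; move: r; rewrite xE => r.
  case: (ltnP (x p) a.+2) => hp; last by rewrite /colle; lia.
  (* A 1' or 1 below [E] must come before [C]. If [C] lies in its row, the column condition fails
     one column further right; if [C] lies in the row of [E], a 1 precedes a 1' there. *)
  exfalso; case: (ltnP p C) => pC; last by have := mid p ltac:(lia); move: r; rewrite /between /colle; lia.
  have [s [hs hH hE]] := V_rows v.
  case: (ltnP C s) => Cs.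
    have Hp : H p by apply: hH; lia.
    have [Hq vq] := V_right v Hp; have rq := rowx Hq; have cq := colx vq.
    have : x p.+1 <= x C by apply: row_mono; [lia | move=> j hj; apply: hH; lia].
    by move: rq cq; rewrite xC xE /rowle /colle; lia.
  have : x C <= x E by apply: row_mono; [lia | move=> j hj; apply: hH; lia].
  by lia.
Qed.

End Fclosure.

Section Eclosure.

Hypothesis move_ : Emove C E.
Hypothesis legal : forall k, E < k < N -> x k = a.+1 \/ x k = a.+2 -> 0 < X k /\ 1 < Y k.

(** E lowers values, so only the left neighbour matters. For types 3 and 4 a left neighbour that is
    too large would have been read just before [C] and would have left the coordinate in question
    positive. *)
Lemma E_rows p : H p -> rowle (x' p) (x' p.+1).
Proof.
move=> h; have r := rowx h; have hN := H_lt h; have od := odd_a.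
have sp := same (k := p); have sp1 := same (k := p.+1).
have ws := walk_step p.
case: move_ => [eCE xC XC x'C|eCE xC YC x'C|lt xC xE mid XC x'C x'E|lt xC xE mid YC x'C x'E].
- subst E; case: (eqVneq p.+1 C) => [e|n2]; last case: (eqVneq p C) => [e|n1].
  + rewrite e x'C sp; try lia.
    have Xp : X p.+1 = 0 by rewrite e.
    by move: r; rewrite e xC /rowle; case: ws => [[]|]; lia.
  + subst p; rewrite x'C sp1; try lia.
    by move: r; rewrite xC /rowle; lia.
  + by rewrite sp ?sp1 //; lia.
- subst E; case: (eqVneq p.+1 C) => [e|n2]; last case: (eqVneq p C) => [e|n1].
  + rewrite e x'C sp; try lia.
    have Yp : Y p.+1 = 0 by rewrite e.
    by move: r; rewrite e xC /rowle; case: ws => [[]|]; lia.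
  + subst p; rewrite x'C sp1; try lia.
    by move: r; rewrite xC /rowle; lia.
  + by rewrite sp ?sp1 //; lia.
- case: (eqVneq p.+1 C) => [e|n1].
    rewrite e x'C sp; try lia.
    by move: r od; rewrite e xC /rowle; lia.
  case: (eqVneq p.+1 E) => [e|n2].
    rewrite e x'E; case: (eqVneq p C) => [ep|n3]; first by exfalso; move: r; rewrite e ep xC xE /rowle; lia.
    have hm := mid p ltac:(lia); rewrite sp; try lia.
    by move: r hm od; rewrite e xE /rowle /between; lia.
  rewrite (sp1 ltac:(lia) ltac:(lia)).
  case: (eqVneq p C) => [e|n3]; first by rewrite e x'C; move: r; rewrite e xC /rowle; lia.
  case: (eqVneq p E) => [e|n4]; first by rewrite e x'E; move: r; rewrite e xE /rowle; lia.
  by rewrite sp //; lia.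
- case: (eqVneq p.+1 C) => [e|n1].
    rewrite e x'C sp; try lia.
    by move: r od; rewrite e xC /rowle; lia.
  case: (eqVneq p.+1 E) => [e|n2].
    rewrite e x'E; case: (eqVneq p C) => [ep|n3]; first by rewrite ep x'C /rowle; lia.
    have hm := mid p ltac:(lia); rewrite sp; try lia.
    by move: r hm od; rewrite e xE /rowle /between; lia.
  rewrite (sp1 ltac:(lia) ltac:(lia)).
  case: (eqVneq p C) => [e|n3]; first by rewrite e x'C; move: r; rewrite e xC /rowle; lia.
  case: (eqVneq p E) => [e|n4]; first by rewrite e x'E; move: r; rewrite e xE /rowle; lia.
  by rewrite sp //; lia.
Qed.

(** One column to the right, a 2 in the lower row raises Y and the 1 at [q] lowers it, so the right
    side does not change. At the end of the lower row [legal] gives Y >= 2 at the upper entry. *)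
Lemma Y_above_two p q s : V p q -> a.+2 <= x p <= a + 3 -> a.+1 <= x q <= a.+2 -> E < q ->
  p < s <= q -> (forall k, p <= k < q -> k.+1 <> s -> H k) -> (forall k, k.+1 = s -> ~ H k) ->
  (Y s).+2 <= Y q + Y p.+1.
Proof.
move=> v hp hq hE hs; have [n] : exists n, s - p = n by exists (s - p).
elim: n p q v hp hq hE hs => [|n IH] p q v hp hq hE hs en hH hEnd; first by lia.
have od := odd_a; have hN := V_lt v.
have [lX lY] : 0 < X q /\ 1 < Y q by apply: legal; lia.
case: (eqVneq p.+1 s) => [e|ne]; first by rewrite e; lia.
have Hp : H p by apply: hH; lia.
have rp := rowx Hp.
have [Hq vq] := V_right v Hp; have rq := rowx Hq; have cq := colx vq.
case: (ltnP (a + 3) (x p.+1)) => hp1.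
  have -> : Y s = Y p.+1.
    apply: walk_const; first by lia.
    move=> k hk; have : x p.+1 <= x k by apply: row_mono; [lia | move=> j hj; apply: hH; lia].
    by case: (walk_step k) => [[]|]; lia.
  by lia.
have xp1 : x p.+1 = a + 3 by move: rp; rewrite /rowle; lia.
have xq1 : a.+1 <= x q.+1 <= a.+2 by move: rq cq; rewrite xp1 /rowle /colle; lia.
have xq : x q = a.+1 by move: rq; rewrite /rowle; lia.
have := IH p.+1 q.+1 vq ltac:(lia) xq1 ltac:(lia) ltac:(lia) ltac:(lia).
have hH' : forall k, p.+1 <= k < q.+1 -> k.+1 <> s -> H k.
  by move=> k hk ks; case: (eqVneq k q) => [-> //|kq]; apply: hH; lia.
move=> /(_ hH' hEnd); have [_ ->] := step2 xp1.
by case: (walk_step q) => [[]|]; lia.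
Qed.

(** Left of [q] its row has no 2' and no 2, so Y does not rise from [s] to [q], and the bound on the
    sum falls entirely on the lower entry. *)
Lemma Y_above_contra p q : V p q -> a.+2 <= x p <= a + 3 -> a.+1 <= x q <= a.+2 -> E < q ->
  1 < Y p.+1.
Proof.
move=> v hp hq hE; have [s [hs hH hEnd]] := V_rows v.
have := Y_above_two v hp hq hE hs hH hEnd.
suff : Y q <= Y s by lia.
apply: walk_anti; first by lia.
move=> k hk; have Hq : H q.-1 by apply: hH; lia.
have rq := rowx Hq.
have : x k <= x q.-1 by apply: row_mono; [lia | move=> j hj; apply: hH; lia].
move: rq odd_a; rewrite prednK; last lia.
by rewrite /rowle; case: (walk_step k) => [[]|]; lia.
Qed.

(** The critical case is a 1 or 2' above [C], which lies after [E]; then Y >= 2 just after [C]. For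
    types 4 and 2 the walk has Y = 1 there. For types 3 and 1 the contradiction is found one column
    to the left, or on the diagonal, where again Y = 1. *)
Lemma E_cols p q : V p q -> colle (x' q) (x' p).
Proof.
move=> v; have r := colx v; have hN := V_lt v; have od := odd_a.
have sp := same (k := p); have sq := same (k := q).
have diag : D p -> a.+2 <= x p <= a + 3 -> Y p.+1 = 1.
  by move=> d hx; have [X0 Y0] := diag_start d hx; case: (walk_step p) => [[]|]; lia.
case: move_ => [eCE xC XC x'C|eCE xC YC x'C|lt xC xE mid XC x'C x'E|lt xC xE mid YC x'C x'E].
- case: (eqVneq p C) => [e|n1]; last case: (eqVneq q C) => [e|n2].
  + subst p; rewrite x'C sq; try lia.
    suff : x q <= a by rewrite /colle; lia.
    rewrite leqNgt; apply/negP => hq.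
    have hq2 : a.+1 <= x q <= a.+2 by move: r; rewrite xC /colle; lia.
    have hC : a.+2 <= x C <= a + 3 by lia.
    have Y2 := Y_above_contra v hC hq2 ltac:(lia).
    have [lX _] : 0 < X q /\ 1 < Y q by apply: legal; lia.
    have [s [hs hH hEnd]] := V_rows v.
    (* X is 0 at the end of the lower row but positive at [q], so the left neighbour of [q] is at
       least 1'. Below that neighbour stands a 1' or 1, just left of [C], against X = 0 at [C];
       otherwise [C] is on the diagonal. *)
    have Xs : X s = 0.
      have -> : X s = X C.+1.
        apply: walk_const; first by lia.
        move=> k hk; have := row_end_mono v ltac:(lia) hs hH (k := k) ltac:(lia).
        by case: (walk_step k) => [[]|]; lia.
      by case: (walk_step C) => [[]|]; lia.
    case: (eqVneq s q) => [esq|nsq]; first by move: lX; rewrite -esq Xs.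
    have Hq : H q.-1 by apply: hH; lia.
    have rq := rowx Hq; have eq1 : q.-1.+1 = q by lia.
    case: (leqP a (x q.-1)) => ha; last first.
      suff : X q = X s by lia.
      apply: walk_const; first by lia.
      move=> k hk; have : x k <= x q.-1 by apply: row_mono; [lia | move=> j hj; apply: hH; lia].
      by case: (walk_step k) => [[]|]; lia.
    move: v; rewrite -eq1 => v; case: (V_left v Hq) => [[p0 e [v0 H0]]|[d _]].
      have c0 := colx v0; have r0 := rowx H0.
      have Xp : X p0.+1 = 0 by rewrite -e.
      by move: c0 r0; rewrite -e xC /colle /rowle; case: (walk_step p0) => [[]|]; lia.
    by have := diag d hC; lia.
  + rewrite e x'C sp; try lia.
    by move: r; rewrite e xC /colle; lia.
  + by rewrite sp ?sq //; lia.
- case: (eqVneq p C) => [e|n1]; last case: (eqVneq q C) => [e|n2].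
  + subst p; rewrite x'C sq; try lia.
    have [_ Y1] := step2 xC; have := @Y_above_contra C q v.
    by move: r od; rewrite xC /colle; lia.
  + rewrite e x'C sp; try lia.
    by move: r; rewrite e xC /colle; lia.
  + by rewrite sp ?sq //; lia.
- case: (eqVneq q E) => [e|n1].
    subst q; rewrite x'E; case: (eqVneq p C) => [->|n2]; first by rewrite x'C /colle; lia.
    by rewrite sp; try lia; move: r; rewrite xE /colle; lia.
  case: (eqVneq p E) => [e|n2].
    have n3 : q <> C by lia.
    by rewrite e x'E sq; try lia; move: r od; rewrite e xE /colle; lia.
  case: (eqVneq q C) => [e|n3].
    rewrite e x'C sp; try lia.
    by move: r; rewrite e xC /colle; lia.
  rewrite sq; try lia.
  case: (eqVneq p C) => [e|n4]; last by rewrite sp //; lia.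
  subst p; rewrite x'C.
  suff : x q <= a by rewrite /colle; lia.
  rewrite leqNgt; apply/negP => hq.
  have hq2 : a.+1 <= x q <= a.+2 by move: r; rewrite xC /colle; lia.
  have hC : a.+2 <= x C <= a + 3 by lia.
  case: (ltnP q E) => qE; first by have := mid q ltac:(lia); rewrite /between; lia.
  have Y2 := Y_above_contra v hC hq2 ltac:(lia).
  have [s [hs hH hEnd]] := V_rows v.
  (* [E] lies in the row of [q], because its 1 cannot follow the 2' at [C] within a row. So the left
     neighbour of [q] is at least 1, and no value fits below it to the left of the 2'. *)
  have sE : s <= E.
    rewrite leqNgt; apply/negP => Es.
    have : x C <= x E by apply: row_mono; [lia | move=> j hj; apply: hH; lia].
    by lia.
  have Hq : H q.-1 by apply: hH; lia.
  have rq := rowx Hq; have eq1 : q.-1.+1 = q by lia.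
  have xq1 : a.+1 <= x q.-1.
    have : x E <= x q.-1 by apply: row_mono; [lia | move=> j hj; apply: hH; lia].
    by lia.
  move: v; rewrite -eq1 => v; case: (V_left v Hq) => [[p0 e [v0 H0]]|[d _]].
    have c0 := colx v0; have r0 := rowx H0.
    by move: c0 r0 rq od; rewrite -e xC eq1 /colle /rowle; lia.
  by have := diag d hC; lia.
- case: (eqVneq q E) => [e|n1].
    subst q; rewrite x'E; have pC : p <> C by move=> e; move: r; rewrite e xC xE /colle; lia.
    by rewrite sp; try lia; move: r; rewrite xE /colle; lia.
  case: (eqVneq p E) => [e|n2].
    have n3 : q <> C by lia.
    by rewrite e x'E sq; try lia; move: r od; rewrite e xE /colle; lia.
  case: (eqVneq q C) => [e|n3].
    rewrite e x'C sp; try lia.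
    by move: r; rewrite e xC /colle; lia.
  rewrite sq; try lia.
  case: (eqVneq p C) => [e|n4]; last by rewrite sp //; lia.
  subst p; rewrite x'C.
  suff : x q <= a by rewrite /colle; lia.
  rewrite leqNgt; apply/negP => hq.
  have hq2 : a.+1 <= x q <= a.+2 by move: r; rewrite xC /colle; lia.
  have hC : a.+2 <= x C <= a + 3 by lia.
  case: (ltnP q E) => qE; first by have := mid q ltac:(lia); rewrite /between; lia.
  have Y2 := Y_above_contra v hC hq2 ltac:(lia).
  by case: (walk_step C) => [[]|]; lia.
Qed.

End Eclosure.
End Geometry.

(** * Shifted skew shapes as positions in the reading word *)

Section Shape.
Variables lam mu : seq nat.
Hypothesis lam_strict : strict_partition lam.
Hypothesis mu_strict : strict_partition mu.
Hypothesis mu_lam : contained mu lam.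

Local Notation L := (size lam).
Local Notation m r := (nth 0 mu r).
Local Notation l r := (nth 0 lam r).
Local Notation len := (rowlen lam mu).

(* cell_off r is the number of entries read before row r, cell_pos r c the position of cell (r, c). *)
Definition cell_off r := sumn [seq len k | k <- iota r.+1 (L - r.+1)].
Definition cell_pos r c := cell_off r + (c - (r + m r)).
Definition shape_size := sumn [seq len r | r <- iota 0 L].
Local Notation ins := (in_shape lam mu).

Lemma strict_step s r : strict_partition s -> nth 0 s r.+1 < nth 0 s r \/ nth 0 s r.+1 = 0.
Proof.
case/andP=> _ h; case: (ltnP r.+1 (size s)) => hr; last by right; rewrite nth_default.
left; apply: (@sorted_ltn_nth _ gtn (rev_trans ltn_trans) 0 s h r r.+1); rewrite ?inE //; lia.
Qed.

Lemma lam_pos r : r < L -> 0 < l r.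
Proof. by move=> hr; case/andP: lam_strict => /allP h _; apply: h; apply: mem_nth. Qed.

Lemma lam_step r : r.+1 < L -> l r.+1 < l r.
Proof. by move=> hr; have := strict_step r lam_strict; have := lam_pos hr; lia. Qed.

Lemma lam_mono r r' : r <= r' -> r' < L -> r' + l r' <= r + l r.
Proof.
move=> h; have -> : r' = r + (r' - r) by lia.
elim: (r' - r) => [|n IH] hr; first by rewrite addn0.
have := IH ltac:(lia); have := @lam_step (r + n) ltac:(lia); rewrite addnS; lia.
Qed.

(** Once [mu] is exhausted the rows start on the diagonal and their left ends move right again,
    hence the positivity assumption. *)
Lemma mu_mono r r' : r <= r' -> 0 < m r' -> r' + m r' <= r + m r.
Proof.
move=> h; have -> : r' = r + (r' - r) by lia.
elim: (r' - r) => [|n IH] hr; first by rewrite addn0.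
have := IH; have := strict_step (r + n) mu_strict; rewrite addnS in hr *; lia.
Qed.

Lemma cell_off_step r : r.+1 < L -> cell_off r = len r.+1 + cell_off r.+1.
Proof. by move=> hr; rewrite /cell_off (_ : L - r.+1 = (L - r.+2).+1) //; lia. Qed.

Lemma cell_off_lt r r' : r < r' < L -> cell_off r' + len r' <= cell_off r.
Proof.
case/andP=> h; have -> : r' = (r + (r' - r.+1)).+1 by lia.
elim: (r' - r.+1) => [|n IH] hr.
  by rewrite addn0 in hr *; rewrite (cell_off_step hr) addnC.
apply: leq_trans (IH ltac:(lia)); rewrite addnS in hr *.
by rewrite (cell_off_step hr); lia.
Qed.

Lemma shape_size_off : 0 < L -> shape_size = len 0 + cell_off 0.
Proof. by rewrite /shape_size /cell_off; case: (size lam) => // n _; rewrite subn1. Qed.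

Lemma ins_lt r c : ins r c -> r < L. Proof. by case/andP. Qed.

Lemma cell_pos_bound r c : ins r c -> cell_off r <= cell_pos r c < cell_off r + len r.
Proof. by rewrite /in_shape /cell_pos /rowlen; lia. Qed.

Lemma cell_pos_size r c : ins r c -> cell_pos r c < shape_size.
Proof.
move=> h; have hr := ins_lt h; have := cell_pos_bound h.
rewrite shape_size_off; last lia.
case: (posnP r) => [->|r0]; first lia.
by have := @cell_off_lt 0 r ltac:(lia); lia.
Qed.

Lemma cell_pos_inj r c r' c' : ins r c -> ins r' c' -> cell_pos r c = cell_pos r' c' -> r = r' /\ c = c'.
Proof.
move=> h h' e; have b := cell_pos_bound h; have b' := cell_pos_bound h'.
have hr := ins_lt h; have hr' := ins_lt h'.
have er : r = r'.
  case: (ltngtP r r') => // hlt.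
    by have := @cell_off_lt r r' ltac:(lia); lia.
  by have := @cell_off_lt r' r ltac:(lia); lia.
split=> //; subst r'; move: e h h'; rewrite /cell_pos /in_shape; lia.
Qed.

Lemma cell_pos_surj k : k < shape_size -> exists r c, ins r c /\ k = cell_pos r c.
Proof.
have key r : r < L -> k < cell_off r + len r -> exists r c, ins r c /\ k = cell_pos r c.
  move=> hr; have [n] : exists n, L - r = n by exists (L - r).
  elim: n r hr => [|n IH] r hr en hk; first lia.
  case: (ltnP k (cell_off r)) => hk2.
    case: (ltnP r.+1 L) => hr1.
      by apply: (IH r.+1) => //; [lia | rewrite addnC -cell_off_step].
    by move: hk2; rewrite /cell_off (_ : L - r.+1 = 0) //; lia.
  exists r, (r + m r + (k - cell_off r)); split; last by rewrite /cell_pos; lia.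
  by move: hk; rewrite /in_shape /rowlen hr; lia.
move=> hk; case: (posnP L) => hL; last by apply: (key 0) => //; rewrite addnC -shape_size_off.
by move: hk; rewrite /shape_size hL.
Qed.

Lemma cell_posS r c : ins r c -> ins r c.+1 -> cell_pos r c.+1 = (cell_pos r c).+1.
Proof. by rewrite /in_shape /cell_pos; lia. Qed.

Definition hadj p := exists r c, [/\ p = cell_pos r c, ins r c & ins r c.+1].
Definition vadj p q := exists r c, [/\ q = cell_pos r c, p = cell_pos r.+1 c, ins r c & ins r.+1 c].
Definition diag p := exists r, p = cell_pos r r /\ ins r r.

Lemma hadj_lt p : hadj p -> p.+1 < shape_size.
Proof. by case=> r [c [-> h1 h2]]; rewrite -cell_posS //; apply: cell_pos_size. Qed.

Lemma vadj_lt p q : vadj p q -> p < q < shape_size.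
Proof.
case=> r [c [-> -> h1 h2]]; rewrite cell_pos_size // andbT.
have := cell_pos_bound h1; have := cell_pos_bound h2.
by have := @cell_off_lt r r.+1 ltac:(rewrite ltnSn; exact: ins_lt h2); lia.
Qed.

(** By strictness of [mu], a row can start further right than the row above it only when both start
    on the diagonal. *)
Lemma vadj_left p q : vadj p q.+1 -> hadj q ->
  (exists2 p0, p = p0.+1 & vadj p0 q /\ hadj p0) \/ diag p /\ forall k, k.+1 = q -> ~ hadj k.
Proof.
case=> r [c [e1 e2 h1 h2]] [r' [c' [e3 h3 h4]]].
have [er ec] : r' = r /\ c'.+1 = c by apply: cell_pos_inj => //; rewrite cell_posS // -e3.
subst r' c; case: (leqP (r.+1 + m r.+1) c') => hc.
  have h5 : ins r.+1 c' by move: h2 hc; rewrite /in_shape; lia.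
  left; exists (cell_pos r.+1 c'); first by rewrite e2 cell_posS.
  by split; [exists r, c' | exists r.+1, c'].
right; have hm : c' = r /\ m r = 0 /\ m r.+1 = 0.
  have := strict_step r mu_strict; move: h2 h3 hc; rewrite /in_shape; lia.
case: hm => ec [m0 m1]; subst c'; split; first by exists r.+1.
move=> k ek [r' [c' [e5 h5 h6]]].
have [] : r' = r /\ c'.+1 = r by apply: cell_pos_inj => //; rewrite cell_posS // -e5 ek.
by move=> e6 e7; move: h5; rewrite e6 /in_shape; lia.
Qed.

Lemma vadj_right p q : vadj p q -> hadj p -> hadj q /\ vadj p.+1 q.+1.
Proof.
case=> r [c [-> -> h1 h2]] [r' [c' [e3 h3 h4]]].
have [er ec] := cell_pos_inj h2 h3 e3; subst r' c'.
have h5 : ins r c.+1.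
  by have := @lam_step r (ins_lt h2); move: h1 h4; rewrite /in_shape; lia.
by split; [exists r, c | exists r, c.+1; rewrite !cell_posS].
Qed.

(** A row is read immediately before the row above it, and [s] is the start of the upper one. *)
Lemma vadj_rows p q : vadj p q ->
  exists s, [/\ p < s <= q, (forall k, p <= k < q -> k.+1 <> s -> hadj k) & forall k, k.+1 = s -> ~ hadj k].
Proof.
case=> r [c [-> -> h1 h2]]; exists (cell_off r).
have b1 := cell_pos_bound h1; have b2 := cell_pos_bound h2.
have eo := cell_off_step (ins_lt h2).
split; first lia.
- move=> k hk ks; case: (ltnP k (cell_off r)) => hkr.
    exists r.+1, (r.+1 + m r.+1 + (k - cell_off r.+1)); move: hk hkr ks b2 h2; rewrite eo /cell_pos /in_shape /rowlen => hk hkr ks b2 h2.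
    by split; lia.
  exists r, (r + m r + (k - cell_off r)); move: hk hkr b1 h1; rewrite /cell_pos /in_shape /rowlen => hk hkr b1 h1.
  by split; lia.
- move=> k ek [r' [c' [e3 h3 h4]]].
  have h5 : ins r (r + m r) by move: h1; rewrite /in_shape; lia.
  have [] : r' = r /\ c'.+1 = r + m r.
    by apply: cell_pos_inj => //; rewrite cell_posS // -e3 ek /cell_pos subnn addn0.
  by move=> e6 e7; move: h3; rewrite e6 /in_shape; lia.
Qed.

(** The entry right of a diagonal 2' or 2 is at least 2, so the diagonal entry below that one
    exceeds 2. Going down, all entries of the lower rows exceed 2, and these are all that is read
    before [p]. *)
Lemma diag_first a (x : nat -> nat) : odd a ->
  (forall p, hadj p -> rowle (x p) (x p.+1)) -> (forall p q, vadj p q -> colle (x q) (x p)) ->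
  forall p, diag p -> a.+2 <= x p <= a + 3 -> forall k, k < p -> ~~ between a (x k).
Proof.
move=> od rowx colx p [r [ep hrr]] hx k hk.
have m0 : m r = 0 by move: hrr; rewrite /in_shape; lia.
have mr r' : r <= r' -> m r' = 0.
  by move=> h; case: (posnP (m r')) => // h'; have := mu_mono h h'; lia.
have rowend r' c c' : ins r' c -> ins r' c' -> c <= c' -> x (cell_pos r' c) <= x (cell_pos r' c').
  move=> h h' hc; have [n en] : exists n, c' = c + n by exists (c' - c); lia.
  subst c'; elim: n h' {hc} => [|n IH] h'; first by rewrite addn0.
  have h2 : ins r' (c + n) by move: h h'; rewrite /in_shape; lia.
  apply: leq_trans (IH h2) _; rewrite addnS in h' *; rewrite cell_posS //.
  have := rowx (cell_pos r' (c + n)) ltac:(by exists r', (c + n)); rewrite /rowle; lia.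
have key n : forall c, ins (r + n.+1) c -> a + 3 < x (cell_pos (r + n.+1) c).
  elim: n => [|n IH] c h.
    have ml := mr (r + 1) ltac:(lia); rewrite addn1 in ml h *.
    have hd : ins r.+1 r.+1 by move: h; rewrite /in_shape ml; lia.
    have h2 : ins r r.+1.
      by have := @lam_step r (ins_lt hd); move: hrr hd; rewrite /in_shape; lia.
    have r1 := rowx (cell_pos r r) ltac:(by exists r, r).
    have c1 := colx (cell_pos r.+1 r.+1) (cell_pos r r.+1) ltac:(by exists r, r.+1).
    have := rowend r.+1 r.+1 c hd h ltac:(by move: h; rewrite /in_shape ml; lia).
    rewrite -cell_posS // in r1; move: r1 c1 hx od; rewrite ep /rowle /colle; lia.
  have ml := mr (r + n.+2) ltac:(lia); rewrite addnS in ml h *.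
  have hd : ins (r + n.+1).+1 (r + n.+1).+1 by move: h; rewrite /in_shape ml; lia.
  have h2 : ins (r + n.+1) (r + n.+1).+1.
    have m2 := mr (r + n.+1) ltac:(lia).
    by have := @lam_step (r + n.+1) (ins_lt hd); move: hd; rewrite /in_shape m2; lia.
  have c1 := colx (cell_pos (r + n.+1).+1 (r + n.+1).+1) (cell_pos (r + n.+1) (r + n.+1).+1)
    ltac:(by exists (r + n.+1), (r + n.+1).+1).
  have := rowend _ _ c hd h ltac:(by move: h; rewrite /in_shape ml; lia).
  by have := IH _ h2; move: c1; rewrite /colle; lia.
have hN : k < shape_size by have := cell_pos_size hrr; lia.
have [r' [c' [h' ek]]] := cell_pos_surj hN.
have hr : r < r'.
  rewrite ltnNge; apply/negP; rewrite leq_eqVlt => /orP[/eqP e|hlt].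
    by move: hk; rewrite ek ep e /cell_pos; move: h'; rewrite e /in_shape; lia.
  have := @cell_off_lt r' r ltac:(rewrite hlt; exact: ins_lt hrr).
  by have := cell_pos_bound hrr; have := cell_pos_bound h'; lia.
have := key (r' - r.+1) c'; rewrite (_ : r + (r' - r.+1).+1 = r'); last lia.
by move=> /(_ h'); rewrite -ek /between; lia.
Qed.
Local Notation P := cell_pos.

Lemma sumn_rev_take r (f : nat -> nat) N : r < N ->
  sumn (take (N - r.+1) (rev [seq f k | k <- iota 0 N])) = sumn [seq f k | k <- iota r.+1 (N - r.+1)].
Proof.
move=> hr; rewrite take_rev sumn_rev size_map size_iota -map_drop drop_iota add0n.
by rewrite (_ : N - (N - r.+1) = r.+1) //; lia.
Qed.

Lemma nth_rows_of v r : r < L ->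
  nth [::] (rows_of lam mu v) r = take (rowlen lam mu r) (drop (cell_off r) v).
Proof.
move=> hr; rewrite /rows_of nth_rev; last by rewrite size_reshape size_rev size_map size_iota.
rewrite size_reshape size_rev size_map size_iota nth_reshape sumn_rev_take //.
congr (take _ _); rewrite nth_rev size_map size_iota; last lia.
rewrite (nth_map 0) ?size_iota; last lia.
by rewrite nth_iota; [congr rowlen; lia | lia].
Qed.

Lemma size_rows_of v : size (rows_of lam mu v) = L.
Proof. by rewrite /rows_of size_rev size_reshape size_rev size_map size_iota. Qed.

Lemma entry_rows_of v r c : ins r c -> entry lam mu (rows_of lam mu v) r c = nth l1 v (P r c).
Proof.
move=> h; rewrite /entry nth_rows_of; last by case/andP: h.
rewrite nth_take; last by move: h; rewrite /in_shape /rowlen; lia.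
by rewrite nth_drop; congr nth; rewrite /cell_pos; lia.
Qed.

Lemma flatten_rows_of v : size v = shape_size -> flatten (rev (rows_of lam mu v)) = v.
Proof.
move=> h; rewrite /rows_of revK reshapeKr // h /shape_size.
by rewrite sumn_rev.
Qed.

Lemma all_flatten_all (T : Type) (Q : pred T) ss : all Q (flatten ss) = all (all Q) ss.
Proof. by elim: ss => //= t ss IH; rewrite all_cat IH. Qed.

Definition good n v : Prop :=
  [/\ all (fun a => 1 <= idx a <= n) v,
      forall p, hadj p -> rowle (lval (nth l1 v p)) (lval (nth l1 v p.+1)) &
      forall p q, vadj p q -> colle (lval (nth l1 v q)) (lval (nth l1 v p))].

Lemma rowle_letters a b : 0 < idx a -> 0 < idx b ->
  (lval a <= lval b) && ~~ (primed a && (a == b)) = rowle (lval a) (lval b).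
Proof.
move=> ha hb; rewrite /rowle leq_eqVlt.
case: (eqVneq (lval a) (lval b)) => [/(lval_inj ha hb) ->|ne] /=.
  rewrite ltnn eqxx andbT; case: b hb => k p; rewrite /lval /primed /=; case: p => /= hk; last by rewrite odd_double.
  by rewrite -subn1 oddB ?odd_double //; lia.
have -> : (a == b) = false by apply/eqP => e; rewrite e eqxx in ne.
by rewrite !andbF andbT orbF.
Qed.

Lemma colle_letters a b : 0 < idx a -> 0 < idx b ->
  (lval a <= lval b) && ~~ (~~ primed a && (a == b)) = colle (lval a) (lval b).
Proof.
move=> ha hb; rewrite /colle leq_eqVlt.
case: (eqVneq (lval a) (lval b)) => [/(lval_inj ha hb) ->|ne] /=.
  rewrite ltnn eqxx andbT; case: b hb => k p; rewrite /lval /primed /=; case: p => /= hk; last by rewrite odd_double.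
  by rewrite -subn1 oddB ?odd_double //; lia.
have -> : (a == b) = false by apply/eqP => e; rewrite e eqxx in ne.
by rewrite !andbF andbT orbF.
Qed.

Lemma rowle_trans : transitive rowle.
Proof. by move=> y x z; rewrite /rowle; lia. Qed.
Lemma colle_trans : transitive colle.
Proof. by move=> y x z; rewrite /colle; lia. Qed.

Lemma ins_head r c : ins r c -> c < head 0 lam.
Proof.
move=> h; have hr := ins_lt h; have := @lam_mono 0 r (leq0n r) hr.
by rewrite nth0; move: h; rewrite /in_shape; lia.
Qed.

Lemma all_iota_in (Q : pred nat) N r : all Q (iota 0 N) -> r < N -> Q r.
Proof. by move/allP => h hr; apply: h; rewrite mem_iota. Qed.

(** Arbitrary pairs reduce to adjacent ones by transitivity; for columns this uses that both borders
    of the shape are monotone, so that a column has no gaps. *)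
Lemma valid_good n v : size v = shape_size ->
  valid_filling n lam mu (rows_of lam mu v) <-> good n v.
Proof.
move=> sz; rewrite /valid_filling size_rows_of eqxx /=.
have idxs : all (fun row => all (fun a => (1 <= idx a <= n)) row) (rows_of lam mu v) =
            all (fun a => 1 <= idx a <= n) v.
  by rewrite -{2}(flatten_rows_of sz) all_flatten_all all_rev.
rewrite idxs; have pos0 : all (fun a => 1 <= idx a <= n) v -> forall r c, ins r c -> 0 < idx (nth l1 v (P r c)).
  by move=> h r c hi; have /andP[] := allP h _ (mem_nth l1 (ltac:(by rewrite sz; apply: cell_pos_size) : P r c < size v)).
split.
  case/and4P=> _ ha hr hc; have hp := pos0 ha; split=> //.
  - move=> p [r [c [-> h1 h2]]]; rewrite -cell_posS // -rowle_letters ?hp //.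
    have := all_iota_in (all_iota_in (all_iota_in hr (ins_lt h1)) (ins_head h1)) (ins_head h2).
    by rewrite h1 h2 ltnSn /= !entry_rows_of.
  - move=> p q [r [c [-> -> h1 h2]]]; rewrite -colle_letters ?hp //.
    have := all_iota_in (all_iota_in (all_iota_in hc (ins_head h1)) (ins_lt h1)) (ins_lt h2).
    by rewrite h1 h2 ltnSn /= !entry_rows_of.
case=> ha hr hc; have hp := pos0 ha; apply/and4P; split=> //.
- apply/allP => r; rewrite mem_iota /= => hL; rewrite nth_rows_of //.
  rewrite size_take size_drop sz; case: ifP => //.
  have : cell_off r + rowlen lam mu r <= shape_size.
    case: (posnP (rowlen lam mu r)) => [->|hl].
      rewrite addn0; case: (posnP r) => [->|r0]; first by rewrite shape_size_off; lia.
      have := @cell_off_lt 0 r ltac:(lia); rewrite shape_size_off; lia.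
    have h1 : ins r (r + l r).-1 by move: hl; rewrite /rowlen /in_shape; lia.
    have := cell_pos_size h1; rewrite /cell_pos; move: h1 hl; rewrite /rowlen /in_shape; lia.
  by lia.
- apply/allP => r _; apply/allP => c _; apply/allP => c' _; apply/implyP => /andP[/andP[h1 h2] hlt].
  rewrite !entry_rows_of // rowle_letters ?hp //.
  have [k ek] : exists k, c' = c.+1 + k by exists (c' - c.+1); lia.
  subst c'; elim: k h2 {hlt} => [|k IH] h2.
    rewrite addn0 in h2 *; rewrite cell_posS //; apply: hr; by exists r, c.
  have h3 : ins r (c.+1 + k) by move: h1 h2; rewrite /in_shape; lia.
  apply: rowle_trans (IH h3) _; rewrite addnS in h2 *; rewrite cell_posS //.
  by apply: hr; exists r, (c.+1 + k).
- apply/allP => c _; apply/allP => r _; apply/allP => r' _; apply/implyP => /andP[/andP[h1 h2] hlt].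
  rewrite !entry_rows_of // colle_letters ?hp //.
  have [k ek] : exists k, r' = r.+1 + k by exists (r' - r.+1); lia.
  subst r'; elim: k h2 {hlt} => [|k IH] h2.
    rewrite addn0 in h2 *; apply: hc; by exists r, c.
  have h3 : ins (r.+1 + k) c.
    have := @lam_mono (r.+1 + k) (r.+1 + k.+1) ltac:(lia) (ins_lt h2).
    have hm : 0 < m (r.+1 + k) -> r.+1 + k + m (r.+1 + k) <= r + m r.
      by apply: mu_mono => //; lia.
    by move: h1 h2; rewrite /in_shape; case: (posnP (m (r.+1 + k))) hm => [->|_ /(_ isT)]; lia.
  apply: colle_trans (IH h3) _; rewrite addnS in h2 *.
  by apply: hc; exists (r.+1 + k), c.
Qed.

Lemma rowle_olt a b : 0 < idx a -> 0 < idx b -> rowle (lval a) (lval b) = olt a b.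
Proof.
case: a b => k p [k' p'] /=; rewrite /rowle /olt /lval /idx /primed /= => h h'.
by case: p; case: p' => /=; lia.
Qed.

Lemma colle_olt a b : 0 < idx a -> 0 < idx b -> colle (lval a) (lval b) = ~~ olt b a.
Proof.
case: a b => k p [k' p'] /=; rewrite /colle /olt /lval /idx /primed /= => h h'.
by case: p; case: p' => /=; lia.
Qed.

(** A lower entry is read before an upper one, so each row and column condition is one comparison
    [olt] of an earlier with a later letter, and such comparisons belong to the order pattern. *)
Lemma good_sim n v v' : size v = shape_size -> simr olt (rev v) (rev v') ->
  all (fun a => 1 <= idx a <= n) v' -> good n v -> good n v'.
Proof.
move=> sz /(simrP _ l1)[e h] ha' [ha hr hc]; rewrite !size_rev in e h.
have hpos w k : all (fun a => 1 <= idx a <= n) w -> k < size w -> 0 < idx (nth l1 w k).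
  by move=> hw hk; have /andP[] := allP hw _ (mem_nth l1 hk).
have olts p q : p < q < size v -> olt (nth l1 v p) (nth l1 v q) = olt (nth l1 v' p) (nth l1 v' q).
  move=> hpq; have /andP[pq hq] := hpq; have := h (size v - q.+1) (size v - p.+1).
  have lt k : size v - k.+1 < size v by clear -hq; lia.
  have bk k : k < size v -> size v - (size v - k.+1).+1 = k by clear; lia.
  have hp := ltn_trans pq hq.
  by rewrite !nth_rev -?e ?lt // !bk //; apply; lia.
split=> //.
- move=> p hp; have hN := hadj_lt hp; have := hr p hp; rewrite -sz in hN.
  have hp0 : p < size v by exact: ltn_trans hN.
  by rewrite !rowle_olt ?hpos -?e // olts // ltnSn hN.
- move=> p q hpq; have hN := vadj_lt hpq; have := hc p q hpq; rewrite -sz in hN.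
  have /andP[pq hq] := hN; have hp := ltn_trans pq hq.
  by rewrite !colle_olt ?hpos -?e // olts.
Qed.
End Shape.

Section Lift.
Implicit Types (s v t X Y Z : seq letter) (b : bool).

(** * The operators on words in all letters *)

Definition raw i X : seq sletter := rev (map (dec i) (filter (in_i i) X)).
(** What the operators of index i leave untouched: the other letters, with a hole for each letter
    they may change. *)
Definition skel i X : seq (option letter) := [seq (if in_i i c then None else Some c) | c <- X].

Lemma dec_down i a : in_i i a -> in_i 1 (down i a) /\ dec 1 (down i a) = dec i a.
Proof.
case: a => k p; rewrite /in_i /down /dec /= => /orP[] /eqP ->.
  by rewrite subnn (_ : (i == i.+1) = false) //; lia.
by rewrite subSn // subnn !eqxx.
Qed.

Lemma up_down i a : 0 < i -> in_i i a -> up i (down i a) = a.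
Proof. by move=> i0; case: a => k p; rewrite /in_i /up /down /= => /orP[] /eqP ->; congr (_, _); lia. Qed.

Lemma down_up i c : 0 < i -> in_i 1 c -> in_i i (up i c) /\ down i (up i c) = c.
Proof.
by move=> i0; case: c => k p; rewrite /in_i /up /down /= => /orP[] /eqP ->; split; [lia|congr (_, _); lia|lia|congr (_, _); lia].
Qed.

Lemma all12_subword i X : all12 (subword i X).
Proof.
by apply/allP => c /mapP[a]; rewrite mem_filter => /andP[h _] ->; case: (dec_down h).
Qed.

Lemma rdec_subword i X : rdec (subword i X) = raw i X.
Proof.
rewrite /rdec /raw /subword -map_comp; congr rev; apply/eq_in_map => a.
by rewrite mem_filter => /andP[/dec_down[]].
Qed.

Lemma subword_rcons i X a :
  subword i (rcons X a) = if in_i i a then rcons (subword i X) (down i a) else subword i X.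
Proof. by rewrite /subword filter_rcons; case: ifP; rewrite ?map_rcons. Qed.

Lemma skel_rcons i X a : skel i (rcons X a) = rcons (skel i X) (if in_i i a then None else Some a).
Proof. by rewrite /skel map_rcons. Qed.

Lemma subword_merge i X t : 0 < i -> all12 t -> size t = size (subword i X) ->
  subword i (merge_back i X t) = t /\ skel i (merge_back i X t) = skel i X.
Proof.
move=> i0; elim: X t => [|a X IH] t /=; first by move=> _ /size0nil ->.
rewrite /subword /=; case: ifP => ha; last first.
  by move=> ht e; have [h1 h2] := IH t ht e; rewrite /subword /= ha /= -/(subword _ _) h1 h2.
case: t => [|c t] //= /andP[hc ht] [e]; have [h1 h2] := IH t ht e.
by have [h3 h4] := down_up i0 hc; rewrite h3 /= -/(subword _ _) h1 h2 h4.
Qed.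

Lemma seen_subword i X a : in_i i a -> seen (subword i X) (idx (down i a)) = seen X (idx a).
Proof.
move=> ha; rewrite /seen /subword has_map has_filter -has_filter.
elim: X => //= c X IH; case: (boolP (in_i i c)) => hc /=; rewrite IH.
  congr (_ || _); clear IH; move: ha hc; rewrite /in_i /down; case: a => k p; case: c => k' p' /=.
  by move=> h1 h2; apply/eqP/eqP; move: h1 h2; lia.
by have -> : (idx c == idx a) = false by apply/eqP => e; move: hc; rewrite /in_i e -/(in_i i a) ha.
Qed.

Lemma subword_canon i X : subword i (canon X) = canon (subword i X).
Proof.
elim/last_ind: X => // X a IH; rewrite canon_rcons !subword_rcons.
have -> : in_i i (if seen X (idx a) then a else (idx a, false)) = in_i i a by case: ifP.
case: (boolP (in_i i a)) => ha //.
by rewrite canon_rcons seen_subword // -IH; case: ifP.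
Qed.

Lemma skel_seen i X Z k : skel i X = skel i Z -> (k == i) || (k == i.+1) = false -> seen X k = seen Z k.
Proof.
move=> + hk; elim: X Z => [|a X IH] [|c Z] //= [h /IH ->]; congr (_ || _).
move: h; rewrite /in_i; case: ifP => h1; case: ifP => h2 //.
  by move=> _; apply/eqP/eqP => e; [move: h1 | move: h2]; rewrite e hk.
by case=> ->.
Qed.

Lemma skel_canon i X Z : canon X = X -> skel i Z = skel i X -> skel i (canon Z) = skel i X.
Proof.
elim/last_ind: X Z => [|X a IH] Z; first by case: Z.
case: (lastP Z) => [|{}Z c]; first by rewrite skel_rcons => _ /(congr1 size); rewrite size_rcons.
rewrite !canon_rcons => /rcons_inj[eX ea]; rewrite !skel_rcons => /rcons_inj[eZ ec].
rewrite (IH Z) //; congr rcons; move: ec.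
have -> : in_i i (if seen Z (idx c) then c else (idx c, false)) = in_i i c by case: ifP.
case: (boolP (in_i i c)) => hc; case: (boolP (in_i i a)) => ha // [e]; subst c.
by rewrite (skel_seen eZ) ?ea //; move: ha; rewrite /in_i => /negbTE.
Qed.

Lemma skel_subword_inj i X Y : 0 < i -> skel i X = skel i Y -> subword i X = subword i Y -> X = Y.
Proof.
move=> i0; elim: X Y => [|a X IH] [|c Y] //= [e1 e2]; rewrite /subword /=.
case: ifP e1 => ha; case: ifP => hc //= e1.
  by case=> h1 h2 h3; rewrite -(up_down i0 ha) -(up_down i0 hc) /down h1 h2 (IH _ e2 h3).
by case: e1 => -> /(IH _ e2) ->.
Qed.

Definition W i X := nf (raw i X).

Lemma W_canon i X : W i (canon X) = W i X.
Proof. by rewrite /W -!rdec_subword subword_canon nf_rdec_canon // all12_subword. Qed.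

Lemma canon_ext i X Y : 0 < i -> canon X = X -> canon Y = Y -> skel i X = skel i Y -> W i X = W i Y -> X = Y.
Proof.
move=> i0 cX cY es eW; apply: (skel_subword_inj i0 es).
rewrite -cX -cY !subword_canon; apply/canon_nf; rewrite ?all12_subword //.
by rewrite !rdec_subword.
Qed.

Definition opL (o : opname) := match o with
  | OpF => flip false | OpE => flip true | OpF' => flipP false | OpE' => flipP true end.

Lemma size_cnt (w : seq sletter) : size w = cnt false w + cnt true w.
Proof. by rewrite /cnt; elim: w => //= -[[] f] w ->; lia. Qed.

Lemma opL_size o w w' : nfp w -> opL o w = Some w' -> size w' = size w.
Proof.
move=> nw; have aux b : moved b w w' -> size w' = size w.
  by case=> _ _ _; rewrite !size_cnt; case: b => /=; lia.
by case: o => /= h; [apply: (aux false); apply: flip_moved | apply: (aux true); apply: flip_moved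
 | apply: (aux false); apply: flipP_moved | apply: (aux true); apply: flipP_moved].
Qed.

Lemma op_word_spec o s : all12 s ->
  if op_word o s is Some t then all12 t /\ opL o (nf (rdec s)) = Some (nf (rdec t))
  else opL o (nf (rdec s)) = None.
Proof.
move=> hs; case: o => /=.
- exact: (crit_op_flip false hs).
- exact: (crit_op_flip true hs).
- by have := primefor_flipP false hs; rewrite /primefor; case: F'w => // t [h1 _ h2].
- by have := primefor_flipP true hs; rewrite /primefor; case: E'w => // t [h1 _ h2].
Qed.

(** A canonical word is determined by its skeleton and the normal form of its subword; an operator
    keeps the former and acts on the latter by [opL]. *)
Lemma TopP o i X Y : 0 < i -> canon X = X ->
  Top o i X = Some Y <-> [/\ canon Y = Y, skel i Y = skel i X & opL o (W i X) = Some (W i Y)].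
Proof.
move=> i0 cX; rewrite /Top /lift_op.
have := op_word_spec o (all12_subword i X); rewrite rdec_subword -/(W i X).
case E: op_word => [t|] h; last by split=> // -[_ _]; rewrite h.
case: h => ht h.
have st : size t = size (subword i X).
  by have := opL_size (nf_nfp _) h; rewrite !size_nf -rdec_subword !size_rdec.
have [m1 m2] := subword_merge i0 ht st.
have WZ : W i (canon (merge_back i X t)) = nf (rdec t) by rewrite W_canon /W -rdec_subword m1.
have sZ : skel i (canon (merge_back i X t)) = skel i X by apply: skel_canon.
split=> [[<-]|[c1 c2 c3]]; first by rewrite canonK sZ WZ h.
congr Some; apply: (canon_ext i0); rewrite ?canonK ?sZ ?c2 // WZ.
by move: c3; rewrite h => -[].
Qed.

(** Equal operators commute trivially and inverse pairs return to [w]; every other pair consists of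
    one primed and one unprimed operator. *)
Lemma opL_comm o1 o2 (w a c u v : seq sletter) : nfp w ->
  opL o2 w = Some a -> opL o1 a = Some u -> opL o1 w = Some c -> opL o2 c = Some v -> u = v.
Proof.
move=> nw; have sameop o : opL o w = Some a -> opL o a = Some u -> opL o w = Some c -> opL o c = Some v -> u = v.
  by move=> -> E1 [<-]; rewrite E1 => -[].
have inv b : flip b w = Some a -> flip (~~ b) a = Some u -> flip (~~ b) w = Some c -> flip b c = Some v -> u = v.
  move=> /(flipK nw) -> [<-] /(flipK nw); rewrite negbK => -> [<-] //.
have invP b : flipP b w = Some a -> flipP (~~ b) a = Some u -> flipP (~~ b) w = Some c -> flipP b c = Some v -> u = v.
  move=> /(flipPK nw) -> [<-] /(flipPK nw); rewrite negbK => -> [<-] //.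
have com b (a' c' u' v' : seq sletter) : flip b w = Some a' -> flipP b a' = Some u' -> flipP b w = Some c' -> flip b c' = Some v' -> u' = v'.
  by move=> E1 E2 E3 E4; have := flip_flipP_comm nw E1 E3; rewrite E2 E4 => -[].
have com2 b (a' c' u' v' : seq sletter) : flip b w = Some a' -> flipP (~~ b) a' = Some u' -> flipP (~~ b) w = Some c' -> flip b c' = Some v' -> u' = v'.
  by move=> E1 E2 E3 E4; apply: flip_flipP_comm_inv nw E1 E3 _ _ E2 E4.
case: o1; case: o2 => /= E1 E2 E3 E4; try exact: (sameop OpF); try exact: (sameop OpE);
 try exact: (sameop OpF'); try exact: (sameop OpE').
all: try exact: (inv false); try exact: (inv true); try exact: (invP false); try exact: (invP true).
all: try by [apply: (com false) E1 E2 E3 E4 | apply: (com true) E1 E2 E3 E4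
  | apply: (com2 false) E1 E2 E3 E4 | apply: (com2 true) E1 E2 E3 E4].
all: apply: esym; first [exact: (com false _ _ _ _ E3 E4 E1 E2) | exact: (com true _ _ _ _ E3 E4 E1 E2)
  | exact: (com2 false _ _ _ _ E3 E4 E1 E2) | exact: (com2 true _ _ _ _ E3 E4 E1 E2)].
Qed.

Lemma Top_comm o1 o2 i X Y1 Y2 : 0 < i -> canon X = X ->
  obind (Top o1 i) (Top o2 i X) = Some Y1 -> obind (Top o2 i) (Top o1 i X) = Some Y2 -> Y1 = Y2.
Proof.
move=> i0 cX; case E2: (Top o2 i X) => [A|] //= E1; case E3: (Top o1 i X) => [Bw|] //= E4.
have [cA sA wA] := (TopP _ _ i0 cX).1 E2; have [cB sB wB] := (TopP _ _ i0 cX).1 E3.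
have [c1 s1 w1] := (TopP _ _ i0 cA).1 E1; have [c2 s2 w2] := (TopP _ _ i0 cB).1 E4.
apply: (canon_ext i0) => //; first by rewrite s1 s2 sA sB.
exact: (opL_comm (nf_nfp _) wA w1 wB w2).
Qed.
End Lift.

(** * The critical substring inside a full word *)

Section Decomposition.
Implicit Types (V X Y : seq letter) (a c : sletter) (w t u p q z : seq sletter) (b : bool).

Fixpoint legal b q z :=
  if q is a :: q' then
    (a.2 || (1 < pos (q' ++ z) b) && (0 < pos (q' ++ z) (~~ b))) && legal b q' z
  else true.

Lemma legal_split b q1 c q2 z : legal b (q1 ++ c :: q2) z ->
  c.2 = false -> 1 < pos (q2 ++ z) b /\ 0 < pos (q2 ++ z) (~~ b).
Proof.
elim: q1 => [|a q1 IH] /= /andP[h1 h2] h; last exact: IH.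
by move: h1; rewrite h /= => /andP.
Qed.

(** Unrolled, the recursion stops at the critical substring; the letters passed over form [q], and
    the tests before the recursive calls are the condition [legal]. *)
Lemma flip_decomp b w t : nfp w -> flip b w = Some t -> exists q u u' p,
  [/\ nf (q ++ rev u ++ p) = w, nf (q ++ rev u' ++ p) = t,
      critg_spec b (pos p b) (pos p (~~ b)) u (Some u') & legal b q (rev u ++ p)].
Proof.
elim: w t => //= a w IH t /andP[jw nw].
have ea : sn a w = a :: w by rewrite sn_id //= jw.
have ext r : flip b w = Some r -> a.2 \/ 1 < pos w b /\ 0 < pos w (~~ b) ->
    exists q u u' p, [/\ nf (q ++ rev u ++ p) = a :: w, nf (q ++ rev u' ++ p) = sn a r,
      critg_spec b (pos p b) (pos p (~~ b)) u (Some u') & legal b q (rev u ++ p)].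
  move=> E h; have [q [u [u' [p [e1 e2 e3 e4]]]]] := IH _ nw E.
  exists (a :: q), u, u', p; rewrite /= e1 e2 e4 andbT; split=> //.
  by rewrite -!(pos_nf (q ++ _)) e1; case: h => [->//|[-> ->]]; rewrite orbT.
have ew := nf_id nw.
case: (eqVneq a.1 b) => ab.
  case: ifP => af.
    case: ifP => [/eqP x0 [<-]|x0].
      exists [::], [:: (b, true)], [:: (~~ b, false)], w; rewrite /= ew; split=> //.
        by rewrite -[RHS]ea; case: a ab af {jw ea ext} => j f /= -> ->.
      by rewrite x0; constructor.
    case: ifP => [/andP[/eqP x1 _]|_] h; last by move: h; osome r E; apply: ext => //; left.
    move: h; osome r E; have [q [p [aq e1 e2]]] := flipP_decomp nw E.
    have yq : pos (q ++ (b, false) :: p) b = 1 by rewrite -pos_nf e1.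
    have [eq hp] := free_block_le1 aq yq.
    exists [::], ((b, false) :: nseq (size q) (~~ b, true) ++ [:: (b, true)]),
      ((~~ b, false) :: nseq (size q) (~~ b, true) ++ [:: (b, false)]), p.
    rewrite /= !rev_crit -eq /= e1 e2; split=> //; last by rewrite eq; constructor.
    by rewrite -[RHS]ea; case: a ab af {jw ea ext} => j f /= -> ->.
  case: ifP => [/eqP y0 [<-]|y0].
    exists [::], [:: (b, false)], [:: (~~ b, true)], w; rewrite /= ew; split=> //.
      by rewrite -[RHS]ea; case: a ab af {jw ea ext} => j f /= -> ->.
    by rewrite y0; constructor.
  case: ifP => // x1; osome r E; apply: ext => //; right; lia.
have ab' : a.1 = ~~ b by case: (a.1) ab; case: (b).
case: ifP => af; first by osome r E; apply: ext => //; left.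
case: ifP => // x0; case: ifP => [/eqP y0|y0]; last first.
  by case: ifP => // x1; osome r E; apply: ext => //; right; lia.
osome r E; have [q [p [aq e1 e2]]] := flipP_decomp nw E.
have yq : pos (q ++ (b, false) :: p) (~~ b) = 0 by rewrite -pos_nf e1.
have [eq hp] := free_block_y0 aq yq.
exists [::], ((b, false) :: nseq (size q) (b, true) ++ [:: (~~ b, false)]),
  ((~~ b, false) :: nseq (size q) (b, true) ++ [:: (~~ b, true)]), p.
rewrite /= !rev_crit -eq /= e1 e2; split=> //; last by rewrite eq; constructor.
by rewrite -[RHS]ea; case: a ab' af {jw ea ext ab} => j f /= -> ->.
Qed.

Lemma raw_rcons i V (d : letter) : raw i (rcons V d) = if in_i i d then dec i d :: raw i V else raw i V.
Proof. by rewrite /raw filter_rcons; case: ifP => // _; rewrite map_rcons rev_rcons. Qed.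

Lemma raw_cat i V V' : raw i (V ++ V') = raw i V' ++ raw i V.
Proof. by rewrite /raw filter_cat map_cat rev_cat. Qed.

Lemma raw_cons i (d : letter) V : in_i i d -> raw i (d :: V) = rcons (raw i V) (dec i d).
Proof. by move=> h; rewrite /raw /= h /= rev_cons. Qed.

Lemma raw_split i V V' q c p q' c' p' :
  skel i V = skel i V' -> raw i V = q ++ c :: p -> raw i V' = q' ++ c' :: p' -> size q = size q' ->
  exists A d B A' d' B', [/\ V = A ++ d :: B, V' = A' ++ d' :: B',
    [/\ in_i i d, dec i d = c, raw i A = p & raw i B = q],
    [/\ in_i i d', dec i d' = c', raw i A' = p' & raw i B' = q'] &
    skel i A = skel i A' /\ skel i B = skel i B'].
Proof.
elim/last_ind: V V' q q' => [|V a IH] V' q q'; first by case: q.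
case: (lastP V') => [|{}V' a'] es; first by move: (congr1 size es); rewrite !size_map size_rcons.
move: es; rewrite !skel_rcons => /rcons_inj[es ea]; rewrite !raw_rcons.
case: ifP ea => ha; case: ifP => ha' // ea.
  case: q q' => [|a0 q] [|a0' q'] //=.
    move=> [<- <-] [<- <-] _; exists V, a, [::], V', a', [::].
    by rewrite !cats1.
  move=> [e0 e1] [e0' e1'] [sq].
  have [A [d [B [A' [d' [B' [h1 h2 [h3 h4 h5 h6] [h7 h8 h9 h10] [h11 h12]]]]]]]] := IH _ _ _ es e1 e1' sq.
  exists A, d, (rcons B a), A', d', (rcons B' a'); rewrite h1 h2 !raw_rcons ha ha' !skel_rcons ha ha' h12 h6 h10 e0 e0'.
  by rewrite !rcons_cat !rcons_cons.
move=> e1 e1' sq; case: ea => ea; subst a'.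
have [A [d [B [A' [d' [B' [h1 h2 [h3 h4 h5 h6] [h7 h8 h9 h10] [h11 h12]]]]]]]] := IH _ _ _ es e1 e1' sq.
exists A, d, (rcons B a), A', d', (rcons B' a); rewrite h1 h2 !raw_rcons ha !skel_rcons ha h12 h6 h10.
by rewrite !rcons_cat !rcons_cons.
Qed.

Lemma skel_raw_inj i V V' : 0 < i -> skel i V = skel i V' -> raw i V = raw i V' -> V = V'.
Proof.
move=> i0 es er; apply: (skel_subword_inj i0 es).
by rewrite -(rdecK (all12_subword i V)) -(rdecK (all12_subword i V')) !rdec_subword er.
Qed.
End Decomposition.

(** * Walk and moves at the positions of a word *)

Section Instance.
Implicit Types (V : seq letter) (w t u p q z : seq sletter) (b : bool).

(* Values outside the word are 0, which lies below every letter. *)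
Definition val V k := if k < size V then lval (nth l1 V k) else 0.

Lemma val_cat V V' k : size V <= k -> val (V ++ V') k = val V' (k - size V).
Proof.
move=> h; rewrite /val size_cat nth_cat (ltnNge k (size V)) h /=.
by rewrite (_ : (k < size V + size V') = (k - size V < size V')) //; lia.
Qed.

Lemma val_catl V V' k : k < size V -> val (V ++ V') k = val V k.
Proof. by move=> h; rewrite /val size_cat nth_cat h ltn_addr. Qed.

Section Walk.
Variable i : nat.
Hypothesis i0 : 0 < i.
Local Notation a := (i.*2.-1).

Definition code (c : sletter) := if c.1 then (if c.2 then 3 else 2) else (if c.2 then 0 else 1).

Lemma lval_code d : in_i i d -> lval d = a + code (dec i d).
Proof.
case: d => k e; rewrite /in_i /lval /code /dec /idx /primed /=.
case: eqP => [->|_] /=; first by rewrite (_ : (i == i.+1) = false); [case: e => /=; lia | lia].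
by move=> /eqP ->; rewrite eqxx; case: e => /=; lia.
Qed.

Lemma between_in d : between a (lval d) = in_i i d.
Proof.
by case: d => k e; rewrite /between /in_i /lval /idx /=; case: e => /=; lia.
Qed.

Definition wx b V k := pos (raw i (take k V)) b.

Lemma raw_take_step V k : raw i (take k.+1 V) =
  if between a (val V k) then dec i (nth l1 V k) :: raw i (take k V) else raw i (take k V).
Proof.
rewrite /val; case: ltnP => hk; last first.
  have -> : between a 0 = false by rewrite /between; lia.
  by rewrite !take_oversize // leqW.
by rewrite (take_nth l1 hk) raw_rcons between_in.
Qed.

Lemma val_between V k : between a (val V k) -> k < size V /\ val V k = a + code (dec i (nth l1 V k)).
Proof.
rewrite /val; case: ifP => hk; last by rewrite /between => h; exfalso; lia.
by rewrite between_in => h; rewrite lval_code.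
Qed.

Lemma code_inj c c' : code c = code c' -> c = c'.
Proof. by case: c => -[] []; case: c' => -[] []. Qed.

Lemma val_code V k c : val V k = a + code c -> between a (val V k) /\ dec i (nth l1 V k) = c.
Proof.
move=> e; have h : between a (val V k) by rewrite e /between /code; case: c {e} => -[] [] /=; lia.
split=> //; have [_ e2] := val_between h; apply: code_inj; lia.
Qed.

Lemma wx_start V : wx false V 0 = 0 /\ wx true V 0 = 0.
Proof. by rewrite /wx take0. Qed.

Lemma wx_step1' V k : val V k = a -> wx false V k.+1 = (wx false V k).+1 /\ wx true V k.+1 = wx true V k.
Proof.
move=> e; have [hb hd] : between a (val V k) /\ dec i (nth l1 V k) = (false, true).
  by apply: val_code; rewrite e /code /= addn0.
by rewrite /wx raw_take_step hb hd.
Qed.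

Lemma wx_step2 V k : val V k = a + 3 -> wx false V k.+1 = wx false V k /\ wx true V k.+1 = (wx true V k).+1.
Proof.
move=> e; have [hb hd] : between a (val V k) /\ dec i (nth l1 V k) = (true, true) by apply: val_code.
by rewrite /wx raw_take_step hb hd.
Qed.

Lemma wx_step1 V k : val V k = a.+1 -> if (0 < wx false V k) && (0 < wx true V k)
  then wx false V k.+1 = wx false V k /\ (wx true V k.+1).+1 = wx true V k
  else wx false V k.+1 = (wx false V k).+1 /\ wx true V k.+1 = wx true V k.
Proof.
move=> e; have [hb hd] : between a (val V k) /\ dec i (nth l1 V k) = (false, false).
  by apply: val_code; rewrite e /code /= addn1.
rewrite /wx raw_take_step hb hd /=.
by case: (pos _ false) => [|x]; case: (pos _ true) => [|y] //=; rewrite ?subn0 ?subn1.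
Qed.

Lemma wx_step2' V k : val V k = a.+2 -> if (0 < wx false V k) && (0 < wx true V k)
  then (wx false V k.+1).+1 = wx false V k /\ wx true V k.+1 = wx true V k
  else wx false V k.+1 = wx false V k /\ wx true V k.+1 = (wx true V k).+1.
Proof.
move=> e; have [hb hd] : between a (val V k) /\ dec i (nth l1 V k) = (true, false).
  by apply: val_code; rewrite e /code /= addn2.
rewrite /wx raw_take_step hb hd /=.
by case: (pos _ false) => [|x]; case: (pos _ true) => [|y] //=; rewrite ?subn0 ?subn1.
Qed.

Lemma wx_out V k : ~~ between a (val V k) -> wx false V k.+1 = wx false V k /\ wx true V k.+1 = wx true V k.
Proof. by move=> /negbTE h; rewrite /wx raw_take_step h. Qed.

Lemma legal_val b V0 V1 q z : raw i V0 = z -> raw i V1 = q -> legal b q z ->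
  forall k, size V0 <= k < size (V0 ++ V1) ->
  val (V0 ++ V1) k = a.+1 \/ val (V0 ++ V1) k = a.+2 ->
  1 < wx b (V0 ++ V1) k /\ 0 < wx (~~ b) (V0 ++ V1) k.
Proof.
move=> e0 e1 hl k /andP[hk hk2] hv.
have hb : between a (val (V0 ++ V1) k) by rewrite /between; case: hv => ->; lia.
have [_ ev] := val_between hb.
have c2 : (dec i (nth l1 (V0 ++ V1) k)).2 = false.
  by move: hv; rewrite ev /code; case: (dec _ _) => -[] [] /=; lia.
have es : V1 = take (k - size V0) V1 ++ nth l1 (V0 ++ V1) k :: drop (k - size V0).+1 V1.
  rewrite nth_cat ltnNge hk /= -drop_nth ?cat_take_drop //.
  by rewrite size_cat in hk2; lia.
have ha : in_i i (nth l1 (V0 ++ V1) k) by move: hb; rewrite /val hk2 between_in.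
have tk : raw i (take k (V0 ++ V1)) = raw i (take (k - size V0) V1) ++ z.
  by rewrite take_cat ltnNge hk /= raw_cat e0.
rewrite /wx tk; apply: legal_split c2.
move: hl; rewrite -e1 {1}es raw_cat raw_cons // cat_rcons; exact.
Qed.
End Walk.

Section Move.
Variable i : nat.
Hypothesis i0 : 0 < i.
Local Notation a := (i.*2.-1).

Lemma val_mid A d B k :
  val (A ++ d :: B) k = if k < size A then val A k else if k == size A then lval d else val B (k - (size A).+1).
Proof.
case: ltnP => h; first by rewrite val_catl.
rewrite val_cat //; case: eqP => [->|hk]; first by rewrite subnn.
by rewrite (_ : k - size A = (k - (size A).+1).+1) //; lia.
Qed.

Lemma val_nseq M j x k : raw i M = nseq j x -> between a (val M k) -> val M k = a + code x.
Proof.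
move=> e h; have [hk ->] := val_between i0 h.
have : dec i (nth l1 M k) \in raw i M.
  rewrite /raw mem_rev map_f // mem_filter mem_nth // andbT.
  by move: h; rewrite /val hk between_in.
by rewrite e => /nseqP[->].
Qed.

(** Equal skeletons and equal subwords make the pieces before, between and after the ends of the
    substring coincide. One-letter types give [C = E], handled by [single]; the others are handled
    by [multi]. *)
Lemma flip_move b V V' q u u' p : skel i V = skel i V' ->
  raw i V = q ++ rev u ++ p -> raw i V' = q ++ rev u' ++ p ->
  critg_spec b (pos p b) (pos p (~~ b)) u (Some u') -> legal b q (rev u ++ p) ->
  exists C E, [/\ forall k, k <> C -> k <> E -> val V' k = val V k,
    forall k, E < k < size V -> val V k = a.+1 \/ val V k = a.+2 ->
      1 < wx i b V k /\ 0 < wx i (~~ b) V k &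
    (if b then Emove else Fmove) a (val V) (wx i false V) (wx i true V) (val V') C E].
Proof.
move=> es e e' cr hl.
have single c c' : u = [:: c] -> u' = [:: c'] -> exists C,
    [/\ forall k, k <> C -> val V' k = val V k,
    forall k, C < k < size V -> val V k = a.+1 \/ val V k = a.+2 ->
      1 < wx i b V k /\ 0 < wx i (~~ b) V k &
    [/\ val V C = a + code c, val V' C = a + code c' & forall b', wx i b' V C = pos p b']].
  move=> eu eu'; subst u u'; rewrite /= in e e' hl.
  have [A [d [B [A' [d' [B' [eV eV' [h1 h2 h3 h4] [h5 h6 h7 h8] [h9 h10]]]]]]]] := raw_split es e e' erefl.
  have eA : A = A' by apply: (skel_raw_inj i0 h9); rewrite h3 h7.
  have eB : B = B' by apply: (skel_raw_inj i0 h10); rewrite h4 h8.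
  subst A' B'; exists (size A); split.
  - by move=> k /eqP/negbTE hk; rewrite eV eV' !val_mid hk.
  - move=> k hk; have eV2 : V = (A ++ [:: d]) ++ B by rewrite eV -catA.
    rewrite eV2; apply: (legal_val i0 (z := c :: p)) hl _ _ => //.
      by rewrite raw_cat h3 /raw /= h1 /= h2.
    by rewrite -eV2 size_cat /= addn1.
  - rewrite eV eV' !val_mid ltnn eqxx !(lval_code i0) // h2 h6; split=> // b'.
    by rewrite /wx take_size_cat // h3.
have multi (m z x : sletter) j (m' z' : sletter) : u = m :: nseq j x ++ [:: z] -> u' = m' :: nseq j x ++ [:: z'] -> exists C E,
    [/\ C < E, forall k, k <> C -> k <> E -> val V' k = val V k,
    forall k, E < k < size V -> val V k = a.+1 \/ val V k = a.+2 ->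
      1 < wx i b V k /\ 0 < wx i (~~ b) V k,
    forall k, C < k < E -> between a (val V k) -> val V k = a + code x &
    [/\ val V C = a + code m, val V' C = a + code m', val V E = a + code z, val V' E = a + code z'
      & forall b', wx i b' V C = pos p b']].
  move=> eu eu'; subst u u'; rewrite !rev_crit in e e' hl.
  have [A1 [d [B [A1' [d' [B' [eV eV' [h1 h2 h3 h4] [h5 h6 h7 h8] [h9 h10]]]]]]]] := raw_split es e e' erefl.
  have eB : B = B' by apply: (skel_raw_inj i0 h10); rewrite h4 h8.
  have [A [f [M [A' [f' [M' [eA1 eA1' [g1 g2 g3 g4] [g5 g6 g7 g8] [g9 g10]]]]]]]] := raw_split h9 h3 h7 erefl.
  have eA : A = A' by apply: (skel_raw_inj i0 g9); rewrite g3 g7.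
  have eM : M = M' by apply: (skel_raw_inj i0 g10); rewrite g4 g8.
  have s1 : size A1 = (size A + size M).+1 by rewrite eA1 size_cat /= addnS.
  have s1' : size A1' = (size A + size M).+1 by rewrite eA1' -eA -eM size_cat /= addnS.
  subst A' B' M'; exists (size A), (size A1); split.
  - by rewrite s1; lia.
  - move=> k /eqP/negbTE hk /eqP/negbTE hk2; rewrite eV eV' !val_mid s1' -s1 hk2.
    by case: ifP => // _; rewrite eA1 eA1' !val_mid hk.
  - move=> k hk; have eV2 : V = (A1 ++ [:: d]) ++ B by rewrite eV -catA.
    rewrite eV2; apply: (legal_val i0 (z := z :: nseq j x ++ m :: p)) hl _ _ => //.
      by rewrite raw_cat h3 /raw /= h1 /= h2.
    by rewrite -eV2 size_cat /= addn1.
  - move=> k /andP[hk1 hk2]; rewrite eV val_mid hk2 eA1 val_mid ltnNge (ltnW hk1) /= gtn_eqF //.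
    exact: val_nseq g4.
  - rewrite eV eV' !val_mid s1' -s1 ltnn eqxx (_ : size A < size A1); last by rewrite s1; lia.
    rewrite eA1 eA1' !val_mid ltnn eqxx !(lval_code i0) // h2 h6 g2 g6; split=> // b'.
    by rewrite /wx -catA take_size_cat // g3.
case: {-1}_ {-1}_ / cr (erefl u) (erefl (Some u')).
- move=> y0 eu [eu']; have [C [h1 h2 [h3 h4 h5]]] := single _ _ eu eu'.
  exists C, C; split=> //; first by move=> k hk _; apply: h1.
  case: (b) y0 h3 h4 h5; rewrite /code /= => y0 h3 h4 h5.
    by apply: E3; rewrite ?h5 ?h3 ?h4 ?addn2 ?addn0.
  by apply: F3; rewrite ?h5 ?h3 ?h4 ?addn1.
- move=> y0 eu [eu']; have [C [h1 h2 [h3 h4 h5]]] := single _ _ eu eu'.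
  exists C, C; split=> //; first by move=> k hk _; apply: h1.
  case: (b) y0 h3 h4 h5; rewrite /code /= => y0 h3 h4 h5.
    by apply: E4; rewrite ?h5 ?h3 ?h4 ?addn1.
  by apply: F4; rewrite ?h5 ?h3 ?h4 ?addn2 ?addn0.
- by [].
- move=> j hp eu [eu']; have [C [E [h0 h1 h2 hm [h3 h4 h6 h7 h5]]]] := multi _ _ _ _ _ _ eu eu'.
  exists C, E; split=> //.
  case: (b) hp hm h3 h4 h5 h6 h7; rewrite /code /= => hp hm h3 h4 h5 h6 h7.
    by apply: E1; rewrite ?h5 ?h3 ?h4 ?h6 ?h7 ?addn2 ?addn1 ?addn0.
  apply: F1; rewrite ?h5 ?h3 ?h4 ?h6 ?h7 ?addn2 ?addn1 ?addn0 //.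
  by move=> k hk /(hm k hk); rewrite addn0.
- move=> j hp eu [eu']; have [C [E [h0 h1 h2 hm [h3 h4 h6 h7 h5]]]] := multi _ _ _ _ _ _ eu eu'.
  exists C, E; split=> //.
  case: (b) hp hm h3 h4 h5 h6 h7; rewrite /code /= => hp hm h3 h4 h5 h6 h7.
    apply: E2; rewrite ?h5 ?h3 ?h4 ?h6 ?h7 ?addn2 ?addn1 ?addn0 //.
    by move=> k hk /(hm k hk); rewrite addn0.
  by apply: F2; rewrite ?h5 ?h3 ?h4 ?h6 ?h7 ?addn2 ?addn1 ?addn0.
Qed.

Lemma skel_size V V' : skel i V = skel i V' -> size V = size V'.
Proof. by move/(congr1 size); rewrite !size_map. Qed.

Lemma flip_good lam mu n b V V' q u u' p :
  strict_partition lam -> strict_partition mu -> contained mu lam ->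
  size V = shape_size lam mu -> skel i V = skel i V' ->
  raw i V = q ++ rev u ++ p -> raw i V' = q ++ rev u' ++ p ->
  critg_spec b (pos p b) (pos p (~~ b)) u (Some u') -> legal b q (rev u ++ p) ->
  all (fun d => 1 <= idx d <= n) V' -> good lam mu n V -> good lam mu n V'.
Proof.
move=> ls ms ml sz es e e' cr hl ha' [ha hr hc].
have [C [E [same lg mv]]] := flip_move es e e' cr hl.
have od : odd a by rewrite -subn1 oddB ?odd_double //; lia.
have hlt := hadj_lt ls ms ml; have vlt := vadj_lt ls ms ml.
have val1 k : k < shape_size lam mu -> val V k = lval (nth l1 V k) by rewrite -sz /val => ->.
have val2 k : k < shape_size lam mu -> val V' k = lval (nth l1 V' k).
  by rewrite -sz (skel_size es) /val => ->.
have rowx k0 : hadj lam mu k0 -> rowle (val V k0) (val V k0.+1).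
  by move=> h; have h1 := hlt _ h; rewrite !val1 ?(ltn_trans (ltnSn _) h1) //; apply: hr.
have colx k0 k1 : vadj lam mu k0 k1 -> colle (val V k1) (val V k0).
  move=> h; have /andP[h1 h2] := vlt _ _ h; rewrite !val1 ?(ltn_trans h1 h2) //; exact: hc.
have df := diag_first ls ms ml od rowx colx.
have s1 := wx_step1' i0 (V := V); have s2 := wx_step2 i0 (V := V); have s3 := wx_step1 i0 (V := V).
have s4 := wx_step2' i0 (V := V); have s5 := wx_out i0 (V := V).
rewrite sz in lg.
split=> //.
- move=> k0 h; have h1 := hlt _ h; rewrite -!val2 ?(ltn_trans (ltnSn _) h1) //.
  case: (b) lg mv => lg mv.
    apply: (E_rows od rowx hlt (wx_start i V) s1 s2 s3 s4 s5 same mv _ h).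
    by move=> k hk hv; have [] := lg k hk hv.
  exact: (F_rows od rowx hlt (wx_start i V) s1 s2 s3 s4 s5 same mv lg h).
- move=> k0 k1 h; have /andP[h1 h2] := vlt _ _ h; rewrite -!val2 ?(ltn_trans h1 h2) //.
  case: (b) lg mv => lg mv.
    apply: (E_cols od rowx colx vlt (vadj_left ls ms ml) (vadj_right ls ms ml) df (vadj_rows ls ms ml)
       (wx_start i V) s1 s2 s3 s4 s5 same mv _ h).
    by move=> k hk hv; have [] := lg k hk hv.
  exact: (F_cols od rowx colx vlt hlt (vadj_left ls ms ml) (vadj_right ls ms ml) df (vadj_rows ls ms ml)
       (wx_start i V) s1 s2 s3 s4 s5 same mv lg h).
Qed.
End Move.
End Instance.

(** Equivalent words differ only in primes of first occurrences, and for those [olt] never finds an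
    earlier letter of the same index. *)
Lemma simr_canon (s v : seq letter) : canon s = canon v -> simr olt (rev s) (rev v).
Proof.
elim/last_ind: s v => [|s a IH] v.
  by move/size_canon_eq; case: v.
case: (lastP v) => [/size_canon_eq|{}v c]; first by rewrite size_rcons.
move/canon_rcons_eq => [e1 e2 e3]; rewrite !rev_rcons /= IH //=.
have ei := canon_idx e1; have sc := seen_idx (idx a) ei.
have hs u : seen u (idx a) = has (fun d => idx d == idx a) (rev u) by rewrite has_rev.
have er : map idx (rev s) = map idx (rev v) by rewrite !map_rev ei.
rewrite hs in e3; rewrite !hs in sc; move: (rev s) (rev v) er e3 sc => {IH e1 ei hs}.
elim=> [|x s' IH] [|y v'] //= [exy er] e3 sc; apply/andP; split.
  rewrite /olt -e2 exy; case: (eqVneq (idx y) (idx a)) => [h|//].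
  by rewrite -e3 // exy h eqxx.
move: e3 sc; rewrite exy; case: (idx y == idx a) => /= e3 sc; last exact: IH.
apply: IH => //; first by move=> _; apply: e3.
by rewrite -!(has_map idx (pred1 (idx a))) er.
Qed.

Lemma all_idx_canon (P : pred nat) s v : canon s = canon v ->
  all (fun d => P (idx d)) s = all (fun d => P (idx d)) v.
Proof. by move/canon_idx => e; rewrite -!(all_map idx P) e. Qed.

(** * Stability of tableaux and the crystal axioms *)

Section Closure.
Variables (n : nat) (lam mu : seq nat).
Hypotheses (ls : strict_partition lam) (ms : strict_partition mu) (ml : contained mu lam).

Lemma good_canon v v' : size v = shape_size lam mu -> canon v = canon v' ->
  good lam mu n v -> good lam mu n v'.
Proof.
move=> sz e g; apply: (good_sim ls ms ml sz) (g); first exact: simr_canon.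
have [h _ _] := g; move: h; exact: etrans (esym (all_idx_canon (fun k => 1 <= k <= n) e)).
Qed.

(** If one representative is a valid filling then all are, in particular the canonical one, because
    [good] depends only on the order pattern and the indices. *)
Lemma inBP s : inB n lam mu s <-> [/\ canon s = s, size s = shape_size lam mu & good lam mu n s].
Proof.
rewrite /inB; split.
  case/and3P=> /eqP c /eqP sz /hasP[v /repsP e hv]; split=> //.
  have sv : size v = shape_size lam mu by rewrite (size_canon_eq e).
  by apply: (good_canon sv e); apply/(valid_good ls ms ml n sv).
case=> c sz g; apply/and3P; split; [exact/eqP | exact/eqP |].
apply/hasP; exists s; first exact/repsP.
exact/(valid_good ls ms ml n sz).
Qed.

Lemma olt_dec_in i c d : in_i i c -> in_i i d -> olt c d = soltn (dec i c) (dec i d).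
Proof.
case: c => k p; case: d => k' p'; rewrite /in_i /olt /soltn /dec /idx /primed /=.
have ne : (i == i.+1) = false by rewrite ltn_eqF.
have ne' : (i.+1 == i) = false by rewrite gtn_eqF.
have nl : (i.+1 < i) = false by rewrite ltnNge leqnSn.
by move=> /orP[] /eqP-> /orP[] /eqP->; rewrite ?eqxx ?ltnn ?ltnSn ?ne ?ne' ?nl /=; case: p; case: p'.
Qed.

Lemma olt_skel i c c' d : ~~ in_i i d -> in_i i c -> in_i i c' -> olt c d = olt c' d /\ olt d c = olt d c'.
Proof.
case: c => k p; case: c' => k' p'; case: d => k0 p0; rewrite /in_i /olt /idx /primed /=.
move=> h0 h h'; have e1 : (k < k0) = (k' < k0) by lia.
have e2 : (k0 < k) = (k0 < k') by lia.
have e3 : (k == k0) = false by lia. have e4 : (k' == k0) = false by lia.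
by rewrite e1 e2 (eq_sym k0) e3 (eq_sym k0 k') e4.
Qed.

(** Pairs of letters of index i or i + 1 are controlled by [raw]. In a pair with any other letter
    the two indices are indistinguishable, since no index lies between them. *)
Lemma simr_skel i X Y : skel i X = skel i Y -> simr soltn (raw i X) (raw i Y) -> simr olt (rev X) (rev Y).
Proof.
elim/last_ind: X Y => [|X a IH] Y; first by case: Y.
case: (lastP Y) => [/(congr1 size)|{}Y c]; first by rewrite !size_map size_rcons.
rewrite !skel_rcons => /rcons_inj[es eac]; rewrite !raw_rcons !rev_rcons => h.
have {}IH : simr olt (rev X) (rev Y).
  apply: IH => //; move: h; case: ifP eac => ha; case: ifP => hc //= _.
  by case/andP.
rewrite /= IH /= {IH}; case: ifP eac h => ha; case: ifP => hc //= eac.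
  case/andP=> _; rewrite /raw -!(map_rev (dec i)) -!filter_rev.
  have : skel i (rev X) = skel i (rev Y) by rewrite /skel !map_rev; congr rev.
  elim: (rev X) (rev Y) => [|x X' IH] [|y Y'] //= [exy er].
  case: ifP exy => hx; case: ifP => hy //= exy.
    by case/andP=> h1 h2; rewrite !(olt_dec_in (i := i)) // h1 IH.
  case: exy => <- h; rewrite IH // andbT.
  by have [_ ->] := olt_skel (negbT hx) ha hc.
case: eac => <- _; have : skel i (rev X) = skel i (rev Y) by rewrite /skel !map_rev; congr rev.
elim: (rev X) (rev Y) => [|x X' IH] [|y Y'] //= [exy er]; rewrite IH // andbT.
case: ifP exy => hx; case: ifP => hy //=; last by move=> [->].
move=> _; have [-> _] := olt_skel (negbT ha) hx hy; exact: eqxx.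
Qed.

Lemma idx_skel i X Y : 0 < i < n -> skel i X = skel i Y ->
  all (fun d => 1 <= idx d <= n) X -> all (fun d => 1 <= idx d <= n) Y.
Proof.
move=> hi; elim: X Y => [|x X IH] [|y Y] //= [exy /IH {}IH] /andP[hx /IH ->]; rewrite andbT.
case: ifP exy => h; case: ifP => h' //; last by move=> [<-].
by move=> _; move: h'; rewrite /in_i; lia.
Qed.

Lemma flipP_closed i b X Y : 0 < i < n -> skel i Y = skel i X -> flipP b (W i X) = Some (W i Y) ->
  size X = shape_size lam mu -> good lam mu n X -> good lam mu n Y.
Proof.
move=> hi es E sz g; apply: (good_sim ls ms ml sz) (g).
  by apply: (simr_skel (esym es)); have := flipP_sim (nf_nfp _) E; rewrite simr_nfs.
by have [h _ _] := g; apply: idx_skel hi (esym es) h.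
Qed.

(** The substring is literally present only in suitable representatives [V] of [X] and [V'] of [Y];
    the tableau conditions pass from [X] to [V], through the move to [V'], and on to [Y]. *)
Lemma flip_closed i b X Y : 0 < i < n -> canon X = X -> canon Y = Y -> skel i Y = skel i X ->
  flip b (W i X) = Some (W i Y) -> size X = shape_size lam mu -> good lam mu n X -> good lam mu n Y.
Proof.
move=> hi cX cY es E sz g; have i0 : 0 < i by case/andP: hi.
have [q [u [u' [p [e1 e2 e3 e4]]]]] := flip_decomp (nf_nfp _) E.
set z := q ++ rev u ++ p in e1; set z' := q ++ rev u' ++ p in e2.
have lift (w : seq sletter) Z : skel i Z = skel i X -> nf w = W i Z -> canon Z = Z ->
    exists V, [/\ skel i V = skel i X, raw i V = w & canon V = Z].
  move=> eZ ew cZ; have sw : size (renc w) = size (subword i Z).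
    by rewrite /renc size_rev size_map -[LHS]size_nf ew size_nf -rdec_subword size_rdec.
  have [m1 m2] := subword_merge i0 (all12_renc w) sw; exists (merge_back i Z (renc w)).
  have er : raw i (merge_back i Z (renc w)) = w by rewrite -rdec_subword m1 rencK.
  split; [by rewrite m2 | exact: er |].
  apply: (canon_ext i0); rewrite ?canonK //; first exact: skel_canon.
  by rewrite W_canon /W er.
have [V [sV rV cV]] := lift z X erefl e1 cX; have [V' [sV' rV' cV']] := lift z' Y es e2 cY.
have szV : size V = shape_size lam mu by rewrite (skel_size sV).
have gV : good lam mu n V by apply: good_canon g; rewrite ?cV.
have szV' : size V' = shape_size lam mu by rewrite (skel_size sV').
apply: (good_canon szV'); first by rewrite cV' cY.
have sVV : skel i V = skel i V' by rewrite sV sV'.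
apply: (flip_good i0 ls ms ml szV sVV rV rV' e3 e4 _ gV).
by have [h _ _] := gV; apply: idx_skel hi sVV h.
Qed.

Lemma Top_closed o i X Y : 0 < i < n -> inB n lam mu X -> Top o i X = Some Y -> inB n lam mu Y.
Proof.
move=> hi /inBP[cX sz g]; have i0 : 0 < i by case/andP: hi.
move/(TopP _ _ i0 cX) => [cY es E]; apply/inBP; split=> //; first by rewrite (skel_size es).
case: o E => /= E; by [apply: flip_closed E sz g | apply: flipP_closed E sz g].
Qed.

Lemma eps_pos i X : eps_ i X = pos (W i X) true.
Proof. by rewrite /eps_ walk_pos ?all12_subword // rdec_subword pos_nf. Qed.

Lemma phi_pos i X : phi_ i X = pos (W i X) false.
Proof. by rewrite /phi_ walk_pos ?all12_subword // rdec_subword pos_nf. Qed.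

Lemma wt_cnt i X b : wt X (if b then i.+1 else i) = cnt b (W i X).
Proof.
rewrite cnt_nf /cnt /raw count_rev count_map count_filter /wt.
apply: eq_count => d /=; rewrite /in_i; case: (b) => /=.
  by case: (idx d == i.+1); rewrite ?orbT.
case: (eqVneq (idx d) i) => [->|_] /=; first by rewrite ltn_eqF.
by case: (idx d == i.+1).
Qed.

Lemma wt_skel i X Y j : j != i -> j != i.+1 -> skel i X = skel i Y -> wt X j = wt Y j.
Proof.
move=> h1 h2; rewrite /wt; elim: X Y => [|x X IH] [|y Y] //= [exy /IH ->]; congr (_ + _).
have aux d : in_i i d -> (idx d == j) = false.
  by move=> hd; apply/eqP => e; move: hd; rewrite /in_i e (negbTE h1) (negbTE h2).
by case: ifP exy => hx; case: ifP => hy //; [rewrite !aux | move=> [->]].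
Qed.

Definition raises (o : opname) := match o with OpE | OpE' => true | _ => false end.
Definition op_inv (o : opname) := match o with OpF => OpE | OpE => OpF | OpF' => OpE' | OpE' => OpF' end.

Lemma opL_moved o w t : nfp w -> opL o w = Some t -> moved (raises o) w t.
Proof. by case: o => nw /= h; first [exact: flip_moved h | exact: flipP_moved h]. Qed.

Lemma opL_inv o w t : nfp w -> opL o w = Some t -> opL (op_inv o) t = Some w.
Proof. by case: o => nw /= h; first [exact: (flipK nw h) | exact: (flipPK nw h)]. Qed.

Lemma Top_inv o i X Y : 0 < i -> canon X = X -> Top o i X = Some Y -> Top (op_inv o) i Y = Some X.
Proof.
move=> i0 cX /(TopP _ _ i0 cX)[cY es E]; apply/(TopP _ _ i0 cY); split=> //.
exact: opL_inv (nf_nfp _) E.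
Qed.

Lemma kashiwara_Top o i : 0 < i < n -> raises o ->
  kashiwara_K1_K2 n lam mu i (Top o i) (Top (op_inv o) i).
Proof.
move=> hi ho; have i0 : 0 < i by case/andP: hi.
have canB X : inB n lam mu X -> canon X = X by case/inBP.
have invK : op_inv (op_inv o) = o by case: (o).
split.
- by move=> X Y; apply: Top_closed.
- by move=> X Y; apply: Top_closed.
- move=> X Y /canB cX /canB cY; split=> [|/(Top_inv i0 cY)]; first exact: Top_inv.
  by rewrite invK.
- move=> X Y /canB cX _ /(TopP _ _ i0 cX)[cY es /(opL_moved (nf_nfp _))].
  rewrite ho -/(W i X) => -[_ h1 h2 h3 h4]; rewrite !eps_pos !phi_pos /= in h2 *.
  split; [lia | lia |] => j _; rewrite /alpha.
  have w0 Z := wt_cnt i Z false; have w1 Z := wt_cnt i Z true; rewrite /= in w0 w1 h4.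
  case: (eqVneq j i) => [->|n1]; first by rewrite ltn_eqF // !w0 h4; lia.
  case: (eqVneq j i.+1) => [->|n2]; first by rewrite !w1 h3; lia.
  by rewrite (wt_skel n1 n2 es); lia.
- move=> X _; rewrite eps_pos phi_pos (wt_cnt i X false) (wt_cnt i X true).
  by have := pos_balance true (W i X); rewrite /=; lia.
Qed.
End Closure.

Theorem mainTheorem6 (n : nat) (lam mu : seq nat) :
  strict_partition lam -> strict_partition mu -> contained mu lam ->
  (forall i, 1 <= i <= n.-1 ->
     forall (o1 o2 : opname) (X Y1 Y2 : seq letter), inB n lam mu X ->
       obind (Top o1 i) (Top o2 i X) = Some Y1 ->
       obind (Top o2 i) (Top o1 i X) = Some Y2 -> Y1 = Y2) /\
  (forall i, 1 <= i <= n.-1 ->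
     kashiwara_K1_K2 n lam mu i (Top OpE i) (Top OpF i) /\
     kashiwara_K1_K2 n lam mu i (Top OpE' i) (Top OpF' i)).
Proof.
move=> ls ms ml; split=> i hi.
  move=> o1 o2 X Y1 Y2 /(inBP n ls ms ml)[cX _ _]; apply: Top_comm cX.
  by case/andP: hi.
have hi' : 0 < i < n by lia.
split; [exact: (kashiwara_Top ls ms ml (o := OpE)) | exact: (kashiwara_Top ls ms ml (o := OpE'))].
Qed.
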